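(* Let $c\in(1,23/22)$, let $(X,\mathcal{B},\mu)$ be a probability space and let $T,S\colon X\to X$ be commuting measure-preserving transformations. Then for every $f,g\in L^\infty_\mu(X)$ the limit \[ \lim_{N\to\infty}\frac{1}{N}\sum_{n=1}^N f(T^{\lfloor n^c\rfloor}x)\,g(S^{\lfloor n^c\rfloor}x) \] exists in $L^2_\mu(X)$ and equals the $L^2_\mu(X)$-limit $\lim_{N\to\infty}\frac{1}{N}\sum_{n=1}^N f(T^n x)\,g(S^n x)$.
   Context: $\lfloor x\rfloor$ denotes the largest integer $\le x$. *)

(* Defs.v *)
From HB Require Import structures.
From mathcomp Require Import all_boot all_order all_algebra.
From mathcomp Require Import all_classical all_reals all_analysis.
Set Implicit Arguments. Unset Strict Implicit. Unset Printing Implicit Defensive.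
Import Order.TTheory GRing.Theory Num.Theory.
Local Open Scope classical_set_scope.
Local Open Scope ring_scope.

Definition measure_preserving {d} {X : measurableType d} {R : realType}
  (mu : {measure set X -> \bar R}) (T : X -> X) : Prop :=
  measurable_fun setT T /\
  forall A : set X, measurable A -> mu (T @^-1` A) = mu A.

Definition Linfty {d} {X : measurableType d} {R : realType}
  (mu : {measure set X -> \bar R}) (f : X -> R) : Prop :=
  measurable_fun setT f /\ (Lnorm mu +oo%E (EFin \o f) < +oo)%E.

Definition L2 {d} {X : measurableType d} {R : realType}
  (mu : {measure set X -> \bar R}) (f : X -> R) : Prop :=
  measurable_fun setT f /\ (Lnorm mu 2%:E (EFin \o f) < +oo)%E.

(* floor of a real, as a natural number (used only on nonnegative reals). *)
Definition floorn {R : realType} (x : R) : nat := `|Num.floor x|%N.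

Definition avg {X : Type} {R : realType} (a : nat -> nat) (T S : X -> X)
  (f g : X -> R) (N : nat) : X -> R :=
  fun x => N%:R^-1 * \sum_(1 <= n < N.+1) f (iter (a n) T x) * g (iter (a n) S x).

Definition L2_cvg {d} {X : measurableType d} {R : realType}
  (mu : {measure set X -> \bar R}) (F : nat -> X -> R) (h : X -> R) : Prop :=
  (fun N => Lnorm mu 2%:E (fun x => (F N x - h x)%:E)) @ \oo --> 0%E.

(* Main.v *)
Require Import Defs.
From HB Require Import structures.
From mathcomp Require Import all_boot all_order all_algebra.
From mathcomp Require Import all_classical all_reals all_analysis.
From mathcomp Require Import measurable_realfun ess_sup_inf.
From mathcomp Require Import ring lra zify.
Set Implicit Arguments. Unset Strict Implicit. Unset Printing Implicit Defensive.
Import Order.TTheory GRing.Theory Num.Theory numFieldNormedType.Exports.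
Local Open Scope classical_set_scope.
Local Open Scope ring_scope.

(** Write [F_k = f(T^k x) g(S^k x)].

    Cesaro averages of [F_k] are Cauchy by an energy decrement.  If the averages fluctuate at a scale
    [N], then [f] correlates with a dual function [D] of scale [N], the average over [n <= N] of
    [T^{-n} h . T^{-n} S^n g].  At scales much smaller than [N] the function [T^k D] is a fixed
    combination of functions moved by [S^k], so the averages attached to [D] are stable there by a
    mean ergodic theorem with uniform bounds.  Subtracting a multiple of [D] from [f] lowers its energy
    by a fixed amount, which can happen only finitely often.  As [T] need not be invertible, [f] is
    replaced by [f o T^L] with [L] large instead of applying [T^{-n}].

    For the fractional powers put [gamma = 1/c] and [K = floor((N+1)^c)].  The sum of the
    [F_{floor(n^c)}] over [n <= N] is the sum of [(ceil((k+1)^gamma) - ceil(k^gamma)) F_k] over [k < K].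
    The function [ceil] is approximated by [x + 1/2 + Psi(x)] with [Psi] a trigonometric polynomial, up to
    an error at most [cos^{2p}(pi x)].  The linear part is handled by Abel summation and the Cesaro
    limit.  The oscillating sums of [e(j k^gamma) F_k] are cut into blocks of length [N]; two applications
    of the van der Corput trick remove [f], [g] and leave sums of
    [e(j (second difference of k^gamma))], to which the Kusmin-Landau inequality applies.  The total loss
    is [(K^22 / N^23)^(1/8)], which tends to [0] exactly because [c < 23/22]. *)

(** * Positive functionals and the associated seminorm *)

(** The obstacle in the energy decrement is the order of the choices. A dual function of scale [N]
    is stable only at times much smaller than [N], so the scales must decrease from step to step,
    and a bound for all later scales is needed before the functions of those steps exist. The mean
    ergodic input is therefore metastable, with a bound that depends neither on the space nor on the
    function. It is stated for an abstract positive functional so that it also applies to a weighted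
    family of functions at once. The exponent 23/22 comes from two factors [K/N]. One is the number
    of blocks. The other is the price of the trigonometric approximation: at degree [p] its error
    has mean of order [p^(-1/2)], this mean must be small against [N/K], and the coefficients sum to
    order [p^(1/2)]. The square root of the block energy is of order [K^(3/4) N^(1/8)], and
    [(K/N)^2 K^(3/4) N^(1/8) / N] is the eighth root of [K^22 / N^23]. *)

Record mean (R : realType) (X : Type) := Mean {
  bm : (X -> R) -> Prop;
  ex : (X -> R) -> R;
  bm_cst : forall c, bm (fun=> c);
  bmD : forall u v, bm u -> bm v -> bm (fun x => u x + v x);
  bmM : forall u v, bm u -> bm v -> bm (fun x => u x * v x);
  exD : forall u v, bm u -> bm v -> ex (fun x => u x + v x) = ex u + ex v;
  exZ : forall c u, bm u -> ex (fun x => c * u x) = c * ex u;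
  ex_ge0 : forall u, bm u -> (forall x, 0 <= u x) -> 0 <= ex u }.

Definition preserves (R : realType) (X : Type) (m : mean R X) (T : X -> X) :=
  forall u, bm m u -> bm m (fun x => u (T x)) /\ ex m (fun x => u (T x)) = ex m u.

Definition nrm (R : realType) (X : Type) (m : mean R X) (u : X -> R) : R :=
  Num.sqrt (ex m (fun x => u x ^+ 2)).

Section MeanTheory.
Variables (R : realType) (X : Type) (m : mean R X).
Implicit Types (u v w : X -> R) (c : R).
Local Notation bm := (bm m).
Local Notation ex := (ex m).
Local Notation nrm := (nrm m).

Lemma bmZ c u : bm u -> bm (fun x => c * u x).
Proof. by move=> bu; apply: (bmM (bm_cst _ _) bu). Qed.

Lemma bmZr c u : bm u -> bm (fun x => u x * c).
Proof. by move=> bu; apply: (bmM bu (bm_cst _ _)). Qed.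

Lemma bmN u : bm u -> bm (fun x => - u x).
Proof.
move=> bu; rewrite (_ : (fun x => - u x) = fun x => -1 * u x); first exact: bmZ.
by apply: funext => x; rewrite mulN1r.
Qed.

Lemma bmB u v : bm u -> bm v -> bm (fun x => u x - v x).
Proof. by move=> bu bv; apply: bmD bu (bmN bv). Qed.

Lemma bmX u n : bm u -> bm (fun x => u x ^+ n).
Proof.
move=> bu; elim: n => [|n IH]; first exact: bm_cst.
rewrite (_ : (fun x => u x ^+ n.+1) = fun x => u x * u x ^+ n); first exact: bmM.
by apply: funext => x; rewrite exprS.
Qed.

Lemma bm_sum (I : Type) (r : seq I) (Q : pred I) (F : I -> X -> R) :
  (forall i, Q i -> bm (F i)) -> bm (fun x => \sum_(i <- r | Q i) F i x).
Proof.
move=> bF; elim: r => [|i r IH].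
  by under eq_fun do rewrite big_nil; exact: bm_cst.
under eq_fun do rewrite big_cons.
by case: (boolP (Q i)) => // Qi; exact: bmD (bF _ Qi) IH.
Qed.

Lemma ex_cst c : ex (fun=> c) = c * ex (fun=> 1).
Proof. by rewrite -exZ; [under [in RHS]eq_fun do rewrite mulr1|exact: bm_cst]. Qed.

Lemma exN u : bm u -> ex (fun x => - u x) = - ex u.
Proof. by move=> bu; rewrite -mulN1r -exZ//; under [in RHS]eq_fun do rewrite mulN1r. Qed.

Lemma exB u v : bm u -> bm v -> ex (fun x => u x - v x) = ex u - ex v.
Proof. by move=> bu bv; rewrite exD ?exN//; exact: bmN. Qed.

Lemma le_ex u v : bm u -> bm v -> (forall x, u x <= v x) -> ex u <= ex v.
Proof.
move=> bu bv uv; rewrite -subr_ge0 -exB//; apply: ex_ge0; first exact: bmB.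
by move=> x; rewrite subr_ge0.
Qed.

Lemma ex_sum (I : Type) (r : seq I) (Q : pred I) (F : I -> X -> R) :
  (forall i, Q i -> bm (F i)) ->
  ex (fun x => \sum_(i <- r | Q i) F i x) = \sum_(i <- r | Q i) ex (F i).
Proof.
move=> bF; elim: r => [|i r IH].
  by under eq_fun do rewrite big_nil; rewrite ex_cst mul0r big_nil.
under eq_fun do rewrite big_cons; rewrite big_cons.
case: (boolP (Q i)) => // Qi; rewrite exD ?IH//; first exact: bF.
exact: bm_sum.
Qed.

Lemma exsq_ge0 u : bm u -> 0 <= ex (fun x => u x ^+ 2).
Proof. by move=> bu; apply: ex_ge0; [exact: bmX|move=> x; exact: sqr_ge0]. Qed.

Lemma nrm_ge0 u : 0 <= nrm u.
Proof. exact: sqrtr_ge0. Qed.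

Lemma nrm_sq u : bm u -> nrm u ^+ 2 = ex (fun x => u x ^+ 2).
Proof. by move=> bu; rewrite sqr_sqrtr ?exsq_ge0. Qed.

Lemma nrmZ c u : bm u -> nrm (fun x => c * u x) = `|c| * nrm u.
Proof.
move=> bu; rewrite /nrm; under eq_fun do rewrite exprMn.
rewrite exZ; last exact: bmX.
by rewrite sqrtrM ?sqr_ge0// sqrtr_sqr.
Qed.

Lemma nrmN u : bm u -> nrm (fun x => - u x) = nrm u.
Proof. by move=> bu; rewrite /nrm; under eq_fun do rewrite sqrrN. Qed.

Lemma exsqD u v : bm u -> bm v ->
  ex (fun x => (u x + v x) ^+ 2) =
  ex (fun x => u x ^+ 2) + 2 * ex (fun x => u x * v x) + ex (fun x => v x ^+ 2).
Proof.
move=> bu bv; under eq_fun do rewrite sqrrD -mulr_natl.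
by rewrite exD ?exD ?exZ//; do ?[apply: bmD|apply: bmX|apply: bmZ|apply: bmM].
Qed.

Lemma cauchy_schwarz_ex u v : bm u -> bm v ->
  ex (fun x => u x * v x) <= nrm u * nrm v.
Proof.
move=> bu bv; set a := nrm u; set b := nrm v.
have a0 : 0 <= a by exact: nrm_ge0.
have b0 : 0 <= b by exact: nrm_ge0.
have key (s t : R) : 2 * (s * t) * ex (fun x => u x * v x) <= s ^+ 2 * a ^+ 2 + t ^+ 2 * b ^+ 2.
  have := exsq_ge0 (bmD (bmZ s bu) (bmZ (- t) bv)).
  have -> : (fun x => (s * u x + - t * v x) ^+ 2) =
      fun x => (s ^+ 2 * u x ^+ 2 + t ^+ 2 * v x ^+ 2) + - (2 * (s * t)) * (u x * v x).
    by apply: funext => x; ring.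
  have bu2 := bmX 2 bu; have bv2 := bmX 2 bv; have buv := bmM bu bv.
  rewrite exD; [|by apply: bmD; exact: bmZ|exact: bmZ].
  rewrite exD; [|exact: bmZ|exact: bmZ].
  rewrite !exZ// /a /b !nrm_sq//.
  lra.
(* When a seminorm vanishes the pair [(b, a)] gives nothing; a large multiple of the null function
   contradicts [key] instead. *)
case: (eqVneq a 0) => [a0'|an0].
  have h t := key t 1; rewrite a0' mul0r.
  rewrite leNgt; apply/negP => e0.
  have := h ((b ^+ 2 + 1) / ex (fun x => u x * v x)).
  rewrite a0' expr0n /= mulr0 add0r expr1n mul1r mulr1.
  have -> : 2 * ((b ^+ 2 + 1) / ex (fun x => u x * v x)) * ex (fun x => u x * v x) = 2 * (b ^+ 2 + 1).
    by field; rewrite gt_eqF.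
  have := sqr_ge0 b; lra.
case: (eqVneq b 0) => [b0'|bn0].
  have h t := key 1 t; rewrite b0' mulr0.
  rewrite leNgt; apply/negP => e0.
  have := h ((a ^+ 2 + 1) / ex (fun x => u x * v x)).
  rewrite b0' expr0n /= mulr0 addr0 expr1n !mul1r.
  have -> : 2 * ((a ^+ 2 + 1) / ex (fun x => u x * v x)) * ex (fun x => u x * v x) = 2 * (a ^+ 2 + 1).
    by field; rewrite gt_eqF.
  have := sqr_ge0 a; lra.
have ap : 0 < a by rewrite lt_def an0.
have bp : 0 < b by rewrite lt_def bn0.
have := key b a.
rewrite (_ : _ + _ = 2 * (b * a) * (a * b)); last by ring.
by rewrite ler_pM2l// !mulr_gt0.
Qed.

Lemma ler_norm_ex u v : bm u -> bm v -> `|ex (fun x => u x * v x)| <= nrm u * nrm v.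
Proof.
move=> bu bv; rewrite ler_norml cauchy_schwarz_ex// andbT lerNl.
rewrite -exN; last exact: bmM.
under eq_fun do rewrite -mulNr.
by rewrite -(nrmN bu); apply: cauchy_schwarz_ex => //; exact: bmN.
Qed.

Lemma ler_nrmD u v : bm u -> bm v -> nrm (fun x => u x + v x) <= nrm u + nrm v.
Proof.
move=> bu bv; rewrite -(@ler_sqr R) ?nnegrE ?addr_ge0 ?nrm_ge0//.
rewrite nrm_sq ?exsqD//; last exact: bmD.
rewrite sqrrD !nrm_sq// lerD2r lerD2l -[leRHS]mulr_natl ler_pM2l//.
exact: cauchy_schwarz_ex.
Qed.

Lemma ler_nrmB u v : bm u -> bm v -> nrm (fun x => u x - v x) <= nrm u + nrm v.
Proof. by move=> bu bv; rewrite -(nrmN bv); apply: ler_nrmD => //; exact: bmN. Qed.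

Lemma ler_nrm_triangle w u v : bm u -> bm v -> bm w ->
  nrm (fun x => u x - v x) <= nrm (fun x => u x - w x) + nrm (fun x => w x - v x).
Proof.
move=> bu bv bw; have := ler_nrmD (bmB bu bw) (bmB bw bv).
by under eq_fun do rewrite addrA subrK.
Qed.

Lemma nrm0 : nrm (fun=> 0) = 0.
Proof. by rewrite /nrm ex_cst expr0n /= mul0r sqrtr0. Qed.

Lemma ler_nrm_sum (I : Type) (r : seq I) (Q : pred I) (F : I -> X -> R) :
  (forall i, Q i -> bm (F i)) ->
  nrm (fun x => \sum_(i <- r | Q i) F i x) <= \sum_(i <- r | Q i) nrm (F i).
Proof.
move=> bF; elim: r => [|i r IH].
  by under eq_fun do rewrite big_nil; rewrite nrm0 big_nil.
under eq_fun do rewrite big_cons; rewrite big_cons.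
case: (boolP (Q i)) => // Qi.
apply: (le_trans (ler_nrmD (bF _ Qi) (bm_sum _ bF))).
by rewrite lerD2l.
Qed.

Lemma ler_nrm u v : bm u -> bm v -> (forall x, `|u x| <= `|v x|) -> nrm u <= nrm v.
Proof.
move=> bu bv uv; rewrite ler_wsqrtr//; apply: le_ex; [exact: bmX|exact: bmX|].
by move=> x; rewrite -real_normK ?num_real// -[leRHS]real_normK ?num_real// ler_sqr ?nnegrE.
Qed.

Lemma nrm_cst c : ex (fun=> 1) = 1 -> nrm (fun=> c) = `|c|.
Proof. by move=> e1; rewrite /nrm ex_cst e1 mulr1 sqrtr_sqr. Qed.

Lemma nrm_le_bound u c : ex (fun=> 1) = 1 -> bm u -> (forall x, `|u x| <= c) -> nrm u <= c.
Proof.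
move=> e1 bu uc.
(* A point is needed to know [0 <= c]. On an empty space all functions coincide, so [ex (fun=> 1)]
   would be 0. *)
have [x|nX] := pselect (exists x : X, True); last first.
  have -> : u = fun=> c by apply: funext => x; case: nX; exists x.
  have : ex (fun=> 1) = 0.
    rewrite (_ : (fun=> 1) = fun=> 0); first by rewrite ex_cst mul0r.
    by apply: funext => x; case: nX; exists x.
  by rewrite e1 => /eqP; rewrite oner_eq0.
have c0 : 0 <= c by case: x => x _; exact: le_trans (uc x).
rewrite -(ger0_norm c0) -nrm_cst//; apply: ler_nrm => //; first exact: bm_cst.
by move=> y; rewrite (ger0_norm c0).
Qed.

Lemma parallelogram u v : bm u -> bm v ->
  nrm (fun x => u x - v x) ^+ 2 = 2 * nrm u ^+ 2 + 2 * nrm v ^+ 2 - nrm (fun x => u x + v x) ^+ 2.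
Proof.
move=> bu bv; have buv := bmM bu bv.
rewrite (nrm_sq (bmB bu bv)) (nrm_sq (bmD bu bv)) !nrm_sq// (exsqD bu bv).
have -> : (fun x => (u x - v x) ^+ 2) = fun x => (u x ^+ 2 + v x ^+ 2) + -2 * (u x * v x).
  by apply: funext => x; ring.
have bu2 := bmX 2 bu; have bv2 := bmX 2 bv.
rewrite exD; [|exact: bmD|exact: bmZ].
rewrite exD// exZ//; ring.
Qed.

Section Preserving.
Variable T : X -> X.
Hypothesis pT : preserves m T.

Lemma bm_comp u : bm u -> bm (fun x => u (T x)).
Proof. by case/pT. Qed.

Lemma ex_comp u : bm u -> ex (fun x => u (T x)) = ex u.
Proof. by case/pT. Qed.

Lemma nrm_comp u : bm u -> nrm (fun x => u (T x)) = nrm u.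
Proof. by move=> bu; rewrite /nrm (ex_comp (bmX 2 bu)). Qed.

Lemma preserves_iter n : preserves m (iter n T).
Proof.
elim: n => [//|n IH] u bu; case: (pT bu) => b1 e1; case: (IH _ b1) => b2 e2.
by split=> //=; rewrite e2.
Qed.

End Preserving.
End MeanTheory.

(** * Metastable mean ergodic theorem *)

Definition cavg (R : realType) (X : Type) (S : X -> X) (v : X -> R) (N : nat) : X -> R :=
  fun x => N%:R^-1 * \sum_(1 <= n < N.+1) v (iter n S x).

Section Cesaro.
Variables (R : realType) (X : Type) (m : mean R X) (S : X -> X).
Hypothesis pS : preserves m S.
Implicit Types v w : X -> R.

Lemma bm_iter v n : bm m v -> bm m (fun x => v (iter n S x)).
Proof. exact: (bm_comp (preserves_iter pS n)). Qed.

Lemma nrm_iter v n : bm m v -> nrm m (fun x => v (iter n S x)) = nrm m v.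
Proof. exact: (nrm_comp (preserves_iter pS n)). Qed.

Lemma bm_cavg v N : bm m v -> bm m (cavg S v N).
Proof. by move=> bv; apply: bmZ; apply: bm_sum => n _; exact: bm_iter. Qed.

Lemma nrm_cavg_le v N : bm m v -> nrm m (cavg S v N) <= nrm m v.
Proof.
move=> bv; rewrite /cavg nrmZ; last by apply: bm_sum => n _; exact: bm_iter.
have [->|N0] := posnP N; first by rewrite invr0 normr0 mul0r nrm_ge0.
rewrite ger0_norm ?invr_ge0// mulrC ler_pdivrMr ?ltr0n//.
apply: le_trans (ler_nrm_sum _ _) _; first by move=> n _; exact: bm_iter.
under eq_bigr do rewrite nrm_iter//.
by rewrite sumr_const_nat subn1 /= mulr_natr.
Qed.

Lemma nrm_cavg_shift1 v N : bm m v ->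
  nrm m (fun x => cavg S (fun y => v (S y)) N x - cavg S v N x) <= 2 / N%:R * nrm m v.
Proof.
move=> bv.
have -> : (fun x => cavg S (fun y => v (S y)) N x - cavg S v N x) =
    fun x => N%:R^-1 * (v (iter N.+1 S x) - v (iter 1 S x)).
  apply: funext => x; rewrite /cavg -mulrBr -sumrB; congr (_ * _).
  rewrite (eq_bigr (fun n => v (iter n.+1 S x) - v (iter n S x))); last by [].
  by rewrite (telescope_sumr (fun n => v (iter n S x))).
have b1 := bm_iter N.+1 bv; have b2 := bm_iter 1 bv.
rewrite nrmZ; last exact: (bmB b1 b2).
rewrite ger0_norm ?invr_ge0// -mulrA mulrCA ler_wpM2l ?invr_ge0//.
apply: le_trans (ler_nrmB b1 b2) _.
by rewrite !nrm_iter//; lra.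
Qed.

Lemma nrm_cavg_shift v N n : bm m v ->
  nrm m (fun x => cavg S (fun y => v (iter n S y)) N x - cavg S v N x)
    <= 2 * n%:R / N%:R * nrm m v.
Proof.
move=> bv; elim: n => [|n IH].
  by under eq_fun do rewrite subrr; rewrite nrm0 mulr0 !mul0r.
have bn := bm_iter n bv; have bn1 := bm_iter n.+1 bv.
apply: le_trans (ler_nrm_triangle (bm_cavg N bn1) (bm_cavg N bv) (bm_cavg N bn)) _.
have := nrm_cavg_shift1 N bn; rewrite nrm_iter// => h.
have -> : (fun y => v (iter n.+1 S y)) = (fun y => v (iter n S (S y))).
  by apply: funext => y; rewrite iterSr.
apply: le_trans (lerD h IH) _.
by rewrite -natr1; lra.
Qed.

(** The inner average is a mean of shifts by [n <= N], each of which moves the outer average only at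
    its two ends. *)
Lemma nrm_cavg_cavg v N P : (0 < N)%N -> bm m v ->
  nrm m (fun x => cavg S (cavg S v N) P x - cavg S v P x) <= 2 * N%:R / P%:R * nrm m v.
Proof.
move=> N0 bv.
have -> : (fun x => cavg S (cavg S v N) P x - cavg S v P x) =
  fun x => N%:R^-1 * \sum_(1 <= n < N.+1) (cavg S (fun y => v (iter n S y)) P x - cavg S v P x).
  apply: funext => x; rewrite sumrB sumr_const_nat subn1 /= mulrBr.
  congr (_ - _); last by rewrite -[X in _ * X]mulr_natl mulKf// pnatr_eq0 -lt0n.
  rewrite /cavg -mulr_sumr -mulr_sumr mulrCA; congr (_ * (_ * _)).
  by rewrite exchange_big.
have bc n : bm m (fun x => cavg S (fun y => v (iter n S y)) P x - cavg S v P x).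
  by apply: bmB; apply: bm_cavg => //; exact: bm_iter.
rewrite nrmZ; last by apply: bm_sum.
rewrite ger0_norm ?invr_ge0// mulrC ler_pdivrMr ?ltr0n//.
apply: le_trans (ler_nrm_sum _ _) _; first by [].
have -> : 2 * N%:R / P%:R * nrm m v * N%:R = \sum_(1 <= n < N.+1) (2 * N%:R / P%:R * nrm m v).
  by rewrite sumr_const_nat subn1 /= -[RHS]mulr_natr.
rewrite big_nat_cond [leRHS]big_nat_cond; apply: ler_sum => n.
rewrite andbT => /andP[_ nN].
apply: le_trans (nrm_cavg_shift P n bv) _.
by rewrite ler_wpM2r ?nrm_ge0// ler_wpM2r ?invr_ge0// ler_wpM2l// ler_nat.
Qed.

(** [cavg S v P] is nearly the average of [cavg S v N], and averaging is a contraction. *)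
Lemma nrm_cavg_le_cavg v N P : (0 < N)%N -> bm m v ->
  nrm m (cavg S v P) <= nrm m (cavg S v N) + 2 * N%:R / P%:R * nrm m v.
Proof.
move=> N0 bv.
have bN := bm_cavg N bv; have bP := bm_cavg P bv; have bPN := bm_cavg P bN.
have -> : cavg S v P = fun x => cavg S (cavg S v N) P x - (cavg S (cavg S v N) P x - cavg S v P x).
  by apply: funext => x; ring.
apply: le_trans (ler_nrmB bPN (bmB bPN bP)) _.
by rewrite lerD// ?nrm_cavg_le// nrm_cavg_cavg.
Qed.

(** Averaging over [P] sends both short averages close to [cavg S v P], so their sum cannot be much
    shorter than twice that vector; in the parallelogram law this bounds their difference. *)
Lemma nrm_cavg_midpoint v N N' P L : (0 < N <= L)%N -> (0 < N' <= L)%N -> bm m v ->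
  2 * nrm m (cavg S v P) <=
  nrm m (fun x => cavg S v N x + cavg S v N' x) + 4 * L%:R / P%:R * nrm m v.
Proof.
move=> /andP[N0 NL] /andP[N0' NL'] bv.
have bN := bm_cavg N bv; have bN' := bm_cavg N' bv; have bP := bm_cavg P bv.
have bPN := bm_cavg P bN; have bPN' := bm_cavg P bN'.
have bb := bmD bN bN'.
have e : (fun x => 2 * cavg S v P x) = fun x => cavg S (fun y => cavg S v N y + cavg S v N' y) P x
    - ((cavg S (cavg S v N) P x - cavg S v P x) + (cavg S (cavg S v N') P x - cavg S v P x)).
  apply: funext => x; rewrite [X in _ = X - _]/cavg big_split mulrDr /=.
  by rewrite -!/(cavg _ _ _ _); ring.
rewrite -[2](@ger0_norm R)// -nrmZ// e.
apply: le_trans (ler_nrmB (bm_cavg P bb) (bmD (bmB bPN bP) (bmB bPN' bP))) _.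
rewrite lerD ?nrm_cavg_le//.
apply: le_trans (ler_nrmD (bmB bPN bP) (bmB bPN' bP)) _.
apply: le_trans (lerD (nrm_cavg_cavg P N0 bv) (nrm_cavg_cavg P N0' bv)) _.
have P0 : 0 <= (P%:R^-1 : R) * nrm m v by rewrite mulr_ge0 ?invr_ge0 ?nrm_ge0.
have hN : (N%:R : R) <= L%:R by rewrite ler_nat.
have hN' : (N'%:R : R) <= L%:R by rewrite ler_nat.
rewrite -!mulrA -mulrDr -mulrDl.
have -> : (4 : R) * (L%:R * (P%:R^-1 * nrm m v)) = 2 * ((L%:R + L%:R) * (P%:R^-1 * nrm m v)) by ring.
by rewrite ler_pM2l// ler_wpM2r// lerD.
Qed.

End Cesaro.

(* The averages stabilise on some window because their norms almost decrease along a sparse sequence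
   of scales: this bound on the scale depends neither on the space nor on the vector. *)
Lemma metastable_mean_ergodic (R : realType) (B eta : R) (F : nat -> nat) (M0 : nat) :
  0 < B -> 0 < eta ->
  exists K, forall (X : Type) (m : mean R X) (S : X -> X) (v : X -> R),
    preserves m S -> bm m v -> nrm m v <= B ->
    exists2 M, (M0 <= M <= K)%N & forall N N', (M <= N <= F M)%N -> (M <= N' <= F M)%N ->
      nrm m (fun x => cavg S v N x - cavg S v N' x) <= eta.
Proof.
move=> B0 eta0.
(* 100 = 4 * (3 + 2)^2 is what the last case of the proof, [a i < 3eB], asks for. *)
pose e := Num.min 1 ((eta / B) ^+ 2 / 100).
have e0 : 0 < e by rewrite /e lt_min ltr01 /= divr_gt0// exprn_gt0// divr_gt0.
have e1 : e <= 1 by rewrite /e ge_min lexx.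
have e2 : 100 * (e * B ^+ 2) <= eta ^+ 2.
  have : e <= (eta / B) ^+ 2 / 100 by rewrite /e ge_min lexx orbT.
  rewrite ler_pdivlMr// expr_div_n ler_pdivlMr ?exprn_gt0//; lra.
pose q := (Num.truncn (e^-1)).+1.
have q0 : 0 < (q%:R : R) by rewrite ltr0n.
have qe : q%:R^-1 <= e.
  by rewrite -[leRHS]invrK lef_pV2 ?posrE ?invr_gt0// ltW// truncnS_gt.
pose G L := maxn L (F L).
(* Consecutive scales leave room for the window from [L = q * Ms i] to [F L], separated from both by
   a factor [q >= 1/e]; the ratios of lengths are then at most [e]. *)
pose Ms := fix Ms i := if i is i'.+1 then (q * G (q * Ms i'))%N else (maxn M0 1).
have Ms0 i : (0 < Ms i)%N.
  elim: i => [|i IH] /=; first by rewrite leq_max orbT.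
  by rewrite muln_gt0 /= /G leq_max muln_gt0 IH.
have MsM i : (Ms i <= Ms i.+1)%N.
  have h : (Ms i <= q * Ms i)%N by rewrite leq_pmull.
  apply: leq_trans h _ => /=; rewrite leq_pmul2l// /G.
  by apply: leq_trans (leq_maxl _ _); rewrite leq_pmull.
have Mshomo : {homo Ms : i j / (i <= j)%N} := homo_leq leqnn leq_trans MsM.
pose n := (Num.truncn (B / (e * B))).+2.
exists (q * Ms n)%N => X m S v pS bv vB.
pose a i := nrm m (cavg S v (Ms i)).
have a0 i : 0 <= a i by exact: nrm_ge0.
have aB i : a i <= B by apply: le_trans vB; exact: nrm_cavg_le.
(* The norms lie in [[0, B]], so they cannot drop by more than [e * B] at each of [n > 1/e]
   consecutive scales. *)
have [i /andP[iN ai]] : exists i, (i < n)%N && (a i - e * B <= a i.+1).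
  apply: contrapT => nex.
  have dec i : (i <= n)%N -> a i <= B - i%:R * (e * B).
    elim: i => [|i IH] iN; first by rewrite mul0r subr0.
    have h : a i.+1 < a i - e * B.
      by rewrite ltNge; apply/negP => h; apply: nex; exists i; rewrite iN.
    apply: (le_trans (ltW h)); have := IH (ltnW iN); rewrite -natr1; lra.
  have := dec n (leqnn n); have := a0 n.
  have : B / (e * B) < n%:R by rewrite /n -natr1; apply: ltr_wpDr => //; exact: truncnS_gt.
  rewrite ltr_pdivrMr ?mulr_gt0//; lra.
pose L := (q * Ms i)%N.
exists L.
  apply/andP; split.
    apply: (@leq_trans (Ms 0)%N); first by rewrite /= leq_max leqnn.
    apply: leq_trans (Mshomo 0%N i (leq0n _)) _; by rewrite /L leq_pmull.
  by rewrite /L leq_pmul2l//; apply: Mshomo; exact: ltnW.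
move=> N N' /andP[LN NF] /andP[LN' NF'].
have L0 : (0 < L)%N by rewrite /L muln_gt0 Ms0.
have N0 : (0 < N)%N by exact: leq_trans LN.
have N0' : (0 < N')%N by exact: leq_trans LN'.
have up k : (L <= k)%N -> nrm m (cavg S v k) <= a i + 2 * (e * B).
  move=> Lk; apply: le_trans (nrm_cavg_le_cavg pS k (Ms0 i) bv) _.
  rewrite lerD2l -!mulrA ler_pM2l//.
  have k0 : 0 < (k%:R : R) by rewrite ltr0n (leq_trans L0).
  have : (Ms i)%:R / k%:R <= e.
    rewrite ler_pdivrMr//; apply: (@le_trans _ _ (e * L%:R)); last by rewrite ler_pM2l// ler_nat.
    rewrite /L natrM mulrA ler_peMl//.
    by rewrite -ler_pdivrMr// div1r.
  by move=> h; rewrite mulrA; apply: ler_pM => //; rewrite ?divr_ge0 ?nrm_ge0.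
have FL : (F L <= G L)%N by rewrite /G leq_maxr.
have mid := @nrm_cavg_midpoint R X m S pS v N N' (Ms i.+1) (G L).
have {}mid := mid _ _ bv.
rewrite N0 N0' /= (leq_trans NF FL) (leq_trans NF' FL) in mid.
have {}mid := mid isT isT.
have GL0 : (0 < G L)%N by rewrite /G leq_max L0.
have hq : 4 * (G L)%:R / (Ms i.+1)%:R * nrm m v <= 4 * (e * B).
  rewrite -!mulrA ler_pM2l// [X in X <= _]mulrA.
  apply: ler_pM; rewrite ?divr_ge0 ?nrm_ge0//.
  rewrite [Ms _]/= -/L natrM invfM mulrCA divff ?mulr1//.
  by rewrite pnatr_eq0 -lt0n.
have bN := bm_cavg pS N bv; have bN' := bm_cavg pS N' bv.
rewrite -(@ler_sqr R) ?nnegrE ?nrm_ge0 ?(ltW eta0)//.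
rewrite parallelogram//.
apply: le_trans e2.
set u := nrm m (cavg S v N) in up *.
have h1 := up _ LN; have h2 := up _ LN'.
rewrite -/u in h1.
set u' := nrm m (cavg S v N') in h2 *.
set s := nrm m (fun x => _ + _) in mid *.
have s0 : 0 <= s by exact: nrm_ge0.
have u0 : 0 <= u by exact: nrm_ge0.
have u0' : 0 <= u' by exact: nrm_ge0.
have hs : 2 * a i - 6 * (e * B) <= s.
  have : 2 * a i.+1 <= s + 4 * (e * B) by apply: le_trans mid _; rewrite lerD2l.
  lra.
have eB0 : 0 < e * B by rewrite mulr_gt0.
have eB : e * B <= B by rewrite ler_piMl// ltW.
have uu : u ^+ 2 <= (a i + 2 * (e * B)) ^+ 2 by rewrite ler_sqr ?nnegrE// addr_ge0// mulr_ge0// ltW.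
have uu' : u' ^+ 2 <= (a i + 2 * (e * B)) ^+ 2 by rewrite ler_sqr ?nnegrE// addr_ge0// mulr_ge0// ltW.
have ee : e * B * (e * B) <= e * B * B by rewrite ler_pM2l.
have aa : a i * (e * B) <= B * (e * B) by rewrite ler_pM2r.
have [hc|hc] := leP (3 * (e * B)) (a i).
  have ss : (2 * a i - 6 * (e * B)) ^+ 2 <= s ^+ 2 by rewrite ler_sqr ?nnegrE//; lra.
  nra.
have s2 := sqr_ge0 s.
have : a i * a i <= 3 * (e * B) * (3 * (e * B)).
  by apply: ler_pM => //; exact: ltW.
nra.
Qed.

(** * Weighted families, stability at a scale, and dual functions *)

Section FamilyMean.
Variables (R : realType) (X : Type) (m : mean R X) (I : finType) (w : I -> R).
Hypothesis w_ge0 : forall i, 0 <= w i.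

(** As a single functional, the family gets one window common to all indices from the mean ergodic
    theorem. Its total mass is the sum of the weights, which is why normalisation is a separate
    hypothesis and not a field of [mean]. *)
Definition family_mean : mean R (X * I).
Proof.
refine (@Mean R (X * I) (fun u => forall i, bm m (fun x => u (x, i)))
  (fun u => \sum_i w i * ex m (fun x => u (x, i))) _ _ _ _ _ _).
- by move=> c i; exact: bm_cst.
- by move=> u v bu bv i; exact: bmD.
- by move=> u v bu bv i; exact: bmM.
- by move=> u v bu bv; rewrite -big_split; apply: eq_bigr => i _; rewrite exD// mulrDr.
- by move=> c u bu; rewrite mulr_sumr; apply: eq_bigr => i _; rewrite exZ// mulrCA.
- by move=> u bu u0; apply: sumr_ge0 => i _; rewrite mulr_ge0// ex_ge0.
Defined.

Lemma preserves_family S : preserves m S -> preserves family_mean (fun p => (S p.1, p.2)).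
Proof.
move=> pS u bu; split=> [i|]; first exact: (bm_comp pS (bu i)).
by apply: eq_bigr => i _; rewrite /= (ex_comp pS (bu i)).
Qed.

Lemma iter_family (S : X -> X) n x i : iter n (fun p : X * I => (S p.1, p.2)) (x, i) = (iter n S x, i).
Proof. by elim: n => //= n ->. Qed.

Lemma nrm_family_sq u : bm family_mean u ->
  nrm family_mean u ^+ 2 = \sum_i w i * nrm m (fun x => u (x, i)) ^+ 2.
Proof. by move=> bu; rewrite nrm_sq//; apply: eq_bigr => i _; rewrite nrm_sq//; exact: bu. Qed.

End FamilyMean.

(** At times much smaller than [W], moving [s] by [T] is imitated by moving the [V i] by [S], while
    the coefficients [b i] do not see the time. Products [s (T^n x) * gam (S^n x)] then involve the
    single transformation [S]. *)
Definition stab (R : realType) (X : Type) (m : mean R X) (T S : X -> X) (W : nat) (C : R)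
    (s : X -> R) :=
  exists (I : finType) (w : I -> R) (b V : I -> X -> R),
    [/\ forall i, 0 <= w i, \sum_i w i <= C,
        forall i, bm m (b i) /\ bm m (V i),
        forall i x, `|b i x| <= 1 /\ `|V i x| <= 1 &
        forall n x, `|s (iter n T x) - \sum_i w i * (b i x * V i (iter n S x))|
          <= C * n%:R / W%:R].

Section Stable.
Variables (R : realType) (X : Type) (m : mean R X) (T S : X -> X).
Hypotheses (m1 : ex m (fun=> 1) = 1) (pT : preserves m T) (pS : preserves m S).
Hypothesis TS : forall x, T (S x) = S (T x).

Lemma iterTS k l x : iter k T (iter l S x) = iter l S (iter k T x).
Proof.
have h y : T (iter l S y) = iter l S (T y) by elim: l => //= l <-; rewrite TS.
by elim: k => //= k ->; rewrite h.
Qed.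

Lemma bm_avg a f g N : bm m f -> bm m g -> bm m (avg a T S f g N).
Proof.
move=> bf bg; apply: bmZ; apply: bm_sum => n _; apply: bmM; first exact: (bm_iter pT).
exact: (bm_iter pS).
Qed.

Lemma avgB a (f f' g : X -> R) N x :
  avg a T S (fun y => f y - f' y) g N x = avg a T S f g N x - avg a T S f' g N x.
Proof. by rewrite /avg -mulrBr -sumrB; under eq_bigr do rewrite mulrBl. Qed.

Lemma avg_iter a (f g : X -> R) N L x :
  avg a T S (fun y => f (iter L T y)) (fun y => g (iter L T y)) N x = avg a T S f g N (iter L T x).
Proof.
rewrite /avg; congr (_ * _); apply: eq_bigr => n _.
by rewrite -iterD addnC iterD iterTS.
Qed.

Lemma avg_bound a (f g : X -> R) N (A B : R) : 0 <= A -> 0 <= B -> (forall x, `|f x| <= A) ->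
  (forall x, `|g x| <= B) -> forall x, `|avg a T S f g N x| <= A * B.
Proof.
move=> A0 B0 fA gB x; rewrite /avg normrM normfV normr_nat.
have [->|N0] := posnP N; first by rewrite invr0 mul0r mulr_ge0.
rewrite mulrC ler_pdivrMr ?ltr0n//.
apply: le_trans (ler_norm_sum _ _ _) _.
apply: (@le_trans _ _ (\sum_(1 <= n < N.+1) A * B)).
  by apply: ler_sum => n _; rewrite normrM ler_pM.
by rewrite sumr_const_nat subn1 /= mulr_natr.
Qed.

Lemma stab0 W C : (0 < W)%N -> 0 <= C -> stab m T S W C (fun=> 0).
Proof.
move=> W0 C0; exists 'I_0, (fun=> 0), (fun=> fun=> 0), (fun=> fun=> 0); split => //.
- by rewrite big_ord0.
- by move=> i; split; exact: bm_cst.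
- by move=> i x; rewrite normr0.
- by move=> n x; rewrite big_ord0 subr0 normr0 divr_ge0// mulr_ge0.
Qed.

Lemma stabD W C C' s s' : stab m T S W C s -> stab m T S W C' s' ->
  stab m T S W (C + C') (fun x => s x + s' x).
Proof.
move=> [I [w [b [V [w0 wC bb bd h]]]]] [I' [w' [b' [V' [w0' wC' bb' bd' h']]]]].
exists (I + I')%type, (fun i => match i with inl i => w i | inr i => w' i end),
  (fun i => match i with inl i => b i | inr i => b' i end),
  (fun i => match i with inl i => V i | inr i => V' i end); split.
- by case.
- by rewrite big_sumType /= lerD.
- by case.
- by case.
- move=> n x; rewrite big_sumType /= opprD addrACA.
  apply: le_trans (ler_normD _ _) _.
  by rewrite mulrDl mulrDl lerD.
Qed.

Lemma stab_iter W C s L : stab m T S W C s -> stab m T S W C (fun x => s (iter L T x)).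
Proof.
move=> [I [w [b [V [w0 wC bb bd h]]]]].
exists I, w, (fun i x => b i (iter L T x)), (fun i x => V i (iter L T x)); split => //.
- by move=> i; case: (bb i) => b1 b2; split; exact: (bm_iter pT).
- move=> n x; rewrite -iterD addnC iterD.
  under eq_bigr do rewrite iterTS.
  exact: h.
Qed.

Lemma stab_weaken W W' C C' s : (0 < W' <= W)%N -> 0 <= C <= C' ->
  stab m T S W C s -> stab m T S W' C' s.
Proof.
move=> /andP[W0' WW] /andP[C0 CC] [I [w [b [V [w0 wC bb bd h]]]]].
have W0 := leq_trans W0' WW.
exists I, w, b, V; split => //; first exact: le_trans CC.
move=> n x; apply: le_trans (h n x) _; apply: ler_pM => //; first by rewrite mulr_ge0.
- by rewrite ler_wpM2r.
- by rewrite lef_pV2 ?posrE ?ltr0n// ler_nat.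
Qed.

Lemma stabZ W C a s : 0 <= a <= 1 -> stab m T S W C s -> stab m T S W C (fun x => a * s x).
Proof.
move=> /andP[a0 a1] [I [w [b [V [w0 wC bb bd h]]]]].
exists I, (fun i => a * w i), b, V; split => //.
- by move=> i; rewrite mulr_ge0.
- apply: le_trans wC; apply: ler_sum => i _; exact: ler_piMl.
- move=> n x; under eq_bigr do rewrite -mulrA.
  rewrite -mulr_sumr -mulrBr normrM (ger0_norm a0).
  by apply: le_trans (h n x); exact: ler_piMl.
Qed.

(** The dual function of the overview composed with [T^N], so that only nonnegative powers of [T]
    occur. *)
Definition dual N (h gam : X -> R) : X -> R := fun x =>
  N%:R^-1 * \sum_(1 <= n < N.+1) h (iter (N - n) T x) * gam (iter n S (iter (N - n) T x)).

Lemma bm_dual N h gam : bm m h -> bm m gam -> bm m (dual N h gam).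
Proof.
move=> bh bg; apply: bmZ; apply: bm_sum => n _; apply: bmM; first exact: (bm_iter pT).
by have := bm_iter pT (N - n) (bm_iter pS n bg).
Qed.

Lemma dual_bound N (h gam : X -> R) (C : R) : 0 <= C -> (forall x, `|h x| <= C) -> (forall x, `|gam x| <= 1) ->
  forall x, `|dual N h gam x| <= C.
Proof.
move=> C0 hC g1 x; rewrite /dual normrM normfV normr_nat.
have [->|N0] := posnP N; first by rewrite invr0 mul0r.
rewrite mulrC ler_pdivrMr ?ltr0n//.
apply: le_trans (ler_norm_sum _ _ _) _.
apply: (@le_trans _ _ (\sum_(1 <= n < N.+1) C)).
  by apply: ler_sum => n _; rewrite normrM -[leRHS]mulr1 ler_pM.
by rewrite sumr_const_nat subn1 /= mulr_natr.
Qed.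

Lemma nrm_dual N h gam : bm m h -> bm m gam -> (forall x, `|gam x| <= 1) ->
  nrm m (dual N h gam) <= nrm m h.
Proof.
move=> bh bg g1; rewrite /dual.
have b1 n : bm m (fun x => h (iter (N - n) T x)) by exact: (bm_iter pT).
have b2 n : bm m (fun x => gam (iter n S (iter (N - n) T x))).
  by have := bm_iter pT (N - n) (bm_iter pS n bg).
rewrite nrmZ; last by apply: bm_sum => n _; exact: bmM.
have [->|N0] := posnP N; first by rewrite invr0 normr0 mul0r nrm_ge0.
rewrite ger0_norm ?invr_ge0// mulrC ler_pdivrMr ?ltr0n//.
apply: le_trans (ler_nrm_sum _ _) _; first by move=> n _; exact: bmM.
apply: (@le_trans _ _ (\sum_(1 <= n < N.+1) nrm m h)).
  apply: ler_sum => n _; rewrite -[leRHS](nrm_iter pT (N - n) bh).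
  apply: ler_nrm => //; first exact: bmM.
  by move=> x; rewrite normrM -[leRHS]mulr1 ler_pM.
by rewrite sumr_const_nat subn1 /= mulr_natr.
Qed.

(** The adjoint relation: the [n]-th term on the left is the [n]-th term on the right evaluated at
    [T^(N-n) x]. *)
Lemma ex_dual N f gam h : bm m f -> bm m gam -> bm m h ->
  ex m (fun x => f (iter N T x) * dual N h gam x) =
  ex m (fun x => avg (fun n => n) T S f gam N x * h x).
Proof.
move=> bf bg bh.
have bn n : bm m (fun x => f (iter n T x) * gam (iter n S x) * h x).
  by apply: bmM => //; apply: bmM; [exact: (bm_iter pT)|exact: (bm_iter pS)].
have -> : (fun x => avg (fun n => n) T S f gam N x * h x) =
  fun x => N%:R^-1 * \sum_(1 <= n < N.+1) (f (iter n T x) * gam (iter n S x) * h x).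
  by apply: funext => x; rewrite /avg -mulrA mulr_suml.
have -> : (fun x => f (iter N T x) * dual N h gam x) =
  fun x => N%:R^-1 * \sum_(1 <= n < N.+1) (f (iter N T x) * (h (iter (N - n) T x) * gam (iter n S (iter (N - n) T x)))).
  by apply: funext => x; rewrite /dual mulrCA mulr_sumr.
have bn' n : bm m (fun x => f (iter N T x) * (h (iter (N - n) T x) * gam (iter n S (iter (N - n) T x)))).
  apply: bmM; first exact: (bm_iter pT).
  apply: bmM; first exact: (bm_iter pT).
  by have := bm_iter pT (N - n) (bm_iter pS n bg).
rewrite !exZ; [|exact: bm_sum|exact: bm_sum].
congr (_ * _); rewrite !ex_sum//.
apply: eq_big_nat => n /andP[_ nN].
rewrite -(ex_comp (preserves_iter pT (N - n)) (bn n)); congr (ex _ _).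
apply: funext => x; rewrite -iterD subnKC; last by lia.
by ring.
Qed.

(** Evaluating at [T^n x] and substituting [j + n] for the summation index puts [S^n] on [gam] and
    leaves the powers of [T] fixed. Only [n] of the [N] terms on each side have no partner. *)
Lemma stab_dual N h gam (C : R) : (0 < N)%N -> 0 < C -> bm m h -> bm m gam ->
  (forall x, `|h x| <= C) -> (forall x, `|gam x| <= 1) ->
  stab m T S N (2 * C) (dual N h gam).
Proof.
move=> N0 C0 bh bg hC g1.
exists 'I_N, (fun=> C / N%:R), (fun (k : 'I_N) x => h (iter (N - k.+1) T x) / C),
  (fun (k : 'I_N) x => gam (iter k.+1 S (iter (N - k.+1) T x))); split.
- by move=> _; rewrite divr_ge0// ltW.
- rewrite sumr_const card_ord -[X in X <= _]mulr_natr divfK; first lra.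
  by rewrite pnatr_eq0 -lt0n.
- move=> i; split; first by apply: bmZr; exact: (bm_iter pT).
  by have := bm_iter pT (N - i.+1) (bm_iter pS i.+1 bg).
- move=> i x; split => //; rewrite normrM normfV (gtr0_norm C0) ler_pdivrMr// mul1r.
  exact: hC.
- move=> n x; pose t j := h (iter (N - j) T (iter n T x)) * gam (iter j S (iter (N - j) T (iter n T x))).
  pose t' j := h (iter (N - j) T x) * gam (iter (n + j) S (iter (N - j) T x)).
  have -> : \sum_(i < N) C / N%:R * (h (iter (N - i.+1) T x) / C *
      gam (iter i.+1 S (iter (N - i.+1) T (iter n S x)))) = N%:R^-1 * \sum_(1 <= j < N.+1) t' j.
    rewrite mulr_sumr big_add1 big_mkord; apply: eq_bigr => i _.
    rewrite /t' iterTS -iterD addnC; field.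
    by move=> *; apply/andP; split; [rewrite pnatr_eq0 -lt0n|rewrite gt_eqF].
  rewrite /dual -/(t _) -mulrBr normrM normfV normr_nat.
  rewrite mulrC ler_pM2r ?invr_gt0 ?ltr0n//.
  have tC j : `|t j| <= C by rewrite /t normrM -[leRHS]mulr1 ler_pM.
  have tC' j : `|t' j| <= C by rewrite /t' normrM -[leRHS]mulr1 ler_pM.
  have bnd (a b : nat) (u : nat -> R) : (forall j, `|u j| <= C) -> `|\sum_(a <= j < b) u j| <= C * (b - a)%:R.
    move=> uC; apply: le_trans (ler_norm_sum _ _ _) _.
    apply: (@le_trans _ _ (\sum_(a <= j < b) C)); first exact: ler_sum.
    by rewrite sumr_const_nat mulr_natr.
  (* For [n > N] nothing overlaps, and the trivial bound [2C <= 2C n / N] suffices. *)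
  have [nN|Nn] := leqP n N; last first.
    apply: le_trans (ler_normB _ _) _.
    apply: le_trans (lerD (bnd _ _ _ tC) (bnd _ _ _ tC')) _.
    have : (N%:R : R) <= n%:R by rewrite ler_nat ltnW.
    rewrite subn1 /= => hN; have : C * N%:R <= C * n%:R by rewrite ler_pM2l.
    lra.
  rewrite (@big_cat_nat _ _ _ n.+1)//=.
  rewrite [X in _ - X](@big_cat_nat _ _ _ (N - n).+1) ?ltnS ?leq_subr//=.
  have -> : \sum_(n.+1 <= j < N.+1) t j = \sum_(1 <= j < (N - n).+1) t' j.
    rewrite -{1}(add1n n) big_addn subSn//.
    apply: eq_big_nat => j /andP[j1 jN]; rewrite /t /t' -!iterD.
    rewrite (_ : (N - (j + n) + n)%N = (N - j)%N); last by lia.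
    by rewrite (addnC n).
  rewrite opprD addrA addrK; apply: le_trans (ler_normB _ _) _.
  apply: le_trans (lerD (bnd _ _ _ tC) (bnd _ _ _ tC')) _.
  by rewrite !subSS subn0 subKn//; lra.
Qed.

(** Multiplication by [gam (S^n x)] turns the approximation into averages along [S] of the functions
    [V i * gam], with coefficients free of [n]. The family is treated as one vector of norm at most
    [C], so [K] depends neither on the family nor on [W]. *)
Lemma stab_metastable (C eta : R) (F : nat -> nat) (M0 : nat) : 1 <= C -> 0 < eta ->
  exists K, forall W s gam, stab m T S W C s -> bm m gam -> (forall x, `|gam x| <= 1) -> bm m s ->
    exists2 M, (M0 <= M <= K)%N & forall N N', (M <= N <= F M)%N -> (M <= N' <= F M)%N ->
      nrm m (fun x => avg (fun n => n) T S s gam N x - avg (fun n => n) T S s gam N' x)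
        <= eta + C * (N%:R + N'%:R) / W%:R.
Proof.
move=> C1 eta0; have C0 : 0 < C by exact: lt_le_trans C1.
have eC0 : 0 < eta / C by rewrite divr_gt0.
have [K HK] := @metastable_mean_ergodic R C (eta / C) F M0 C0 eC0.
exists K => W s gam [I [w [b [V [w0 wC bb bd h]]]]] bg g1 bs.
pose v : X * I -> R := fun p => V p.2 p.1 * gam p.1.
have bv : bm (family_mean m w0) v.
  by move=> i /=; apply: bmM => //; case: (bb i).
(* The squared norm is at most the total weight, and [C <= C^2]. *)
have nv : nrm (family_mean m w0) v <= C.
  rewrite -(@ler_sqr R) ?nnegrE ?nrm_ge0 ?(ltW C0)// nrm_family_sq//.
  apply: (@le_trans _ _ (\sum_i w i)).
    apply: ler_sum => i _; rewrite ler_piMr//.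
    rewrite expr_le1 ?nrm_ge0//; apply: (nrm_le_bound m1 (bv i)) => x.
    by rewrite normrM /= -[leRHS]mulr1 ler_pM//; case: (bd i x).
  apply: le_trans wC _; rewrite expr2; exact: ler_peMl (ltW C0) C1.
have [M MK HM] := HK _ _ _ _ (preserves_family (w_ge0 := w0) pS) bv nv.
exists M => // N N' hN hN'.
have {}HM := HM N N' hN hN'.
pose u i x := cavg S (fun y => v (y, i)) N x - cavg S (fun y => v (y, i)) N' x.
have Uu P i x : cavg (fun p : X * I => (S p.1, p.2)) v P (x, i) = cavg S (fun y => v (y, i)) P x.
  by rewrite /cavg; congr (_ * _); apply: eq_bigr => n _; rewrite iter_family.
have bu i : bm m (u i) by apply: bmB; apply: (bm_cavg pS); exact: bv.
have su : \sum_i w i * nrm m (u i) ^+ 2 <= (eta / C) ^+ 2.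
  rewrite -[leLHS](nrm_family_sq (w_ge0 := w0) (u := fun p => u p.2 p.1))//.
  rewrite ler_sqr ?nnegrE ?nrm_ge0 ?(ltW eC0)//.
  apply: le_trans HM; rewrite le_eqVlt; apply/orP; left; apply/eqP; congr (nrm _ _).
  by apply: funext => -[x i]; rewrite /u /= -!Uu.
have comb (P : nat) x :
  `|avg (fun n => n) T S s gam P x - \sum_i w i * (b i x * cavg S (fun y => v (y, i)) P x)| <= C * P%:R / W%:R.
  have [->|P0] := posnP P.
    rewrite /avg /cavg invr0 mul0r sub0r normrN mulr0 mul0r.
    by under eq_bigr do rewrite mul0r !mulr0; rewrite big1 ?normr0.
  have -> : avg (fun n => n) T S s gam P x - \sum_i w i * (b i x * cavg S (fun y => v (y, i)) P x) =
      P%:R^-1 * \sum_(1 <= n < P.+1) ((s (iter n T x) - \sum_i w i * (b i x * V i (iter n S x))) * gam (iter n S x)).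
    under [in RHS]eq_bigr do rewrite mulrBl.
    rewrite sumrB mulrBr; congr (_ - _).
    under [in RHS]eq_bigr do rewrite mulr_suml.
    rewrite exchange_big /= mulr_sumr; apply: eq_bigr => i _.
    rewrite /cavg /v /= !mulr_sumr; apply: eq_bigr => n _; ring.
  rewrite normrM normfV normr_nat mulrC ler_pdivrMr ?ltr0n//.
  apply: le_trans (ler_norm_sum _ _ _) _.
  apply: (@le_trans _ _ (\sum_(1 <= n < P.+1) C * P%:R / W%:R)).
    rewrite big_nat_cond [leRHS]big_nat_cond; apply: ler_sum => n.
    rewrite andbT => /andP[_ nP].
    rewrite normrM -[leRHS]mulr1 ler_pM//; apply: le_trans (h n x) _.
    by rewrite ler_wpM2r ?invr_ge0// ler_pM2l// ler_nat.
  by rewrite sumr_const_nat subn1 /= -[X in X <= _]mulr_natr.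
pose c x := \sum_i w i * (b i x * u i x).
have bc : bm m c by apply: bm_sum => i _; apply: bmZ; apply: bmM => //; case: (bb i).
have bA P : bm m (avg (fun n => n) T S s gam P) by exact: bm_avg.
have nc : nrm m c <= eta.
  apply: (@le_trans _ _ (\sum_i w i * nrm m (u i))).
    apply: le_trans (ler_nrm_sum _ _) _.
      by move=> i _; apply: bmZ; apply: bmM => //; case: (bb i).
    apply: ler_sum => i _; have bbu : bm m (fun x => b i x * u i x) by apply: bmM => //; case: (bb i).
    rewrite nrmZ// ger0_norm// ler_wpM2l//; apply: ler_nrm => // x.
    by rewrite normrM ler_piMl//; case: (bd i x).
  (* The mean ergodic theorem controls the weighted sum of squares; this inequality between the two
     means converts it into a bound for the weighted sum of norms. *)
  have am i : nrm m (u i) <= (eta / C + nrm m (u i) ^+ 2 / (eta / C)) / 2.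
    have := sqr_ge0 (nrm m (u i) - eta / C); set z := nrm m (u i); set y := eta / C => hh.
    rewrite ler_pdivlMr// -(@ler_pM2r _ y)// mulrDl divfK ?gt_eqF//; lra.
  apply: (@le_trans _ _ (\sum_i w i * ((eta / C + nrm m (u i) ^+ 2 / (eta / C)) / 2))).
    by apply: ler_sum => i _; rewrite ler_wpM2l.
  have -> : \sum_i w i * ((eta / C + nrm m (u i) ^+ 2 / (eta / C)) / 2) =
    (\sum_i w i) * (eta / C) / 2 + (\sum_i w i * nrm m (u i) ^+ 2) / (eta / C) / 2.
    rewrite !mulr_suml -big_split /=; apply: eq_bigr => i _; ring.
  have h1 : (\sum_i w i) * (eta / C) <= eta.
    apply: (@le_trans _ _ (C * (eta / C))); first by rewrite ler_pM2r.
    by rewrite mulrC divfK ?gt_eqF.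
  have h2 : (\sum_i w i * nrm m (u i) ^+ 2) / (eta / C) <= eta.
    rewrite ler_pdivrMr//; apply: le_trans su _; rewrite expr2 ler_pM2r//.
    by rewrite ler_pdivrMr// ler_peMr// ltW.
  lra.
pose A P := avg (fun n => n) T S s gam P.
have eA : (fun x => A N x - A N' x) = fun x => (A N x - A N' x - c x) + c x.
  by apply: funext => x; rewrite subrK.
have bAA : bm m (fun x => A N x - A N' x) by exact: bmB.
rewrite -/(A N) -/(A N') eA.
apply: le_trans (ler_nrmD (bmB bAA bc) bc) _.
rewrite addrC lerD//; apply: nrm_le_bound => //; first exact: bmB.
move=> x; have -> : A N x - A N' x - c x =
  (A N x - \sum_i w i * (b i x * cavg S (fun y => v (y, i)) N x)) -
  (A N' x - \sum_i w i * (b i x * cavg S (fun y => v (y, i)) N' x)).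
  rewrite /c /u; under eq_bigr do rewrite mulrBr mulrBr.
  by rewrite sumrB; ring.
apply: le_trans (ler_normB _ _) _.
apply: le_trans (lerD (comb _ _) (comb _ _)) _; lra.
Qed.

End Stable.

(** * Cesaro convergence for two commuting transformations *)

Section CesaroCauchy.
Variables (R : realType) (X : Type) (m : mean R X) (T S : X -> X).
Hypotheses (m1 : ex m (fun=> 1) = 1) (pT : preserves m T) (pS : preserves m S).
Hypothesis TS : forall x, T (S x) = S (T x).
Variables f g : X -> R.
Hypotheses (bf : bm m f) (bg : bm m g).
Hypotheses (f1 : forall x, `|f x| <= 1) (g1 : forall x, `|g x| <= 1).

Local Notation A := (avg (fun n => n) T S).

(* Energy decrement: whenever the averages of f o T^L - s fluctuate, subtracting a multiple of a dual
   function lowers its energy by a fixed amount; the new dual function lives at a scale at which the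
   remaining steps can still be carried out. *)
Lemma energy_decrement (e : R) (F : nat -> nat) : 0 < e -> e <= 1 ->
  (forall M, exists N N', [/\ (M <= N <= F M)%N, (M <= N' <= F M)%N &
     4 * e < nrm m (fun x => A f g N x - A f g N' x)]) ->
  forall (r : nat) (C : R), 1 <= C -> exists2 W, (0 < W)%N & forall (L : nat) (s : X -> R),
    bm m s -> stab m T S W C s -> (forall x, `|f (iter L T x) - s x| <= C) ->
    nrm m (fun x => f (iter L T x) - s x) ^+ 2 < r%:R * e ^+ 4 -> False.
Proof.
move=> e0 e1 HF; elim=> [|r IH] C C1.
  by exists 1%N => // L s _ _ _; rewrite mul0r ltNge sqr_ge0.
have C0 : 0 < C by exact: lt_le_trans C1.
(* The corrected function inherits the constant [C] of [s] and [2 * C] of the dual function, hence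
   [3 * C] in the remaining steps. *)
have [W1 W10 {}IH] : exists2 W, (0 < W)%N & forall (L : nat) (s : X -> R),
    bm m s -> stab m T S W (3 * C) s -> (forall x, `|f (iter L T x) - s x| <= 3 * C) ->
    nrm m (fun x => f (iter L T x) - s x) ^+ 2 < r%:R * e ^+ 4 -> False.
  by apply: IH; lra.
have [K HK] := @stab_metastable R X m T S m1 pT pS C e F W1 C1 e0.
pose Fm := \max_(i < K.+1) F i.
(* Every window [[M, F M]] with [M <= K] must be short against [W], so that the error of
   [stab_metastable] costs at most [e]. *)
pose W := (maxn W1 (Num.truncn (2 * C * Fm%:R / e)).+1).
have W0 : (0 < W)%N by rewrite leq_max W10.
have hW : 2 * C * Fm%:R / W%:R <= e.
  rewrite ler_pdivrMr ?ltr0n// [leRHS]mulrC -ler_pdivrMr//.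
  apply: le_trans (ltW (truncnS_gt _)) _.
  by rewrite ler_nat leq_max leqnn orbT.
exists W => // L s bs ss fsC fse.
pose gam x := g (iter L T x).
have bgam : bm m gam by exact: (bm_iter pT).
have gam1 x : `|gam x| <= 1 by exact: g1.
have [M /andP[MW MK] HM] := HK W s gam ss bgam gam1 bs.
have [N [N' [hN hN' hbig]]] := HF M.
have {}HM := HM N N' hN hN'.
have FM : (F M <= Fm)%N by apply: (@leq_bigmax _ (fun i : 'I_K.+1 => F i) (Ordinal (MK : (M < K.+1)%N))).
pose ff x := f (iter L T x) - s x.
have bfL : bm m (fun x => f (iter L T x)) by exact: (bm_iter pT).
have bff : bm m ff by exact: bmB.
have bA u n : bm m u -> bm m (A u gam n) by move=> bu; exact: (bm_avg pT pS).
have small : nrm m (fun x => A s gam N x - A s gam N' x) <= 2 * e.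
  apply: le_trans HM _.
  have NN : (N%:R + N'%:R : R) <= 2 * Fm%:R.
    have h1 : (N%:R : R) <= Fm%:R by rewrite ler_nat; case/andP: hN => _ h; exact: leq_trans h FM.
    have h2 : (N'%:R : R) <= Fm%:R by rewrite ler_nat; case/andP: hN' => _ h; exact: leq_trans h FM.
    lra.
  have : C * (N%:R + N'%:R) / W%:R <= C * (2 * Fm%:R) / W%:R.
    by rewrite ler_pM2r ?invr_gt0 ?ltr0n// ler_pM2l.
  lra.
have large : 4 * e < nrm m (fun x => A (fun y => f (iter L T y)) gam N x - A (fun y => f (iter L T y)) gam N' x).
  under eq_fun do rewrite !avg_iter//.
  have := nrm_iter pT L (bmB (bm_avg pT pS (fun n => n) N bf bg) (bm_avg pT pS (fun n => n) N' bf bg)).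
  by move=> ->.
(* [s] accounts for at most [2e] of a fluctuation above [4e]; the rest belongs to [ff], so one of
   its two averages exceeds [e]. *)
have [P hP Pbig] : exists2 P, (M <= P)%N & e < nrm m (A ff gam P).
  have diff : 2 * e < nrm m (fun x => A ff gam N x - A ff gam N' x).
    have e' : (fun x => A (fun y => f (iter L T y)) gam N x - A (fun y => f (iter L T y)) gam N' x) =
      fun x => (A ff gam N x - A ff gam N' x) + (A s gam N x - A s gam N' x).
      by apply: funext => x; rewrite !avgB; ring.
    rewrite e' in large.
    have := lt_le_trans large (ler_nrmD (bmB (bA _ N bff) (bA _ N' bff)) (bmB (bA _ N bs) (bA _ N' bs))).
    lra.
  have := lt_le_trans diff (ler_nrmB (bA _ N bff) (bA _ N' bff)).
  have [h|h] := ltP e (nrm m (A ff gam N)); first by exists N => //; case/andP: hN.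
  by move=> h2; exists N'; [case/andP: hN'|lra].
have P0 : (0 < P)%N by apply: leq_trans hP; exact: leq_trans MW.
pose h := A ff gam P.
have bh : bm m h by exact: bA.
have hC x : `|h x| <= C.
  by rewrite -[leRHS]mulr1; apply: avg_bound => //; exact: ltW.
pose D := dual T S P h gam.
have bD : bm m D by exact: bm_dual.
have bs' : bm m (fun x => s (iter P T x) + e ^+ 2 * D x).
  by apply: bmD; [exact: (bm_iter pT)|exact: bmZ].
have e21 : e ^+ 2 <= 1 by rewrite expr_le1// ltW.
have e20 : 0 <= e ^+ 2 by exact: sqr_ge0.
have eq1 x : f (iter (P + L) T x) - (s (iter P T x) + e ^+ 2 * D x) = ff (iter P T x) - e ^+ 2 * D x.
  by rewrite /ff opprD addrA addnC iterD.
have DC x : `|e ^+ 2 * D x| <= C.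
  rewrite normrM (ger0_norm e20) -[leRHS]mul1r ler_pM//.
  by apply: dual_bound => //; exact: ltW.
apply: (IH (P + L)%N (fun x => s (iter P T x) + e ^+ 2 * D x)) => //.
- rewrite (_ : 3 * C = C + 2 * C); last by ring.
  apply: stabD.
    apply: (@stab_weaken _ _ _ _ _ W W1 C C); rewrite ?W10 ?leq_max ?leqnn ?(ltW C0) ?lexx//.
    exact: stab_iter.
  have : stab m T S W1 (2 * C) D.
    apply: (@stab_weaken _ _ _ _ _ P W1 (2 * C) (2 * C)).
    - by rewrite W10 (leq_trans MW).
    - by rewrite lexx andbT; lra.
    - exact: stab_dual.
  by apply: stabZ; rewrite e20.
- move=> x; rewrite eq1; apply: le_trans (ler_normB _ _) _.
  have := lerD (fsC (iter P T x)) (DC x); rewrite -/(ff _); lra.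
- under eq_fun do rewrite eq1.
  have bffP : bm m (fun x => ff (iter P T x)) by exact: (bm_iter pT).
  (* In the expanded square the energy changes by [-2 e^2 |h|^2 + e^4 |D|^2]. With [|D| <= |h|] and
     [e <= 1] this is at most [-e^2 |h|^2], hence at most [-e^4] because [|h| > e]. *)
  have corr : ex m (fun x => ff (iter P T x) * D x) = nrm m h ^+ 2.
    by rewrite ex_dual// nrm_sq//; congr (ex _ _); apply: funext => x; rewrite expr2.
  have nD : nrm m D ^+ 2 <= nrm m h ^+ 2.
    by rewrite ler_sqr ?nnegrE ?nrm_ge0//; apply: nrm_dual.
  have bb := bmZ (- e ^+ 2) bD.
  have -> : nrm m (fun x => ff (iter P T x) - e ^+ 2 * D x) ^+ 2 =
     nrm m ff ^+ 2 - 2 * e ^+ 2 * nrm m h ^+ 2 + e ^+ 4 * nrm m D ^+ 2.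
    under eq_fun do rewrite -mulNr.
    rewrite (nrm_sq (bmD bffP bb)) (exsqD bffP bb).
    rewrite -corr -(nrm_iter pT P bff) !nrm_sq//.
    have -> : (fun x => ff (iter P T x) * (- e ^+ 2 * D x)) = fun x => - e ^+ 2 * (ff (iter P T x) * D x).
      by apply: funext => x; ring.
    have -> : (fun x => (- e ^+ 2 * D x) ^+ 2) = fun x => e ^+ 4 * D x ^+ 2.
      by apply: funext => x; ring.
    rewrite (exZ _ (bmM bffP bD)) (exZ _ (bmX 2 bD)). by ring.
  have hh : e ^+ 2 <= nrm m h ^+ 2 by rewrite ler_sqr ?nnegrE ?nrm_ge0 ?(ltW e0)// ltW.
  move: fse; rewrite -/ff -natr1 mulrDl mul1r => fse.
  have h4 : e ^+ 4 = e ^+ 2 * e ^+ 2 by rewrite -exprD.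
  have k1 : e ^+ 4 * nrm m D ^+ 2 <= e ^+ 2 * nrm m h ^+ 2.
    rewrite h4 -mulrA ler_wpM2l//.
    by apply: le_trans nD; rewrite ler_piMl// sqr_ge0.
  have k2 : e ^+ 2 * e ^+ 2 <= e ^+ 2 * nrm m h ^+ 2 by rewrite ler_wpM2l.
  lra.
Qed.

Theorem cesaro_cauchy (eps : R) : 0 < eps ->
  exists M, forall N N', (M <= N)%N -> (M <= N')%N -> nrm m (fun x => A f g N x - A f g N' x) <= eps.
Proof.
move=> eps0; apply: contrapT => ncauchy.
pose e := Num.min 1 (eps / 4).
have e0 : 0 < e by rewrite lt_min ltr01 divr_gt0.
have e1 : e <= 1 by rewrite ge_min lexx.
have e4 : 4 * e <= eps.
  by have : e <= eps / 4 by [rewrite ge_min lexx orbT]; lra.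
(* Failure of the Cauchy property beyond [M] yields two scales; the larger one ends the window. *)
have HF0 M : exists FM : nat, exists N N', [/\ (M <= N <= FM)%N, (M <= N' <= FM)%N &
     4 * e < nrm m (fun x => A f g N x - A f g N' x)].
  apply: contrapT => nex; apply: ncauchy; exists M => N N' MN MN'.
  rewrite leNgt; apply/negP => h; apply: nex; exists (maxn N N'), N, N'.
  by rewrite MN MN' leq_maxl leq_maxr; split => //; exact: le_lt_trans h.
have [F HF] := choice HF0.
pose r := (Num.truncn (2 / e ^+ 4)).+1.
have [W W0 HW] := energy_decrement e0 e1 HF r (lexx 1).
apply: (HW 0%N (fun=> 0)).
- exact: bm_cst.
- exact: stab0.
- by move=> x; rewrite subr0.
- under eq_fun do rewrite subr0.
  have h1 : nrm m f ^+ 2 <= 1 by rewrite expr_le1 ?nrm_ge0//; apply: nrm_le_bound.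
  have : 2 / e ^+ 4 < r%:R by exact: truncnS_gt.
  rewrite ltr_pdivrMr ?exprn_gt0//; rewrite /=; lra.
Qed.

End CesaroCauchy.

(** * Exponential sums and iterated differences of powers *)

Section KusminLandau.
Variable R : realType.
Implicit Types x t : R.

Lemma mul_cos_le_sin t : 0 <= t <= pi / 2 -> t * cos t <= sin t.
Proof.
move=> /andP[t0 tpi].
have hc : {within `[0, t], continuous (@sin R)}.
  by apply: continuous_subspaceT; exact: continuous_sin.
have [c] := @MVT_segment R sin cos 0 t t0 (fun x _ => is_derive_sin x) hc.
rewrite in_itv /= => /andP[c0 ct]; rewrite sin0 !subr0 => ->.
rewrite mulrC ler_wpM2r//.
have pi0 := @pi_ge0 R.
have [->//|tc] := eqVneq c t.
apply: ltW; rewrite ltr_cos ?in_itv /= ?lt_neqAle ?tc//; apply/andP; split; lra.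
Qed.

(** Real part of [exp(ia) = (exp(ib) - exp(ia)) / (exp(i(b - a)) - 1)], the coefficient being
    expressed by the cotangent of the half difference. *)
Lemma cos_telescope (a b : R) : sin ((b - a) / 2) != 0 ->
  cos a = - ((cos b - cos a) / 2) + cos ((b - a) / 2) / (2 * sin ((b - a) / 2)) * (sin b - sin a).
Proof.
have key (u t : R) : sin t != 0 ->
    cos (u - t) = - ((cos (u + t) - cos (u - t)) / 2) + cos t / (2 * sin t) * (sin (u + t) - sin (u - t)).
  by move=> st; rewrite cosB cosD sinB sinD; move: (cos u) (sin u) (cos t) (sin t) st => A B C E st; field.
move=> st; have := key ((a + b) / 2) _ st.
have -> : (a + b) / 2 - (b - a) / 2 = a by field.
by have -> : (a + b) / 2 + (b - a) / 2 = b by field.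
Qed.

Lemma abel_bound (c s : nat -> R) n : (0 < n)%N ->
  (forall k, (k < n)%N -> 0 <= c k) -> (forall k, (k.+1 < n)%N -> c k <= c k.+1) ->
  (forall k, `|s k| <= 1) ->
  `|\sum_(0 <= k < n) c k * (s k.+1 - s k)| <= 2 * c n.-1.
Proof.
move=> n0 c0 cM s1.
(* With the boundary term subtracted the induction closes: each new term adds one increment of [c]
   to both sides. *)
suff h : `|\sum_(0 <= k < n) c k * (s k.+1 - s k) - c n.-1 * s n| <= c n.-1.
  have -> : \sum_(0 <= k < n) c k * (s k.+1 - s k) =
    (\sum_(0 <= k < n) c k * (s k.+1 - s k) - c n.-1 * s n) + c n.-1 * s n by rewrite subrK.
  apply: le_trans (ler_normD _ _) _.
  have cn : 0 <= c n.-1 by apply: c0; rewrite prednK.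
  have : `|c n.-1 * s n| <= c n.-1 by rewrite normrM (ger0_norm cn) ler_piMr.
  lra.
elim: n n0 c0 cM => [//|[_ _ c0 _|n IH _ c0 cM]].
  rewrite big_nat1 /= mulrBr addrAC subrr add0r normrN normrM ger0_norm ?c0//.
  by rewrite ler_piMr ?c0.
rewrite big_nat_recr //=.
have := IH isT (fun k kn => c0 k (ltnW kn)) (fun k kn => cM k (ltnW kn)) => /=.
set U := \sum_(_ <= _ < _) _ => h.
have -> : U + c n.+1 * (s n.+2 - s n.+1) - c n.+1 * s n.+2 =
  (U - c n * s n.+1) - (c n.+1 - c n) * s n.+1 by ring.
apply: le_trans (ler_normB _ _) _.
have cc : 0 <= c n.+1 - c n by rewrite subr_ge0 cM.
have : `|(c n.+1 - c n) * s n.+1| <= c n.+1 - c n by rewrite normrM (ger0_norm cc) ler_piMr.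
lra.
Qed.

(** Decreasing differences make the cotangents of their halves increase, so summation by parts costs
    only the last one, which [t cos t <= sin t] bounds. Differences up to [pi] keep the cotangents
    nonnegative. *)
Lemma kusmin_landau (phi : nat -> R) n (th : R) : 0 < th ->
  (forall k, (k < n)%N -> th <= phi k.+1 - phi k <= pi) ->
  (forall k, (k.+1 < n)%N -> phi k.+2 - phi k.+1 <= phi k.+1 - phi k) ->
  `|\sum_(0 <= k < n) cos (phi k)| <= 1 + 2 / th.
Proof.
move=> th0 hth mono.
have [->|n0] := posnP n; first by rewrite big_geq// normr0 addr_ge0// divr_ge0// ltW.
pose t k := (phi k.+1 - phi k) / 2.
have tb k : (k < n)%N -> th / 2 <= t k <= pi / 2.
  by move=> /hth /andP[h1 h2]; rewrite /t !ler_pM2r ?h1 ?h2 ?invr_gt0.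
have pi0 := @pi_gt0 R.
have st k : (k < n)%N -> 0 < sin (t k).
  by move=> /tb /andP[h1 h2]; apply: sin_gt0_pi; apply/andP; split; lra.
have ct k : (k < n)%N -> 0 <= cos (t k).
  by move=> /tb /andP[h1 h2]; apply: cos_ge0_pihalf; apply/andP; split; lra.
pose c k := cos (t k) / (2 * sin (t k)).
have c0 k : (k < n)%N -> 0 <= c k.
  by move=> kn; rewrite divr_ge0 ?ct// mulr_ge0// ltW// st.
have cM k : (k.+1 < n)%N -> c k <= c k.+1.
  move=> kn; have kn' := ltnW kn; have := tb _ kn; have := tb _ kn' => /andP[h1 h2] /andP[h3 h4].
  have tt : t k.+1 <= t k by rewrite /t ler_pM2r ?invr_gt0// mono.
  rewrite /c; apply: ler_pM; rewrite ?ct ?invr_ge0 ?mulr_ge0 ?(ltW (st _ _))//.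
    have [->//|ne] := eqVneq (t k.+1) (t k).
    apply: ltW; rewrite ltr_cos ?in_itv /= ?lt_neqAle ?ne//; apply/andP; split; lra.
  rewrite lef_pV2 ?posrE ?mulr_gt0 ?st// ler_pM2l//.
  have [->//|ne] := eqVneq (t k.+1) (t k).
  apply: ltW; rewrite ltr_sin ?in_itv /= ?lt_neqAle ?ne//; apply/andP; split; lra.
have cth k : (k < n)%N -> c k <= th^-1.
  move=> kn; have /andP[h1 h2] := tb _ kn.
  have h : t k * cos (t k) <= sin (t k) by apply: mul_cos_le_sin; apply/andP; split; lra.
  rewrite /c ler_pdivrMr ?mulr_gt0 ?st// mulrC ler_pdivlMr//.
  have : th / 2 * cos (t k) <= t k * cos (t k) by rewrite ler_wpM2r ?ct.
  lra.
have -> : \sum_(0 <= k < n) cos (phi k) =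
  - ((cos (phi n) - cos (phi 0%N)) / 2) + \sum_(0 <= k < n) c k * (sin (phi k.+1) - sin (phi k)).
  rewrite -(telescope_sumr (fun k => cos (phi k)) (leq0n n)) mulr_suml -sumrN -big_split /=.
  apply: eq_big_nat => k /andP[_ kn]; rewrite -cos_telescope//.
  by rewrite gt_eqF// st.
apply: le_trans (ler_normD _ _) _; apply: lerD.
  rewrite normrN normrM (@ger0_norm _ 2^-1)// ler_pdivrMr// mul1r.
  apply: le_trans (ler_normB _ _) _.
  have h1 := cos_max (phi n); have h2 := cos_max (phi 0%N); lra.
apply: le_trans (abel_bound (s := fun k => sin (phi k)) n0 c0 cM _) _.
  by move=> k; exact: sin_max.
by rewrite ler_pM2l// cth// prednK.
Qed.

End KusminLandau.

Section Differences.
Variable R : realType.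
Implicit Types (a h x : R) (D : seq R).

Fixpoint dif (D : seq R) (F : R -> R) : R -> R :=
  if D is h :: D' then fun x => dif D' F (x + h) - dif D' F x else F.

Fixpoint falling a n := if n is n'.+1 then a * falling (a - 1) n' else 1.

Lemma is_derive_dif_powR D a x : 0 < x -> all (>= 0) D ->
  is_derive x 1 (dif D (fun y => y `^ a)) (a * dif D (fun y => y `^ (a - 1)) x).
Proof.
elim: D x => [|h D IH] x x0 /=; first by move=> _; exact: is_derive1_powR.
move=> /andP[h0 D0].
have d1 := IH x x0 D0.
have d2 : is_derive (x + h) 1 (dif D (fun y => y `^ a)) (a * dif D (fun y => y `^ (a - 1)) (x + h)).
  by apply: IH => //; rewrite ltr_wpDr.
have d3 : is_derive x 1 (fun y : R => y + h) 1.
  by apply: is_derive_eq; rewrite addr0.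
have d4 : is_derive x 1 (dif D (fun y => y `^ a) \o (fun y => y + h)) (a * dif D (fun y => y `^ (a - 1)) (x + h) * 1).
  exact: is_derive1_comp.
have := is_deriveB d4 d1.
by rewrite mulr1 mulrBr.
Qed.

(** Differentiation commutes with differences, so each use of the mean value theorem trades one
    entry of [D] for a factor and lowers the exponent by one. *)
Lemma dif_powR_MVT D a x : 0 < x -> all (>= 0) D ->
  exists2 xi, x <= xi <= x + \sum_(h <- D) h &
    dif D (fun y => y `^ a) x = (\prod_(h <- D) h) * falling a (size D) * xi `^ (a - (size D)%:R).
Proof.
elim: D a x => [|h D IH] a x x0 /=.
  by move=> _; exists x; rewrite ?big_nil ?addr0 ?lexx// !mul1r subr0.
move=> /andP[h0 D0].
have drv y : y \in `]x, (x + h)[ -> is_derive y 1 (dif D (fun y => y `^ a)) (a * dif D (fun y => y `^ (a - 1)) y).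
  by rewrite in_itv /= => /andP[xy _]; apply: is_derive_dif_powR => //; exact: lt_trans xy.
have cont : {within `[x, x + h], continuous (dif D (fun y => y `^ a))}.
  apply: derivable_within_continuous => y; rewrite in_itv /= => /andP[xy _].
  by have [] := @is_derive_dif_powR D a y (lt_le_trans x0 xy) D0.
have xh : x <= x + h by rewrite lerDl.
have [c] := MVT_segment xh drv cont.
rewrite in_itv /= => /andP[xc ch] ->.
have [xi /andP[x1 x2] ->] := IH (a - 1) c (lt_le_trans x0 xc) D0.
exists xi.
  rewrite big_cons (le_trans xc)//= addrA; apply: le_trans x2 _.
  by rewrite lerD2r.
rewrite big_cons (_ : x + h - x = h); last by ring.
rewrite (_ : a - (size D).+1%:R = a - 1 - (size D)%:R); last by rewrite -natr1; ring.
ring.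
Qed.

End Differences.

(** * A trigonometric approximation of the integer part *)

Section Staircase.
Variable R : realType.
Implicit Types x y phi : R.

(** The phase [phi] lets the induction use [2 cos y cos phi = cos (phi + y) + cos (phi - y)];
    Pascal's rule then collects the terms. *)
Lemma pow_cos n phi y : 2 ^+ n * cos y ^+ n * cos phi =
  \sum_(i < n.+1) 'C(n, i)%:R * cos (phi + (n%:R - 2 * i%:R) * y).
Proof.
elim: n phi => [|n IH] phi.
  by rewrite big_ord_recl big_ord0 addr0 bin0 /= !expr0 !mul1r mulr0 subrr mul0r addr0.
have -> : 2 ^+ n.+1 * cos y ^+ n.+1 * cos phi =
    2 ^+ n * cos y ^+ n * cos (phi + y) + 2 ^+ n * cos y ^+ n * cos (phi - y).
  by rewrite cosD cosB !exprS; ring.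
rewrite !IH [RHS]big_ord_recl bin0 mul1r.
under [in RHS]eq_bigr => i _ do rewrite lift0 binS natrD mulrDl.
rewrite big_split /= addrA; congr (_ + _); last first.
  apply: eq_bigr => i _; congr (_ * cos _).
  by rewrite -!natr1; ring.
have -> : \sum_(i < n.+1) 'C(n, i)%:R * cos (phi + y + (n%:R - 2 * i%:R) * y) =
  \sum_(i < n.+2) 'C(n, i)%:R * cos (phi + y + (n%:R - 2 * i%:R) * y).
  by rewrite [RHS]big_ord_recr /= bin_small// mul0r addr0.
rewrite [LHS]big_ord_recl bin0 mul1r; congr (cos _ + _).
  by rewrite -natr1 /=; ring.
apply: eq_bigr => i _; rewrite lift0; congr (_ * cos _).
by rewrite -!natr1; ring.
Qed.

(** The mean of [cos^(2m)] over a period, of order [m^(-1/2)] by [central_upper] and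
    [central_lower]. *)
Definition central m : R := 'C(m.*2, m)%:R / 4 ^+ m.

Lemma central_gt0 m : 0 < central m.
Proof. by rewrite divr_gt0 ?exprn_gt0// ltr0n bin_gt0 -addnn leq_addl. Qed.

Lemma centralS m : central m.+1 = central m * (2 * m%:R + 1) / (2 * m%:R + 2).
Proof.
have h : (m.+1 * 'C(m.+1.*2, m.+1) = 2 * (m.*2.+1 * 'C(m.*2, m)))%N.
  have := mul_bin_diag m.*2.+1 m; rewrite /= => ->.
  rewrite doubleS binS.
  have -> : 'C(m.*2.+1, m.+1) = 'C(m.*2.+1, m).
    rewrite -[in RHS]bin_sub; last by rewrite -addnn; lia.
    by congr 'C(_, _); rewrite -addnn; lia.
  by rewrite addnn -mul2n mulnCA.
have {}h : (m%:R + 1) * 'C(m.+1.*2, m.+1)%:R = 2 * ((2 * m%:R + 1) * 'C(m.*2, m)%:R) :> R.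
  have e : m.*2.+1%:R = 2 * m%:R + 1 :> R by rewrite -natr1 -muln2 natrM mulrC.
  by rewrite natr1 -e -!natrM h.
rewrite /central exprS.
have h1 : (m%:R + 1 : R) != 0 by rewrite natr1 pnatr_eq0.
have h4 : (4 : R) ^+ m != 0 by rewrite expf_neq0// pnatr_eq0.
have -> : 'C(m.+1.*2, m.+1)%:R = 2 * ((2 * m%:R + 1) * 'C(m.*2, m)%:R) / (m%:R + 1) :> R.
  by rewrite -h mulrC mulKf.
have h2 : (2 * m%:R + 2 : R) != 0 by rewrite -[X in _ + X]mulr1 -mulrDr mulf_neq0// pnatr_eq0.
by field; rewrite h1 h2 h4.
Qed.

Lemma central_upper m : central m ^+ 2 * (2 * m%:R + 1) <= 1.
Proof.
elim: m => [|m IH]; first by rewrite /central bin0 expr0 divr1 expr1n mulr0 add0r mulr1.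
rewrite centralS -natr1; set c := central m in IH *; set k := (m%:R : R) in IH *.
have k0 : 0 <= k by exact: ler0n.
have d0 : 0 < 2 * k + 2 by lra.
rewrite expr_div_n mulrAC ler_pdivrMr ?exprn_gt0// mul1r exprMn.
have c2 := sqr_ge0 c.
have : c ^+ 2 * (2 * k + 1) * ((2 * k + 1) * (2 * (k + 1) + 1)) <= 1 * ((2 * k + 1) * (2 * (k + 1) + 1)).
  by rewrite ler_wpM2r// mulr_ge0; lra.
nra.
Qed.

Lemma central_lower m : (0 < m)%N -> 1 <= central m ^+ 2 * (4 * m%:R).
Proof.
case: m => // m _; elim: m => [|m IH].
  by rewrite /central /= expr1; have -> : 'C(2, 1) = 2%N by []; lra.
rewrite centralS -[in X in 4 * X]natr1; set c := central m.+1 in IH *; set k := (m.+1%:R : R) in IH *.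
have k0 : 0 < k by rewrite ltr0n.
have d0 : 0 < 2 * k + 2 by lra.
rewrite expr_div_n mulrAC ler_pdivlMr ?exprn_gt0// mul1r exprMn.
have : 1 * ((2 * k + 1) ^+ 2 * (k + 1)) <= c ^+ 2 * (4 * k) * ((2 * k + 1) ^+ 2 * (k + 1)).
  by rewrite ler_wpM2r// mulr_ge0 ?sqr_ge0//; lra.
move=> h; rewrite -(ler_pM2l k0); nra.
Qed.

Definition freq m i : R := 2 * pi * (m%:R - i%:R).

(** A primitive of the kernel [cos (pi x)^(2m) / central m], which has mean one and peaks at the
    integers, so the function climbs by one near each integer. The constant 1/2 centres the jump of
    the ceiling at 0. *)
Definition stair m x : R := x + 2^-1 +
  \sum_(i < m.*2.+1 | i != m :> nat)
     'C(m.*2, i)%:R / 'C(m.*2, m)%:R * (sin (freq m i * x) / freq m i).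

Lemma freq_neq0 m i : (i != m)%N -> freq m i != 0.
Proof.
move=> im; rewrite /freq mulf_neq0//; first by rewrite mulf_neq0// gt_eqF// pi_gt0.
by rewrite subr_eq0 eqr_nat eq_sym.
Qed.

Lemma sin_shift x m i : sin (x + freq m i) = sin x.
Proof.
have per y k : sin (y + 2 * pi * k%:R) = sin y :> R.
  by rewrite mulr_natl mulr_natr; exact: (periodicn (@sinD2pi R)).
rewrite -(per (x + _) i) /freq.
have -> : x + 2 * pi * (m%:R - i%:R) + 2 * pi * i%:R = x + 2 * pi * m%:R by ring.
exact: per.
Qed.

Lemma stairD1 m x : stair m (x + 1) = stair m x + 1.
Proof.
rewrite /stair [in LHS](eq_bigr (fun i : 'I_m.*2.+1 =>
  'C(m.*2, i)%:R / 'C(m.*2, m)%:R * (sin (freq m i * x) / freq m i))); first by ring.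
by move=> i _; rewrite mulrDr mulr1 sin_shift.
Qed.

Lemma stairN m x : stair m (- x) = 1 - stair m x.
Proof.
rewrite /stair [in LHS](eq_bigr (fun i : 'I_m.*2.+1 =>
  - ('C(m.*2, i)%:R / 'C(m.*2, m)%:R * (sin (freq m i * x) / freq m i)))).
  by rewrite sumrN; move: (\sum_(_ | _) _) => U; lra.
by move=> i _; rewrite mulrN sinN mulNr mulrN.
Qed.

Lemma stair0 m : stair m 0 = 2^-1.
Proof. by rewrite /stair add0r big1 ?addr0// => i _; rewrite mulr0 sin0 mul0r mulr0. Qed.

Lemma stair_half m : stair m 2^-1 = 1.
Proof.
have h : stair m (- 2^-1 + 1) = stair m (- 2^-1) + 1 by exact: stairD1.
rewrite stairN (_ : - 2^-1 + 1 = 2^-1 :> R) in h; last by field.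
lra.
Qed.

Lemma pow_cos_pi m x : cos (pi * x) ^+ m.*2 =
  central m + \sum_(i < m.*2.+1 | i != m :> nat) 'C(m.*2, i)%:R / 4 ^+ m * cos (freq m i * x).
Proof.
have := pow_cos m.*2 0 (pi * x); rewrite cos0 mulr1.
have h4 : (2 : R) ^+ m.*2 = 4 ^+ m by rewrite -mul2n exprM; congr (_ ^+ _); ring.
have n4 : (4 : R) ^+ m != 0 by rewrite expf_neq0// pnatr_eq0.
have hm : (m < m.*2.+1)%N by rewrite ltnS -addnn leq_addl.
rewrite h4 (bigD1 (Ordinal hm))//= => e.
apply: (mulfI n4); rewrite e mulrDr mulr_sumr; congr (_ + _).
  rewrite add0r -mul2n natrM subrr mul0r cos0 mulr1 /central mul2n.
  by field.
apply: eq_bigr => i _; rewrite add0r [RHS]mulrA; congr (_ * cos _).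
  by field.
by rewrite /freq (_ : m.*2%:R = 2 * m%:R :> R) -?mul2n ?natrM//; ring.
Qed.

Lemma is_derive_bigsum (I : Type) (r : seq I) (Q : pred I) (F : I -> R -> R) (dF : I -> R) x :
  (forall i, Q i -> is_derive x 1 (F i) (dF i)) ->
  is_derive x 1 (fun y => \sum_(i <- r | Q i) F i y) (\sum_(i <- r | Q i) dF i).
Proof.
move=> h; elim: r => [|i r IH].
  rewrite big_nil (_ : (fun y => _) = cst 0); first exact: is_derive_cst.
  by apply: funext => y; rewrite big_nil.
rewrite big_cons (_ : (fun y => _) = fun y => (if Q i then F i y else 0) + \sum_(i <- r | Q i) F i y); last first.
  by apply: funext => y; rewrite big_cons; case: ifP => // _; rewrite add0r.
case: ifP => Qi; first exact: is_deriveD (h _ Qi) IH.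
rewrite (_ : (fun y => _) = fun y => \sum_(i <- r | Q i) F i y)//.
by apply: funext => y; rewrite add0r.
Qed.

Lemma is_derive_stair m x : is_derive x 1 (stair m) (cos (pi * x) ^+ m.*2 / central m).
Proof.
have d1 (c : R) : is_derive x 1 (fun y : R => y + c) 1.
  by apply: is_derive_eq; rewrite addr0.
have d2 : is_derive x 1 (fun y => \sum_(i < m.*2.+1 | i != m :> nat)
     'C(m.*2, i)%:R / 'C(m.*2, m)%:R * (sin (freq m i * y) / freq m i))
   (\sum_(i < m.*2.+1 | i != m :> nat) 'C(m.*2, i)%:R / 'C(m.*2, m)%:R * cos (freq m i * x)).
  apply: is_derive_bigsum => i im.
  set a := freq m i; set b := _ / _.
  have a0 : a != 0 by exact: freq_neq0.
  have da : is_derive x 1 (fun y : R => a * y) a.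
    by have := is_deriveZ a (is_derive_id x (1 : R)); rewrite [X in is_derive _ _ _ X]mulr1.
  have ds : is_derive x 1 (sin \o (fun y : R => a * y)) (cos (a * x) * a) by exact: is_derive1_comp.
  have := is_deriveZ (b / a) ds.
  rewrite (_ : _ *: (_ * a) = b * cos (a * x)); last first.
    by rewrite -[_ *: _]/(_ * _); field.
  congr is_derive; apply: funext => y; rewrite -[LHS]/(b / a * sin (a * y)).
  by rewrite mulrAC -mulrA.
have := is_deriveD (d1 2^-1) d2.
congr is_derive.
rewrite pow_cos_pi mulrDl divff ?gt_eqF ?central_gt0//; congr (_ + _).
rewrite mulr_suml; apply: eq_bigr => i _; rewrite /central.
have h4 : (4 : R) ^+ m != 0 by rewrite expf_neq0// pnatr_eq0.
have hc : ('C(m.*2, m)%:R : R) != 0 by rewrite pnatr_eq0 -lt0n bin_gt0 -addnn leq_addl.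
by field; rewrite hc h4.
Qed.

Lemma le_derive_ge0 (F dF : R -> R) (a b : R) : a <= b -> (forall x, is_derive x 1 F (dF x)) ->
  (forall x, a <= x <= b -> 0 <= dF x) -> F a <= F b.
Proof.
move=> ab dFx dF0.
have cont : {within `[a, b], continuous F}.
  by apply: derivable_within_continuous => x _; case: (dFx x).
have [c] := MVT_segment ab (fun x _ => dFx x) cont.
rewrite in_itv /= => hc e; rewrite -subr_ge0 e mulr_ge0 ?dF0//.
by rewrite subr_ge0.
Qed.

Lemma le_stair m (a b : R) : a <= b -> stair m a <= stair m b.
Proof.
move=> ab; apply: le_derive_ge0 ab (is_derive_stair m) _ => x _.
by rewrite divr_ge0 ?(ltW (central_gt0 _))// -mul2n exprM exprn_ge0// sqr_ge0.
Qed.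

(** The factor 2 is compensated by [1 - stair p x <= 1/2], so that [stair_tail] holds with constant
    one. *)
Lemma central_half p : (0 < p)%N -> central p <= 2 * central p.*2.
Proof.
move=> p0; have h1 := central_upper p.
have h2 := @central_lower p.*2; rewrite double_gt0 in h2; have {}h2 := h2 p0.
have c1 := central_gt0 p; have c2 := central_gt0 p.*2.
rewrite -mul2n in h2 c2 *; rewrite natrM in h2.
rewrite -(@ler_sqr R) ?nnegrE ?mulr_ge0 ?(ltW c1) ?(ltW c2)//.
have p1 : 0 < (p%:R : R) by rewrite ltr0n.
rewrite -(@ler_pM2r _ (2 * p%:R + 1)); last by lra.
apply: le_trans h1 _; rewrite exprMn.
have := sqr_ge0 (central (2 * p)); nra.
Qed.

(* On [x, 1/2] the even powers satisfy cos^(4p)(pi t) <= cos^(2p)(pi x) cos^(2p)(pi t), so the tail of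
   the kernel of order 2p is at most cos^(2p)(pi x) times the tail of the kernel of order p. *)
Lemma stair_tail p x : (0 < p)%N -> 0 <= x <= 2^-1 ->
  0 <= 1 - stair p.*2 x <= cos (pi * x) ^+ p.*2.
Proof.
move=> p0 /andP[x0 x2]; have pi0 := @pi_gt0 R.
rewrite -(stair_half p.*2) subr_ge0 le_stair//=.
have c1 := central_gt0 p; have c2 := central_gt0 p.*2.
pose A := cos (pi * x) ^+ p.*2.
have A0 : 0 <= A by rewrite /A -mul2n exprM exprn_ge0// sqr_ge0.
pose r := central p / central p.*2.
pose u t := A * r * stair p t - stair p.*2 t.
have du (t : R) : is_derive t 1 u (A * r * (cos (pi * t) ^+ p.*2 / central p) - cos (pi * t) ^+ p.*2.*2 / central p.*2).
  apply: is_deriveB (is_derive_stair _ _).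
  exact: (is_deriveZ (A * r) (is_derive_stair p t)).
have : u x <= u 2^-1.
  apply: le_derive_ge0 x2 du _ => t /andP[xt t2].
  have ct : 0 <= cos (pi * t).
    by apply: cos_ge0_pihalf; apply/andP; split; nra.
  have cc : cos (pi * t) <= cos (pi * x).
    have [->//|ne] := eqVneq t x.
    have lt_xt : x < t by rewrite lt_neqAle eq_sym ne.
    apply: ltW; rewrite ltr_cos ?in_itv /=; [by rewrite ltr_pM2l|apply/andP; split; nra|apply/andP; split; nra].
  have cp : cos (pi * t) ^+ p.*2 <= A by rewrite lerXn2r ?nnegrE// (le_trans ct).
  have cp0 : 0 <= cos (pi * t) ^+ p.*2 by exact: exprn_ge0.
  rewrite -[p.*2.*2]addnn exprD /r.
  have -> : A * (central p / central p.*2) * (cos (pi * t) ^+ p.*2 / central p) -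
     cos (pi * t) ^+ p.*2 * cos (pi * t) ^+ p.*2 / central p.*2 =
     (A - cos (pi * t) ^+ p.*2) * cos (pi * t) ^+ p.*2 / central p.*2.
    by field; rewrite !gt_eqF.
  by rewrite divr_ge0 ?(ltW c2)// mulr_ge0// subr_ge0.
rewrite /u !stair_half mulr1 => h.
have s1 : 2^-1 <= stair p x by rewrite -(stair0 p) le_stair.
have r2 : r <= 2 by rewrite ler_pdivrMr// central_half.
have r0 : 0 <= r by rewrite divr_ge0// ltW.
have Ar : 0 <= A * r by rewrite mulr_ge0.
have : A * r * (1 - stair p x) <= A * r * 2^-1 by rewrite ler_wpM2l//; lra.
have : A * r <= A * 2 by rewrite ler_wpM2l.
rewrite -/A; lra.
Qed.

(** Periodicity reduces to [(0, 1]]. The left half is [stair_tail], the right half its image under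
    the symmetry [x -> 1 - x]. *)
Lemma stair_ceil p (z : nat) x : (0 < p)%N -> z%:R < x <= z%:R + 1 ->
  `|z%:R + 1 - stair p.*2 x| <= cos (pi * x) ^+ p.*2.
Proof.
move=> p0; elim: z x => [|z IH] x /andP[zx xz].
  rewrite add0r in xz *.
  have [h|h] := leP x 2^-1.
    have /andP[h1 h2] := stair_tail p0 (introT andP (conj (ltW zx) h)).
    by rewrite ger0_norm.
  have /andP[h1 h2] : 0 <= 1 - stair p.*2 (1 - x) <= cos (pi * (1 - x)) ^+ p.*2.
    by apply: stair_tail => //; apply/andP; split; lra.
  have e : stair p.*2 (1 - x) = 2 - stair p.*2 x.
    by rewrite addrC stairD1 stairN; ring.
  rewrite e in h1 h2; rewrite distrC ger0_norm; last by lra.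
  rewrite mulrBr mulr1 cosB cospi sinpi mul0r addr0 mulN1r -mul2n exprM sqrrN -exprM mul2n in h2.
  lra.
have -> : x = (x - 1) + 1 by ring.
rewrite stairD1 mulrDr mulr1 cosD cospi sinpi mulr0 subr0 mulrN1 -mul2n exprM sqrrN -exprM mul2n.
rewrite -natr1 in zx xz *.
have := IH (x - 1); rewrite (_ : z%:R + 1 + 1 - (stair p.*2 (x - 1) + 1) = z%:R + 1 - stair p.*2 (x - 1)); last by ring.
by apply; apply/andP; split; lra.
Qed.

End Staircase.

(** * Van der Corput estimates *)

Section VanDerCorput.
Variables (R : realType) (X : Type) (m : mean R X) (T S : X -> X).
Hypotheses (m1 : ex m (fun=> 1) = 1) (pT : preserves m T) (pS : preserves m S).
Hypothesis TS : forall x, T (S x) = S (T x).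

Lemma sum_sym_diag (r : nat -> nat -> R) n : (forall k l, r k l = r l k) ->
  \sum_(0 <= k < n) \sum_(0 <= l < n) r k l =
  \sum_(0 <= k < n) r k k + 2 * \sum_(1 <= d < n) \sum_(0 <= k < n - d) r k (k + d)%N.
Proof.
move=> rs; elim: n => [|n IH]; first by rewrite !big_geq// mulr0 addr0.
rewrite big_nat_recr//=; under eq_bigr do rewrite big_nat_recr//=.
rewrite big_split /= IH [\sum_(0 <= l < n.+1) r n l]big_nat_recr//= [\sum_(0 <= k < n.+1) r k k]big_nat_recr//=.
have -> : \sum_(0 <= l < n) r n l = \sum_(0 <= k < n) r k n by apply: eq_bigr => i _; rewrite rs.
have -> : \sum_(1 <= d < n.+1) \sum_(0 <= k < n.+1 - d) r k (k + d)%N =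
  \sum_(1 <= d < n) \sum_(0 <= k < n - d) r k (k + d)%N + \sum_(0 <= k < n) r k n.
  have -> : \sum_(0 <= k < n) r k n = \sum_(1 <= d < n.+1) r (n - d)%N n.
    rewrite big_add1 /= big_nat_rev /=; apply: eq_big_nat => i /andP[_ iN].
    by rewrite add0n.
  have [->|n0] := posnP n; first by rewrite !big_geq// addr0.
  have -> : \sum_(1 <= d < n) \sum_(0 <= k < n - d) r k (k + d)%N =
      \sum_(1 <= d < n.+1) \sum_(0 <= k < n - d) r k (k + d)%N.
    by rewrite [RHS]big_nat_recr//= subnn [X in _ + X]big_geq// addr0.
  rewrite -big_split /=; apply: eq_big_nat => d /andP[d1 dn].
  rewrite subSn; last by lia.
  by rewrite big_nat_recr//= subnK//; lia.
by ring.
Qed.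

(** The two sums are the real and imaginary parts of one exponential sum; adding their squares
    merges the cross terms into [cos (w k - w l)]. *)
Lemma vdc_sq n (w : nat -> R) (u : nat -> X -> R) :
  (forall k, bm m (u k)) -> (forall k x, `|u k x| <= 1) ->
  ex m (fun x => (\sum_(0 <= k < n) cos (w k) * u k x) ^+ 2) +
  ex m (fun x => (\sum_(0 <= k < n) sin (w k) * u k x) ^+ 2) <=
  n%:R + 2 * \sum_(1 <= d < n) `|\sum_(0 <= k < n - d) cos (w k - w (k + d)%N) * ex m (fun x => u k x * u (k + d)%N x)|.
Proof.
move=> bu u1; have buu k l : bm m (fun x => u k x * u l x) by exact: bmM.
have sqe (c : nat -> R) : ex m (fun x => (\sum_(0 <= k < n) c k * u k x) ^+ 2) =
    \sum_(0 <= k < n) \sum_(0 <= l < n) c k * c l * ex m (fun x => u k x * u l x).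
  have -> : (fun x => (\sum_(0 <= k < n) c k * u k x) ^+ 2) =
      fun x => \sum_(0 <= k < n) \sum_(0 <= l < n) c k * c l * (u k x * u l x).
    apply: funext => x; rewrite expr2 mulr_suml; apply: eq_bigr => k _.
    by rewrite mulr_sumr; apply: eq_bigr => l _; ring.
  rewrite ex_sum; last by move=> k _; apply: bm_sum => l _; exact: bmZ.
  apply: eq_bigr => k _; rewrite ex_sum; last by move=> l _; exact: bmZ.
  by apply: eq_bigr => l _; rewrite exZ.
rewrite !sqe -big_split /=.
under eq_bigr do rewrite -big_split /=.
under eq_bigr do under eq_bigr do rewrite -mulrDl -cosB.
rewrite (sum_sym_diag (r := fun k l => cos (w k - w l) * ex m (fun x => u k x * u l x))); last first.
  move=> k l; rewrite -cosN opprB; congr (_ * ex _ _).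
  by apply: funext => x; rewrite mulrC.
apply: lerD.
  have -> : n%:R = \sum_(0 <= k < n) (1 : R) by rewrite sumr_const_nat subn0.
  apply: ler_sum => k _; rewrite subrr cos0 mul1r -m1.
  apply: le_ex; [exact: buu|exact: bm_cst|move=> x].
  by rewrite -expr2 -real_normK ?num_real// expr_le1.
rewrite ler_pM2l//; apply: ler_sum => d _; exact: ler_norm.
Qed.

Lemma ex_shift_corr (A B : X -> R) k l : bm m A -> bm m B ->
  ex m (fun x => A (iter k T x) * B (iter k S x)) =
  ex m (fun x => A (iter (k + l) T x) * B (iter k S (iter l T x))).
Proof.
move=> bA bB.
have bb : bm m (fun x => A (iter k T x) * B (iter k S x)).
  by apply: bmM; [exact: (bm_iter pT)|exact: (bm_iter pS)].
rewrite -(ex_comp (preserves_iter pT l) bb); congr (ex _ _).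
by apply: funext => x; rewrite -iterD.
Qed.

(** After a shift by [T^(n-k)] the factor with [A] no longer depends on [k] and is removed by
    Cauchy-Schwarz. The correlations of the remaining functions depend only on the shift [d], so
    they leave the sum over [k], which becomes scalar. *)
Lemma inner_bound n p (w : nat -> R) (A B : X -> R) : bm m A -> bm m B ->
  (forall x, `|A x| <= 1) -> (forall x, `|B x| <= 1) ->
  (\sum_(0 <= k < n) cos (w k) * ex m (fun x => A (iter (p + k) T x) * B (iter (p + k) S x))) ^+ 2
  <= n%:R + 2 * \sum_(1 <= d < n) `|\sum_(0 <= k < n - d) cos (w k - w (k + d)%N)|.
Proof.
move=> bA bB A1 B1.
pose V k x := B (iter (p + k) S (iter (n - k) T x)).
have bV k : bm m (V k) by have := bm_iter pT (n - k) (bm_iter pS (p + k) bB).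
have V1 k x : `|V k x| <= 1 by exact: B1.
have bAn : bm m (fun x => A (iter (p + n) T x)) by exact: (bm_iter pT).
have -> : \sum_(0 <= k < n) cos (w k) * ex m (fun x => A (iter (p + k) T x) * B (iter (p + k) S x)) =
   ex m (fun x => A (iter (p + n) T x) * \sum_(0 <= k < n) cos (w k) * V k x).
  have -> : (fun x => A (iter (p + n) T x) * \sum_(0 <= k < n) cos (w k) * V k x) =
      fun x => \sum_(0 <= k < n) cos (w k) * (A (iter (p + n) T x) * V k x).
    by apply: funext => x; rewrite mulr_sumr; apply: eq_bigr => k _; rewrite mulrCA.
  rewrite ex_sum; last by move=> k _; apply: bmZ; exact: bmM.
  apply: eq_big_nat => k /andP[_ kn]; rewrite exZ; last exact: bmM.
  rewrite (ex_shift_corr (p + k) (n - k) bA bB); congr (_ * ex _ _).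
  by apply: funext => x; rewrite -addnA subnKC// ltnW.
have bc : bm m (fun x => \sum_(0 <= k < n) cos (w k) * V k x) by apply: bm_sum => k _; exact: bmZ.
have bs : bm m (fun x => \sum_(0 <= k < n) sin (w k) * V k x) by apply: bm_sum => k _; exact: bmZ.
apply: (@le_trans _ _ (nrm m (fun x => \sum_(0 <= k < n) cos (w k) * V k x) ^+ 2)).
  rewrite -real_normK ?num_real// ler_sqr ?nnegrE ?nrm_ge0//.
  apply: le_trans (ler_norm_ex bAn bc) _.
  by rewrite ler_piMl ?nrm_ge0//; apply: nrm_le_bound.
rewrite nrm_sq//.
apply: (@le_trans _ _ (ex m (fun x => (\sum_(0 <= k < n) cos (w k) * V k x) ^+ 2) +
  ex m (fun x => (\sum_(0 <= k < n) sin (w k) * V k x) ^+ 2))).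
  by rewrite lerDl exsq_ge0.
apply: le_trans (vdc_sq n w bV V1) _.
rewrite lerD2l ler_pM2l// big_nat_cond [leRHS]big_nat_cond; apply: ler_sum => d.
rewrite andbT => /andP[d1 dn].
(* At [y = S^(p+k) T^(n-k-d) x] the product of [V k] and [V (k + d)] is [B (T^d y) * B (S^d y)],
   whose mean is free of [k]. *)
pose rho := ex m (fun x => B (iter d T x) * B (iter d S x)).
have bdd : bm m (fun x => B (iter d T x) * B (iter d S x)).
  by apply: bmM; [exact: (bm_iter pT)|exact: (bm_iter pS)].
have -> : \sum_(0 <= k < n - d) cos (w k - w (k + d)%N) * ex m (fun x => V k x * V (k + d)%N x) =
   (\sum_(0 <= k < n - d) cos (w k - w (k + d)%N)) * rho.
  rewrite mulr_suml; apply: eq_big_nat => k /andP[_ kn]; congr (_ * _).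
  rewrite /rho -(ex_comp (preserves_iter pS (p + k)) bdd).
  have bdd' := bm_comp (preserves_iter pS (p + k)) bdd.
  rewrite -(ex_comp (preserves_iter pT (n - k - d)) bdd'); congr (ex _ _).
  apply: funext => x; congr (B _ * B _).
    rewrite [RHS]iterTS// -[in RHS]iterD; congr (iter _ S (iter _ T _)); lia.
  rewrite -[RHS]iterD (_ : (n - (k + d))%N = (n - k - d)%N); last by lia.
  by congr (iter _ S _); lia.
rewrite normrM ler_piMr//.
have h : nrm m (fun x => B (iter d T x)) <= 1 by apply: nrm_le_bound => //; exact: (bm_iter pT).
have h' : nrm m (fun x => B (iter d S x)) <= 1 by apply: nrm_le_bound => //; exact: (bm_iter pS).
apply: le_trans (ler_norm_ex _ _) _; [exact: (bm_iter pT)|exact: (bm_iter pS)|].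
by rewrite mulr_ile1 ?nrm_ge0.
Qed.

Variables f g : X -> R.
Hypotheses (bf : bm m f) (bg : bm m g).
Hypotheses (f1 : forall x, `|f x| <= 1) (g1 : forall x, `|g x| <= 1).

Definition prodTS k : X -> R := fun x => f (iter k T x) * g (iter k S x).

Lemma bm_prodTS k : bm m (prodTS k).
Proof. by apply: bmM; [exact: (bm_iter pT)|exact: (bm_iter pS)]. Qed.

Lemma prodTS_le1 k x : `|prodTS k x| <= 1.
Proof. by rewrite normrM mulr_ile1. Qed.

(** [F_k F_(k+d)] is again a product along [T] and [S], of [f * f o T^d] and [g * g o S^d], so
    [inner_bound] applies for each shift [d]. *)
Lemma block_bound n p (w : nat -> R) :
  ex m (fun x => (\sum_(0 <= k < n) cos (w k) * prodTS (p + k) x) ^+ 2) +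
  ex m (fun x => (\sum_(0 <= k < n) sin (w k) * prodTS (p + k) x) ^+ 2) <=
  n%:R + 2 * \sum_(1 <= d < n) Num.sqrt ((n - d)%:R + 2 * \sum_(1 <= e < n - d)
     `|\sum_(0 <= k < n - d - e) cos ((w k - w (k + d)%N) - (w (k + e)%N - w (k + e + d)%N))|).
Proof.
apply: le_trans (vdc_sq n w (fun k => bm_prodTS (p + k)) (fun k x => prodTS_le1 (p + k) x)) _.
rewrite lerD2l ler_pM2l//; apply: ler_sum => d _.
pose A x := f x * f (iter d T x); pose B x := g x * g (iter d S x).
have bA : bm m A by apply: bmM => //; exact: (bm_iter pT).
have bB : bm m B by apply: bmM => //; exact: (bm_iter pS).
have A1 x : `|A x| <= 1 by rewrite normrM mulr_ile1.
have B1 x : `|B x| <= 1 by rewrite normrM mulr_ile1.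
have -> : \sum_(0 <= k < n - d) cos (w k - w (k + d)%N) * ex m (fun x => prodTS (p + k) x * prodTS (p + (k + d)) x) =
   \sum_(0 <= k < n - d) cos (w k - w (k + d)%N) * ex m (fun x => A (iter (p + k) T x) * B (iter (p + k) S x)).
  apply: eq_bigr => k _; congr (_ * ex _ _); apply: funext => x.
  rewrite /prodTS /A /B -!iterD (_ : (d + (p + k))%N = (p + (k + d))%N); last by lia.
  by ring.
rewrite -sqrtr_sqr ler_wsqrtr//.
exact: (inner_bound (n - d) p (fun k => w k - w (k + d)%N) bA bB A1 B1).
Qed.

End VanDerCorput.

(** * Second differences of the phases *)

Section PhaseSums.
Variable R : realType.
Variables (ga : R).
Hypotheses (ga0 : 0 < ga) (ga1 : ga < 1).

(** The coefficient of [y^(ga - 3)] in the third derivative of [y^ga]. *)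
Definition third : R := ga * (1 - ga) * (2 - ga).

Lemma third_gt0 : 0 < third.
Proof. by have := (ga0, ga1) => -[h0 h1]; rewrite /third !mulr_gt0// subr_gt0//; lra. Qed.

(** The increments of the second differences are third differences, [d e third xi^(ga-3)] times
    [2 pi j]; [hlo] and [hup] place them between [lam d e] and [pi]. They decrease because a fourth
    difference of [y^ga] is nonpositive. *)
Lemma phase_sum (j p n d e : nat) (lam : R) (w : nat -> R) : (0 < j)%N -> (0 < p)%N -> (0 < d)%N -> (0 < e)%N ->
  0 < lam -> lam <= 2 * pi * j%:R * third * (p + n)%:R `^ (ga - 3) ->
  2 * pi * j%:R * third * n%:R ^+ 2 * p%:R `^ (ga - 3) <= pi ->
  (forall k, w k = 2 * pi * j%:R * (p + k)%:R `^ ga) ->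
  `|\sum_(0 <= k < n - d - e) cos ((w k - w (k + d)%N) - (w (k + e)%N - w (k + e + d)%N))|
    <= 1 + 2 / (lam * d%:R * e%:R).
Proof.
move=> j0 p0 d0 e0 lam0 hlo hup wE; have g0 := ga0; have g1 := ga1.
have pi0 := @pi_gt0 R; have th0 := third_gt0.
have jR : 0 < (j%:R : R) by rewrite ltr0n.
have dR : 0 < (d%:R : R) by rewrite ltr0n.
have eR : 0 < (e%:R : R) by rewrite ltr0n.
have J0 : 0 < 2 * pi * (j%:R : R) by rewrite !mulr_gt0.
pose P (y : R) := y `^ ga.
have phiE k : (w k - w (k + d)%N) - (w (k + e)%N - w (k + e + d)%N) =
    2 * pi * j%:R * dif [:: d%:R; e%:R] P (p + k)%:R.
  rewrite !wE /= /P !addnA !natrD.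
  rewrite (_ : p%:R + k%:R + e%:R + d%:R = p%:R + k%:R + d%:R + e%:R :> R); last by ring.
  by ring.
under eq_bigr do rewrite phiE.
have x0 k : 0 < ((p + k)%:R : R) by rewrite ltr0n addn_gt0 p0.
have stepE k : 2 * pi * j%:R * dif [:: d%:R; e%:R] P (p + k.+1)%:R - 2 * pi * j%:R * dif [:: d%:R; e%:R] P (p + k)%:R
   = 2 * pi * j%:R * dif [:: 1; d%:R; e%:R] P (p + k)%:R.
  by rewrite -mulrBr addnS -[(p + k).+1%:R]natr1.
apply: kusmin_landau; first by rewrite !mulr_gt0.
  move=> k kn; rewrite stepE.
  have kde : (k.+1 + d + e <= n)%N by move: kn; clear; lia.
  have dn : (d <= n)%N by move: kde; clear; lia.
  have en : (e <= n)%N by move: kde; clear; lia.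
  have [|xi /andP[x1 x2] E] := @dif_powR_MVT R [:: 1; d%:R; e%:R] ga (p + k)%:R (x0 k).
    by rewrite /= ler01 !ler0n.
  have {}E : dif [:: 1; d%:R; e%:R] P (p + k)%:R = d%:R * e%:R * third * xi `^ (ga - 3).
    by rewrite E !big_cons big_nil /= /third; ring.
  rewrite E; rewrite !big_cons big_nil in x2.
  have xi0 : 0 < xi by exact: lt_le_trans (x0 k) x1.
  have xin : xi <= (p + n)%:R.
    apply: le_trans x2 _; have : (k.+1 + d + e)%:R <= n%:R :> R by rewrite ler_nat.
    by rewrite addr0 !natrD -natr1 => h; rewrite -!addrA lerD2l !addrA.
  have pxi : p%:R <= xi by apply: le_trans x1; rewrite ler_nat leq_addr.
  have pR : 0 < (p%:R : R) by rewrite ltr0n.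
  have neg (a b : R) : 0 < a -> a <= b -> b `^ (ga - 3) <= a `^ (ga - 3).
    move=> a0 ab; have b0 := lt_le_trans a0 ab.
    have -> : ga - 3 = - (3 - ga) by ring.
    rewrite !powRN lef_pV2 ?posrE ?powR_gt0//.
    by apply: ge0_ler_powR; rewrite ?nnegrE ?(ltW a0) ?(ltW b0)//; lra.
  have lo := neg _ _ xi0 xin; have up := neg _ _ pR pxi.
  apply/andP; split.
    have -> : 2 * pi * j%:R * (d%:R * e%:R * third * xi `^ (ga - 3)) =
       (2 * pi * j%:R * third * xi `^ (ga - 3)) * d%:R * e%:R by ring.
    rewrite ler_pM2r// ler_pM2r//; apply: le_trans hlo _.
    by rewrite ler_pM2l// mulr_gt0.
  apply: le_trans hup.
  have -> : 2 * pi * j%:R * (d%:R * e%:R * third * xi `^ (ga - 3)) =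
     (2 * pi * j%:R * third) * (d%:R * e%:R) * xi `^ (ga - 3) by ring.
  have Jt : 0 < 2 * pi * j%:R * third by rewrite mulr_gt0.
  have hde : d%:R * e%:R <= n%:R ^+ 2 :> R.
    by rewrite expr2 -!natrM ler_nat; exact: leq_mul.
  apply: (@le_trans _ _ (2 * pi * j%:R * third * n%:R ^+ 2 * xi `^ (ga - 3))).
    by rewrite ler_wpM2r ?powR_ge0// ler_pM2l.
  by rewrite ler_wpM2l// mulr_ge0 ?(ltW Jt)// exprn_ge0.
move=> k kn; rewrite !stepE ler_pM2l// -subr_le0.
have -> : dif [:: 1; d%:R; e%:R] P (p + k.+1)%:R - dif [:: 1; d%:R; e%:R] P (p + k)%:R =
    dif [:: 1; 1; d%:R; e%:R] P (p + k)%:R by rewrite addnS -natr1.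
have [|xi _ ->] := @dif_powR_MVT R [:: 1; 1; d%:R; e%:R] ga (p + k)%:R (x0 k).
  by rewrite /= ler01 !ler0n.
rewrite !big_cons big_nil /= !mulr1 !mul1r mulr_le0_ge0 ?powR_ge0// mulr_ge0_le0 ?mulr_ge0//.
have -> : ga * ((ga - 1) * ((ga - 1 - 1) * (ga - 1 - 1 - 1))) = - (third * (3 - ga)) by rewrite /third; ring.
by rewrite oppr_le0 mulr_ge0 ?(ltW th0)//; lra.
Qed.

Lemma sum_inv_sqrt n : \sum_(1 <= d < n.+1) (Num.sqrt d%:R)^-1 <= 2 * Num.sqrt n%:R :> R.
Proof.
elim: n => [|n IH]; first by rewrite big_geq// mulr_ge0 ?sqrtr_ge0.
rewrite big_nat_recr//=.
set a := Num.sqrt n%:R in IH *; set b := Num.sqrt n.+1%:R.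
have a0 : 0 <= a by exact: sqrtr_ge0.
have b0 : 0 < b by rewrite sqrtr_gt0 ltr0n.
have a2 : a ^+ 2 = n%:R by rewrite sqr_sqrtr.
have b2 : b ^+ 2 = n%:R + 1 by rewrite sqr_sqrtr// natr1.
have : b^-1 <= 2 * (b - a).
  rewrite -(ler_pM2r b0) mulVf ?gt_eqF//.
  have := sqr_ge0 (b - a); nra.
lra.
Qed.

Lemma sum_inv_sqrt_lt n : \sum_(1 <= d < n) (Num.sqrt d%:R)^-1 <= 2 * Num.sqrt n%:R :> R.
Proof.
case: n => [|n]; first by rewrite big_geq// mulr_ge0 ?sqrtr_ge0.
by apply: le_trans (sum_inv_sqrt n) _; rewrite ler_pM2l// ler_wsqrtr// ler_nat.
Qed.

End PhaseSums.

Lemma sqrtrD_le (R : realType) (a b : R) : 0 <= a -> 0 <= b ->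
  Num.sqrt (a + b) <= Num.sqrt a + Num.sqrt b.
Proof.
move=> a0 b0; have sa := sqrtr_ge0 a; have sb := sqrtr_ge0 b.
rewrite -(@ler_sqr R) ?nnegrE ?sqrtr_ge0 ?addr_ge0//.
rewrite sqrrD !sqr_sqrtr ?addr_ge0//.
have := mulr_ge0 sa sb; lra.
Qed.

(** * Exponential sums weighted by the products along [T] and [S] *)

Section ExpSums.
Variables (R : realType) (X : Type) (m : mean R X) (T S : X -> X).
Hypotheses (m1 : ex m (fun=> 1) = 1) (pT : preserves m T) (pS : preserves m S).
Hypothesis TS : forall x, T (S x) = S (T x).
Variables f g : X -> R.
Hypotheses (bf : bm m f) (bg : bm m g).
Hypotheses (f1 : forall x, `|f x| <= 1) (g1 : forall x, `|g x| <= 1).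
Variable ga : R.
Hypotheses (ga0 : 0 < ga) (ga1 : ga < 1).

Local Notation F := (prodTS T S f g).

(** What [block_bound] gives on a block of length [N]: the diagonal, then for each first shift the
    root of a trivial part [3N] and of the Kusmin-Landau part. *)
Definition energy (N lam : R) : R :=
  N + 2 * (N * Num.sqrt (3 * N) + Num.sqrt (8 * Num.sqrt N / lam) * (2 * Num.sqrt N)).

Lemma block_energy (j p s n N : nat) (lam : R) (w : nat -> R) :
  (0 < j)%N -> (0 < p)%N -> (n <= N)%N -> 0 < lam ->
  lam <= 2 * pi * j%:R * third ga * (p + s + n)%:R `^ (ga - 3) ->
  2 * pi * j%:R * third ga * N%:R ^+ 2 * (p + s)%:R `^ (ga - 3) <= pi ->
  (forall k, w k = 2 * pi * j%:R * (p + s + k)%:R `^ ga) ->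
  ex m (fun x => (\sum_(0 <= k < n) cos (w k) * F (p + k) x) ^+ 2) +
  ex m (fun x => (\sum_(0 <= k < n) sin (w k) * F (p + k) x) ^+ 2) <= energy N%:R lam.
Proof.
move=> j0 p0 nN lam0 hlo hup wE.
have pi0 := @pi_gt0 R; have th0 := third_gt0 ga0 ga1.
have nNR : (n%:R : R) <= N%:R by rewrite ler_nat.
have hup' : 2 * pi * j%:R * third ga * n%:R ^+ 2 * (p + s)%:R `^ (ga - 3) <= pi.
  apply: le_trans hup; rewrite ler_wpM2r ?powR_ge0// ler_wpM2l//.
    by apply: mulr_ge0 (ltW th0); rewrite mulr_ge0// mulr_ge0// ltW.
  by rewrite ler_sqr ?nnegrE.
set sN := Num.sqrt (N%:R : R).
have sN0 : 0 <= sN by exact: sqrtr_ge0.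
have sumN (n' : nat) : (n' <= N)%N -> \sum_(1 <= e < n') (Num.sqrt e%:R)^-1 <= 2 * sN :> R.
  move=> h; apply: le_trans (sum_inv_sqrt_lt R n') _.
  by rewrite ler_pM2l// ler_wsqrtr// ler_nat.
apply: le_trans (block_bound m1 pT pS TS bf bg f1 g1 n p w) _.
rewrite /energy lerD// ler_pM2l//.
apply: (@le_trans _ _ (\sum_(1 <= d < n) (Num.sqrt (3 * N%:R) + Num.sqrt (8 * sN / lam) * (Num.sqrt d%:R)^-1))).
  rewrite big_nat_cond [leRHS]big_nat_cond; apply: ler_sum => d.
  rewrite andbT => /andP[d1 dn].
  have dR : 0 < (d%:R : R) by rewrite ltr0n.
  rewrite -sqrtrV ?ler0n// -sqrtrM; last by rewrite divr_ge0 ?mulr_ge0// ltW.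
  apply: le_trans (sqrtrD_le _ _); [|by rewrite mulr_ge0|by rewrite mulr_ge0 ?invr_ge0 ?divr_ge0 ?mulr_ge0// ltW].
  rewrite ler_wsqrtr//.
  have inner : \sum_(1 <= e < n - d)
     `|\sum_(0 <= k < n - d - e) cos ((w k - w (k + d)%N) - (w (k + e)%N - w (k + e + d)%N))|
     <= N%:R + 4 * sN / (lam * d%:R).
    (* Weakening [1/e] to [e^(-1/2)] keeps logarithms out; it is the origin of the inner factor
       [Num.sqrt N] in [energy]. *)
    apply: (@le_trans _ _ (\sum_(1 <= e < n - d) (1 + 2 / (lam * d%:R) * (Num.sqrt e%:R)^-1))).
      rewrite big_nat_cond [leRHS]big_nat_cond; apply: ler_sum => e.
      rewrite andbT => /andP[e1 en].
      have := phase_sum ga0 ga1 j0 _ d1 e1 lam0 hlo hup' wE.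
      rewrite addn_gt0 p0 => /(_ isT) h; apply: le_trans h _.
      rewrite lerD2l invfM mulrA ler_wpM2l//.
        by rewrite divr_ge0// mulr_ge0// ltW.
      have eR : 1 <= (e%:R : R) by rewrite ler1n.
      have e0 : 0 < (e%:R : R) by rewrite ltr0n.
      rewrite lef_pV2 ?posrE ?sqrtr_gt0//.
      rewrite -{2}(sqr_sqrtr (ltW e0)) expr2 ler_peMl ?sqrtr_ge0//.
      by rewrite -[X in X <= _]sqrtr1 ler_wsqrtr.
    rewrite big_split /= sumr_const_nat -mulr_sumr; apply: lerD.
      by rewrite ler_nat; exact: leq_trans (leq_subr _ _) (leq_trans (leq_subr _ _) nN).
    have := sumN (n - d)%N; rewrite (leq_trans (leq_subr _ _) nN) => /(_ isT) h.
    have l0 : 0 <= 2 / (lam * d%:R) by rewrite divr_ge0// mulr_ge0// ltW.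
    apply: le_trans (ler_wpM2l l0 h) _; lra.
  have nd : ((n - d)%:R : R) <= N%:R by rewrite ler_nat (leq_trans (leq_subr _ _)).
  rewrite [8 * sN / lam * _](_ : _ = 2 * (4 * sN / (lam * d%:R))); last first.
    by field; rewrite !gt_eqF.
  lra.
rewrite big_split /= sumr_const_nat -mulr_sumr; apply: lerD.
  rewrite -[X in X <= _]mulr_natl ler_wpM2r ?sqrtr_ge0// ler_nat; exact: leq_trans (leq_subr _ _) nN.
by rewrite ler_wpM2l ?sqrtr_ge0// sumN.
Qed.

Lemma range_nrm_le (u : nat -> X -> R) (K0 K N : nat) (B : R) : (0 < N)%N -> 0 <= B ->
  (forall k, bm m (u k)) ->
  (forall p n, (K0 <= p)%N -> (p + n <= K)%N -> (n <= N)%N ->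
     nrm m (fun x => \sum_(0 <= k < n) u (p + k)%N x) <= B) ->
  forall L p, (K0 <= p)%N -> (p + L <= K)%N ->
     nrm m (fun x => \sum_(0 <= k < L) u (p + k)%N x) <= (L %/ N).+1%:R * B.
Proof.
move=> N0 B0 bu h L; have [n Ln] := ubnP L; elim: n => // n IH in L Ln *.
move=> p Kp pL; have [LN|NL] := leqP L N.
  apply: le_trans (h p L Kp pL LN) _; rewrite ler_peMl//.
  by rewrite ler1n.
have -> : (fun x => \sum_(0 <= k < L) u (p + k)%N x) =
  fun x => \sum_(0 <= k < N) u (p + k)%N x + \sum_(0 <= k < L - N) u (p + N + k)%N x.
  apply: funext => x; rewrite (@big_cat_nat _ _ _ N)//=; last exact: ltnW.
  congr (_ + _); rewrite -{1}(add0n N) big_addn; apply: eq_bigr => k _.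
  by rewrite (addnC k) addnA.
have bs a b q : bm m (fun x => \sum_(a <= k < b) u (q + k)%N x) by apply: bm_sum.
apply: le_trans (ler_nrmD (bs _ _ _) (bs _ _ _)) _.
have h1 : nrm m (fun x => \sum_(0 <= k < N) u (p + k)%N x) <= B by apply: h => //; lia.
have h2 : nrm m (fun x => \sum_(0 <= k < L - N) u (p + N + k)%N x) <= ((L - N) %/ N).+1%:R * B.
  by apply: IH; lia.
apply: le_trans (lerD h1 h2) _.
have -> : (L %/ N)%N = ((L - N) %/ N).+1.
  by rewrite -{1}(subnK (ltnW NL)) divnDr// divnn N0 addn1.
by rewrite -(natr1 ((L - N) %/ N).+1); lra.
Qed.

(** As [ga - 3 < 0], the bound by [lam] is tested at the right end and the bound by [pi] at the left
    end [K0]. The shift [s] moves the phase but not [F], because increments of the ceiling involve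
    both [k^ga] and [(k+1)^ga]. *)
Lemma exp_sum_range (j s K0 K N : nat) (lam : R) :
  (0 < j)%N -> (0 < K0 <= K)%N -> (0 < N)%N -> 0 < lam ->
  lam <= 2 * pi * j%:R * third ga * (K + s)%:R `^ (ga - 3) ->
  2 * pi * j%:R * third ga * N%:R ^+ 2 * K0%:R `^ (ga - 3) <= pi ->
  let B := (K %/ N).+1%:R * Num.sqrt (energy N%:R lam) in
  nrm m (fun x => \sum_(K0 <= k < K) cos (2 * pi * j%:R * (k + s)%:R `^ ga) * F k x) <= B /\
  nrm m (fun x => \sum_(K0 <= k < K) sin (2 * pi * j%:R * (k + s)%:R `^ ga) * F k x) <= B.
Proof.
move=> j0 /andP[K00 K0K] N0 lam0 hlo hup B.
have pi0 := @pi_gt0 R; have th0 := third_gt0 ga0 ga1.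
have jR : 0 < (j%:R : R) by rewrite ltr0n.
have J0 : 0 < 2 * pi * j%:R * third ga by apply: mulr_gt0 th0; rewrite mulr_gt0// mulr_gt0.
have neg (a b : nat) : (0 < a)%N -> (a <= b)%N -> b%:R `^ (ga - 3) <= a%:R `^ (ga - 3) :> R.
  move=> a0 ab; have -> : ga - 3 = - (3 - ga) by ring.
  have b0 := leq_trans a0 ab.
  rewrite !powRN lef_pV2 ?posrE ?powR_gt0 ?ltr0n//.
  apply: ge0_ler_powR; rewrite ?nnegrE ?ler_nat//.
  by have := ga1; lra.
have bF k : bm m (F k) by exact: (bm_prodTS pT pS).
have gen (trig : R -> R) :
  (forall n p (w : nat -> R), ex m (fun x => (\sum_(0 <= k < n) trig (w k) * F (p + k) x) ^+ 2) <=
  ex m (fun x => (\sum_(0 <= k < n) cos (w k) * F (p + k) x) ^+ 2) +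
  ex m (fun x => (\sum_(0 <= k < n) sin (w k) * F (p + k) x) ^+ 2)) ->
  nrm m (fun x => \sum_(K0 <= k < K) trig (2 * pi * j%:R * (k + s)%:R `^ ga) * F k x) <= B.
  move=> htrig.
  pose u k x := trig (2 * pi * j%:R * (k + s)%:R `^ ga) * F k x.
  have bu k : bm m (u k) by exact: bmZ.
  have blk p n : (K0 <= p)%N -> (p + n <= K)%N -> (n <= N)%N ->
     nrm m (fun x => \sum_(0 <= k < n) u (p + k)%N x) <= Num.sqrt (energy N%:R lam).
    move=> Kp pn nN; rewrite ler_wsqrtr//.
    pose w k : R := 2 * pi * j%:R * (p + s + k)%:R `^ ga.
    apply: le_trans (@block_energy j p s n N lam w j0 (leq_trans K00 Kp) nN lam0 _ _ _) => //.
    - apply: le_trans (htrig n p w); rewrite le_eqVlt; apply/orP; left; apply/eqP; congr (ex _ _).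
      apply: funext => x; congr (_ ^+ 2); apply: eq_bigr => k _.
      by rewrite /u /w addnAC.
    - apply: le_trans hlo _; rewrite ler_pM2l//; apply: neg; first by lia.
      by rewrite addnAC leq_add2r.
    - apply: le_trans hup; apply: ler_wpM2l.
        by apply: mulr_ge0; [exact: ltW|exact: exprn_ge0].
      by apply: neg => //; exact: leq_trans (leq_addr _ _).
  have := range_nrm_le N0 (sqrtr_ge0 _) bu blk (L := K - K0) (leqnn K0).
  rewrite subnKC// leqnn => /(_ isT) h.
  apply: (@le_trans _ _ (((K - K0) %/ N).+1%:R * Num.sqrt (energy N%:R lam))); last first.
    by rewrite ler_wpM2r ?sqrtr_ge0// ler_nat ltnS leq_div2r// leq_subr.
  apply: le_trans h; rewrite le_eqVlt; apply/orP; left; apply/eqP; congr (nrm _ _).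
  apply: funext => x; rewrite -{1}(add0n K0) big_addn; apply: eq_bigr => k _.
  by rewrite /u (addnC K0).
split; apply: gen => n p w.
  by rewrite lerDl exsq_ge0//; apply: bm_sum => k _; exact: bmZ.
by rewrite lerDr exsq_ge0//; apply: bm_sum => k _; exact: bmZ.
Qed.

End ExpSums.

(** * Integer parts of fractional powers *)

Section FloorPowers.
Variables (R : realType) (c : R).
Hypothesis c1 : 1 < c.
Let ga : R := c^-1.

Definition fpow (n : nat) : nat := floorn (n%:R `^ c : R).

Lemma fpow_itv n : (fpow n)%:R <= (n%:R `^ c : R) < (fpow n)%:R + 1.
Proof.
have h : 0 <= (n%:R `^ c : R) by exact: powR_ge0.
have := truncn_itv h; rewrite truncn_floor h natr1 => //.
Qed.

Lemma fpow1 : fpow 1 = 1%N.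
Proof.
have := fpow_itv 1; rewrite powR1 => /andP[h1 h2].
apply/eqP; rewrite eqn_leq; apply/andP; split; first by rewrite -(ler_nat R).
by rewrite -ltnS -(ltr_nat R) -[X in _ < X]natr1.
Qed.

Lemma powR_step n : n%:R `^ c + 1 <= n.+1%:R `^ c :> R.
Proof.
have c0 : 0 < c by exact: lt_trans c1.
have c10 : 0 <= c - 1 by rewrite subr_ge0 ltW.
rewrite -mulr_powRB1 ?ler0n// -[X in _ <= X]mulr_powRB1 ?ler0n// -natr1 mulrDl mul1r.
have h : n%:R `^ (c - 1) <= (n%:R + 1) `^ (c - 1) :> R.
  by apply: (ge0_ler_powR c10); rewrite ?nnegrE ?addr_ge0 ?lerDl ?ler01 ?ler0n.
have h1 : 1 <= (n%:R + 1) `^ (c - 1) :> R.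
  by rewrite -[X in X <= _](@powRr0 R (n%:R + 1)) ler_powR// lerDr.
by rewrite lerD// ler_wpM2l.
Qed.

Lemma fpow_lt n : (fpow n < fpow n.+1)%N.
Proof.
have /andP[h1 h2] := fpow_itv n; have /andP[h3 h4] := fpow_itv n.+1; have := powR_step n.
rewrite -(ltr_nat R); lra.
Qed.

Lemma powR_cga (x : R) : 0 <= x -> (x `^ c) `^ ga = x.
Proof. by move=> x0; rewrite -powRrM divff ?powRr1// gt_eqF// (lt_trans ltr01). Qed.

Lemma ga_gt0 : 0 < ga.
Proof. by rewrite invr_gt0 (lt_trans ltr01). Qed.

Lemma fpow_root n k : (fpow n < k <= fpow n.+1)%N -> n%:R < (k%:R `^ ga : R) <= n%:R + 1.
Proof.
have g0 := ga_gt0.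
move=> /andP[h1 h2]; have /andP[h3 h4] := fpow_itv n; have /andP[h5 h6] := fpow_itv n.+1.
apply/andP; split.
  rewrite -[X in X < _](powR_cga (ler0n _ n)); apply: gt0_ltr_powR; rewrite ?nnegrE ?powR_ge0//.
  by apply: lt_le_trans h4 _; rewrite natr1 ler_nat.
rewrite natr1 -[X in _ <= X](powR_cga (ler0n _ n.+1)); apply: ge0_ler_powR; rewrite ?nnegrE ?powR_ge0// ?(ltW g0)//.
by apply: le_trans h5; rewrite ler_nat.
Qed.

Definition ceilp (k : nat) : R := (Num.ceil (k%:R `^ ga))%:~R.

Lemma ceilp_fpow n k : (fpow n < k <= fpow n.+1)%N -> ceilp k = n%:R + 1.
Proof.
move=> /fpow_root h; rewrite /ceilp; suff -> : Num.ceil (k%:R `^ ga) = n%:Z + 1.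
  by rewrite intrD.
by apply/eqP; rewrite ceil_eq addrK intrD.
Qed.

(** The ceiling is [n + 1] for [fpow n < k <= fpow (n+1)], so from [k] to [k + 1] it grows by one if
    [k] is some [fpow n] and is constant otherwise. *)
Lemma sum_fpow (F : nat -> R) N : \sum_(1 <= n < N.+1) F (fpow n) =
  \sum_(1 <= k < fpow N.+1) (ceilp k.+1 - ceilp k) * F k.
Proof.
elim: N => [|N IH]; first by rewrite fpow1 !big_geq.
rewrite big_nat_recr//= IH.
have h1 : (1 <= fpow N.+1)%N by exact: leq_ltn_trans (fpow_lt N).
have h2 := fpow_lt N.+1.
rewrite [RHS](@big_cat_nat _ _ _ (fpow N.+1))//=; last exact: ltnW.
congr (_ + _); rewrite big_ltn// big_nat_cond big1 ?addr0.
  rewrite (@ceilp_fpow N.+1 (fpow N.+1).+1) ?ltnSn// (@ceilp_fpow N (fpow N.+1)) ?leqnn ?fpow_lt//.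
  by rewrite -natr1; ring.
move=> k /andP[/andP[k1 k2] _].
rewrite (@ceilp_fpow N.+1 k.+1) ?(ltnW (ltnW k1)) ?k2//; last by rewrite ltnS ltnW.
by rewrite (@ceilp_fpow N.+1 k) ?subrr ?mul0r// k1 ltnW.
Qed.

Lemma le_ceilp k : ceilp k <= ceilp k.+1.
Proof.
rewrite ler_int le_ceil//; apply: ge0_ler_powR; rewrite ?nnegrE ?ler_nat ?(ltW ga_gt0)//.
Qed.

Lemma ceilp_lt k : ceilp k < k%:R `^ ga + 1.
Proof. by have /andP[h _] := ceil_itv (k%:R `^ ga : R); rewrite intrB in h; rewrite -ltrBlDr. Qed.

Lemma ceilp_stair p k : (0 < p)%N -> (0 < k)%N ->
  `|ceilp k - stair p.*2 (k%:R `^ ga)| <= cos (pi * k%:R `^ ga) ^+ p.*2.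
Proof.
move=> p0 k0.
have x0 : 0 < k%:R `^ ga :> R by apply: powR_gt0; rewrite ltr0n.
have z0 : 0 < Num.ceil (k%:R `^ ga : R) by rewrite ceil_gt0.
pose z := `|Num.ceil (k%:R `^ ga : R) - 1|%N.
have zE : Num.ceil (k%:R `^ ga : R) = z%:Z + 1.
  by rewrite /z gez0_abs ?subrK// subr_ge0 -gtz0_ge1.
rewrite /ceilp zE intrD; apply: stair_ceil => //.
by have := ceil_itv (k%:R `^ ga : R); rewrite zE addrK intrD.
Qed.

Lemma root_fpowS N : N%:R <= ((fpow N.+1)%:R `^ ga : R) <= N%:R + 1.
Proof.
have := @fpow_root N (fpow N.+1); rewrite fpow_lt leqnn => /(_ isT) /andP[h1 h2].
by rewrite (ltW h1).
Qed.

Lemma fpowS_ge N : N%:R `^ c <= (fpow N.+1)%:R :> R.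
Proof. have /andP[h1 h2] := fpow_itv N.+1; have := powR_step N; lra. Qed.

Lemma fpowS_ge_id N : (N <= fpow N.+1)%N.
Proof. by elim: N => // N IH; exact: leq_ltn_trans (fpow_lt _). Qed.

End FloorPowers.

Lemma sum_bin_offcenter (R : realType) p :
  \sum_(i < p.*2.+1 | i != p :> nat) 'C(p.*2, i)%:R <= 4 ^+ p :> R.
Proof.
have -> : (4 : R) ^+ p = \sum_(i < p.*2.+1) 'C(p.*2, i)%:R.
  have := Pascal 1 1 p.*2; rewrite addn1.
  under eq_bigr do rewrite !exp1n muln1 muln1.
  move=> /(congr1 (fun n : nat => n%:R : R)); rewrite natr_sum natrX => <-.
  by rewrite -mul2n exprM; congr (_ ^+ _); ring.
by rewrite [leRHS](bigID (fun i : 'I_p.*2.+1 => i != p :> nat)) /= lerDl sumr_ge0.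
Qed.

(** * Comparison with the Cesaro limit *)

Section Comparison.
Variables (R : realType) (X : Type) (m : mean R X).
Hypothesis m1 : ex m (fun=> 1) = 1.
Variables (c : R) (c1 : 1 < c).
Let ga : R := c^-1.
Variables (F : nat -> X -> R) (h : X -> R).
Hypotheses (bF : forall k, bm m (F k)) (F1 : forall k x, `|F k x| <= 1) (bh : bm m h).

Let d k : R := k.+1%:R `^ ga - k%:R `^ ga.

Lemma ga_lt1 : ga < 1.
Proof. by rewrite invf_lt1// (lt_trans ltr01). Qed.

Lemma delta_ge0 k : 0 <= d k.
Proof.
by rewrite subr_ge0; apply: ge0_ler_powR; rewrite ?nnegrE ?ler_nat// ltW// ga_gt0.
Qed.

Lemma delta_anti k : (0 < k)%N -> d k.+1 <= d k.
Proof.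
move=> k0; have k0R : 0 < (k%:R : R) by rewrite ltr0n.
have [|xi _] := @dif_powR_MVT R [:: 1; 1] ga k%:R k0R; first by rewrite /= ler01.
rewrite /= !big_cons big_nil !mulr1 !mul1r => E.
have : d k.+1 - d k = (ga * (ga - 1)) * xi `^ (ga - 2).
  by rewrite -E /d -!natr1.
move=> E'; rewrite -subr_le0 E' mulr_le0_ge0 ?powR_ge0// mulr_ge0_le0 ?(ltW (ga_gt0 c1))//.
by rewrite subr_le0 ltW// ga_lt1.
Qed.

Lemma delta_le k : (0 < k)%N -> d k <= k%:R `^ ga / k%:R.
Proof.
move=> k0; have k0R : 0 < (k%:R : R) by rewrite ltr0n.
have [|xi /andP[x1 _]] := @dif_powR_MVT R [:: 1] ga k%:R k0R; first by rewrite /= ler01.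
rewrite /= !big_cons big_nil !mulr1 !mul1r => E.
have xi0 : 0 < xi by exact: lt_le_trans x1.
rewrite /d -natr1 E.
have g1 := ga_lt1; have g0 := ga_gt0 c1; rewrite -/ga in g0.
apply: (@le_trans _ _ (1 * xi `^ (ga - 1))); first by rewrite ler_wpM2r ?powR_ge0// ltW.
rewrite mul1r.
have -> : k%:R `^ ga / k%:R = k%:R `^ (ga - 1) :> R.
  by rewrite powRB ?powRr1 ?ler0n// (gt_eqF k0R) implybT.
have -> : ga - 1 = - (1 - ga) by ring.
rewrite !powRN lef_pV2 ?posrE ?powR_gt0//.
by apply: ge0_ler_powR; rewrite ?nnegrE ?(ltW xi0) ?(ltW k0R)// subr_ge0 ltW.
Qed.

Lemma abel_nrm_le (P : nat -> X -> R) (K0 K : nat) (W : R) : (0 < K0 <= K)%N -> 0 <= W ->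
  (forall k, bm m (P k)) -> (forall k, (K0 <= k <= K)%N -> nrm m (P k) <= W) ->
  nrm m (fun x => \sum_(K0 <= k < K) d k * (P k.+1 x - P k x)) <= 2 * d K0 * W.
Proof.
move=> /andP[K00 K0K] W0 bP hP.
have d0 k : 0 <= d k by exact: delta_ge0.
have bS L : bm m (fun x => \sum_(K0 <= k < L) d k * (P k.+1 x - P k x)).
  by apply: bm_sum => k _; apply: bmZ; exact: bmB.
move: hP; have [->|ne] := eqVneq K K0 => hP.
  under eq_fun do rewrite big_geq//.
  by rewrite nrm0 !mulr_ge0.
have {ne} lt : (K0 < K)%N by rewrite ltn_neqAle eq_sym ne.
(* As in [abel_bound] the boundary term is carried along; the weights now decrease from [d K0]. *)
suff key L : (K0 < L <= K)%N ->
    nrm m (fun x => \sum_(K0 <= k < L) d k * (P k.+1 x - P k x) - d L.-1 * P L x) <= (2 * d K0 - d L.-1) * W.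
  have := key K; rewrite lt leqnn => /(_ isT) hK.
  have -> : (fun x => \sum_(K0 <= k < K) d k * (P k.+1 x - P k x)) =
     fun x => (\sum_(K0 <= k < K) d k * (P k.+1 x - P k x) - d K.-1 * P K x) + d K.-1 * P K x.
    by apply: funext => x; rewrite subrK.
  apply: le_trans (ler_nrmD (bmB (bS K) (bmZ _ (bP K))) (bmZ _ (bP K))) _.
  have : nrm m (fun x => d K.-1 * P K x) <= d K.-1 * W.
    by rewrite nrmZ// ger0_norm// ler_wpM2l// hP// leqnn K0K.
  lra.
elim: L => [//|L IH] /andP[KL LK].
have [e|{}ne] := eqVneq L K0.
  subst L; have -> : (fun x => \sum_(K0 <= k < K0.+1) d k * (P k.+1 x - P k x) - d K0 * P K0.+1 x) =
     fun x => - d K0 * P K0 x.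
    by apply: funext => x; rewrite big_nat1; ring.
  rewrite nrmZ// normrN ger0_norm//= (_ : 2 * d K0 - d K0 = d K0); last by ring.
  by rewrite ler_wpM2l// hP// leqnn K0K.
have KL' : (K0 < L)%N by rewrite ltn_neqAle eq_sym ne -ltnS.
have L0 : (0 < L)%N by exact: leq_ltn_trans KL'.
have {}IH := IH (introT andP (conj KL' (ltnW LK))).
have -> : (fun x => \sum_(K0 <= k < L.+1) d k * (P k.+1 x - P k x) - d L * P L.+1 x) =
   fun x => (\sum_(K0 <= k < L) d k * (P k.+1 x - P k x) - d L.-1 * P L x) + (d L.-1 - d L) * P L x.
  by apply: funext => x; rewrite big_nat_recr//=; ring.
apply: le_trans (ler_nrmD (bmB (bS L) (bmZ _ (bP L))) (bmZ _ (bP L))) _.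
have dd : 0 <= d L.-1 - d L.
  rewrite subr_ge0 -{1}(prednK L0); apply: delta_anti.
  by rewrite -ltnS prednK// (leq_ltn_trans _ KL').
have : nrm m (fun x => (d L.-1 - d L) * P L x) <= (d L.-1 - d L) * W.
  by rewrite nrmZ// ger0_norm// ler_wpM2l// hP// (ltnW KL') ltnW.
rewrite /=; lra.
Qed.

Let psi p (x : R) := stair p x - x - 2^-1.

(** All frequencies are at least one in absolute value, and the binomial ratios sum to at most
    [4^p / C(2p, p)]. Negative frequencies reduce to positive ones since sine is odd. *)
Lemma psi_sum_nrm_le p s K0 K (B : R) : (0 < p)%N -> 0 <= B ->
  (forall j, (0 < j <= p)%N ->
    nrm m (fun x => \sum_(K0 <= k < K) sin (2 * pi * j%:R * (k + s)%:R `^ ga) * F k x) <= B) ->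
  nrm m (fun x => \sum_(K0 <= k < K) psi p ((k + s)%:R `^ ga) * F k x) <= B / central R p.
Proof.
move=> p0 B0 hB.
have bS j : bm m (fun x => \sum_(K0 <= k < K) sin (j * (k + s)%:R `^ ga) * F k x).
  by apply: bm_sum => k _; exact: bmZ.
pose co (i : 'I_p.*2.+1) : R := 'C(p.*2, i)%:R / 'C(p.*2, p)%:R / freq R p i.
have -> : (fun x => \sum_(K0 <= k < K) psi p ((k + s)%:R `^ ga) * F k x) =
  fun x => \sum_(i < p.*2.+1 | i != p :> nat) co i *
     \sum_(K0 <= k < K) sin (freq R p i * (k + s)%:R `^ ga) * F k x.
  apply: funext => x; rewrite [RHS](eq_bigr (fun i : 'I_p.*2.+1 =>
    \sum_(K0 <= k < K) co i * (sin (freq R p i * (k + s)%:R `^ ga) * F k x))); last first.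
    by move=> i _; rewrite mulr_sumr.
  rewrite exchange_big /=; apply: eq_bigr => k _.
  have -> : psi p ((k + s)%:R `^ ga) = \sum_(i < p.*2.+1 | i != p :> nat)
     'C(p.*2, i)%:R / 'C(p.*2, p)%:R * (sin (freq R p i * (k + s)%:R `^ ga) / freq R p i).
    by rewrite /psi /stair; ring.
  rewrite mulr_suml; apply: eq_bigr => i _; rewrite /co; ring.
apply: le_trans (ler_nrm_sum _ _) _; first by move=> i _; apply: bmZ.
apply: (@le_trans _ _ (\sum_(i < p.*2.+1 | i != p :> nat) 'C(p.*2, i)%:R / 'C(p.*2, p)%:R * B)).
  apply: ler_sum => i ip; rewrite nrmZ//.
  have b0 : 0 <= 'C(p.*2, i)%:R / 'C(p.*2, p)%:R :> R by rewrite divr_ge0.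
  rewrite /co normrM (ger0_norm b0) -[X in X <= _]mulrA; apply: ler_wpM2l => //.
  have pi2 := @pi_ge2 R.
  have ipn : (i <= p + p)%N by rewrite addnn -ltnS ltn_ord.
  have big : 1 <= `|freq R p i|.
    rewrite /freq normrM ger0_norm; last by lra.
    have h1 : 1 <= `|(p%:R - i%:R : R)|.
      have [lt|lt|e] := ltngtP i p; last by rewrite e eqxx in ip.
        rewrite -natrB ?(ltnW lt)// normr_nat ler1n subn_gt0//.
      by rewrite distrC -natrB ?(ltnW lt)// normr_nat ler1n subn_gt0.
    by rewrite -[X in X <= _]mul1r ler_pM//; lra.
  apply: (@le_trans _ _ (1 * B)); last by rewrite mul1r.
  apply: ler_pM; rewrite ?nrm_ge0//.
    by rewrite normfV invf_le1// (lt_le_trans ltr01).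
  have [lt|lt|e] := ltngtP i p; last by rewrite e eqxx in ip.
    have -> : freq R p i = 2 * pi * (p - i)%:R by rewrite /freq natrB// ltnW.
    by apply: hB; rewrite subn_gt0 lt leq_subr.
  have -> : (fun x => \sum_(K0 <= k < K) sin (freq R p i * (k + s)%:R `^ ga) * F k x) =
     fun x => - \sum_(K0 <= k < K) sin (2 * pi * (i - p)%:R * (k + s)%:R `^ ga) * F k x.
    apply: funext => x; rewrite -sumrN; apply: eq_bigr => k _.
    have -> : freq R p i = - (2 * pi * (i - p)%:R) by rewrite /freq natrB ?(ltnW lt)//; ring.
    by rewrite mulNr sinN mulNr.
  rewrite nrmN; first by apply: hB; rewrite subn_gt0 lt /=; rewrite leq_subLR.
  by apply: bS.
rewrite -mulr_suml mulrC ler_wpM2l//.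
have hc : 0 < 'C(p.*2, p)%:R :> R by rewrite ltr0n bin_gt0 -addnn leq_addl.
rewrite -mulr_suml /central invf_div ler_pM2r ?invr_gt0//.
exact: sum_bin_offcenter.
Qed.

(** The zero frequency contributes [central p] per term; the weights [C(2p, i) / 4^p] of the others
    sum to at most one. *)
Lemma cos_pow_sum_le p s K0 K (B : R) : (0 < p)%N -> (K0 <= K)%N -> 0 <= B ->
  (forall j, (0 < j <= p)%N ->
    `|\sum_(K0 <= k < K) cos (2 * pi * j%:R * (k + s)%:R `^ ga)| <= B) ->
  \sum_(K0 <= k < K) cos (pi * (k + s)%:R `^ ga) ^+ p.*2 <= K%:R * central R p + B.
Proof.
move=> p0 KK B0 hB.
under eq_bigr do rewrite pow_cos_pi.
rewrite big_split /= sumr_const_nat; apply: lerD.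
  rewrite -[X in X <= _]mulr_natl ler_wpM2r ?(ltW (central_gt0 _ _))// ler_nat leq_subr//.
rewrite exchange_big /=.
apply: (@le_trans _ _ (\sum_(i < p.*2.+1 | i != p :> nat) 'C(p.*2, i)%:R / 4 ^+ p * B)).
  apply: ler_sum => i ip; rewrite -mulr_sumr ler_wpM2l ?divr_ge0 ?exprn_ge0//.
  have ipn : (i <= p + p)%N by rewrite addnn -ltnS ltn_ord.
  have [lt|lt|e] := ltngtP i p; last by rewrite e eqxx in ip.
    have -> : freq R p i = 2 * pi * (p - i)%:R by rewrite /freq natrB// ltnW.
    by apply: le_trans (ler_norm _) _; apply: hB; rewrite subn_gt0 lt leq_subr.
  have -> : \sum_(K0 <= k < K) cos (freq R p i * (k + s)%:R `^ ga) =
     \sum_(K0 <= k < K) cos (2 * pi * (i - p)%:R * (k + s)%:R `^ ga).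
    apply: eq_bigr => k _.
    have -> : freq R p i = - (2 * pi * (i - p)%:R) by rewrite /freq natrB ?(ltnW lt)//; ring.
    by rewrite mulNr cosN.
  apply: le_trans (ler_norm _) _; apply: hB; rewrite subn_gt0 lt /=.
  by rewrite leq_subLR.
rewrite -mulr_suml ler_piMl// -mulr_suml ler_pdivrMr ?exprn_gt0// mul1r.
exact: sum_bin_offcenter.
Qed.

(** The four terms bound, in order: the head [k < K0] together with the mismatch of total weight;
    the oscillating part; the error of the trigonometric approximation; the linear part after Abel
    summation. *)
Lemma comparison_ineq (N K0 p : nat) (B W : R) :
  (0 < K0 <= fpow c N.+1)%N -> (0 < p)%N -> 0 <= B -> 0 <= W ->
  (forall j s, (0 < j <= p.*2)%N -> (s <= 1)%N ->
    nrm m (fun x => \sum_(K0 <= k < fpow c N.+1)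
      sin (2 * pi * j%:R * (k + s)%:R `^ ga) * F k x) <= B) ->
  (forall j s, (0 < j <= p)%N -> (s <= 1)%N ->
    `|\sum_(K0 <= k < fpow c N.+1) cos (2 * pi * j%:R * (k + s)%:R `^ ga)| <= B) ->
  (forall k, (K0 <= k <= fpow c N.+1)%N ->
    nrm m (fun x => \sum_(1 <= i < k) (F i x - h x)) <= W) ->
  nrm m (fun x => \sum_(1 <= n < N.+1) F (fpow c n) x - N%:R * h x) <=
    (K0%:R `^ ga + 1) * (1 + nrm m h) + 2 * (B / central R p.*2) +
    2 * ((fpow c N.+1)%:R * central R p + B) + 2 * (K0%:R `^ ga / K0%:R) * W.
Proof.
set K := fpow c N.+1 => /andP[K00 K0K] p0 B0 W0 hsin hcos hW.
have p20 : (0 < p.*2)%N by rewrite double_gt0.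
pose C k := ceilp c k.
pose err k := C k - stair p.*2 (k%:R `^ ga).
pose u1 x := \sum_(1 <= k < K0) (C k.+1 - C k) * F k x.
pose u2 s x := \sum_(K0 <= k < K) psi p.*2 ((k + s)%:R `^ ga) * F k x.
pose u3 x := \sum_(K0 <= k < K) (err k.+1 - err k) * F k x.
pose P k x := \sum_(1 <= i < k) (F i x - h x).
pose u4 x := \sum_(K0 <= k < K) d k * (P k.+1 x - P k x).
(* The weights [d k] sum to [K^ga - K0^ga] rather than to [N]; the discrepancy stays as a multiple
   of [h]. *)
pose al := K%:R `^ ga - K0%:R `^ ga - N%:R.
have bu1 : bm m u1 by apply: bm_sum => k _; exact: bmZ.
have bu2 s : bm m (u2 s) by apply: bm_sum => k _; exact: bmZ.
have bu3 : bm m u3 by apply: bm_sum => k _; exact: bmZ.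
have bP k : bm m (P k) by apply: bm_sum => i _; exact: bmB.
have bu4 : bm m u4 by apply: bm_sum => k _; apply: bmZ; exact: bmB.
have bu5 : bm m (fun x => al * h x) by exact: bmZ.
have -> : (fun x => \sum_(1 <= n < N.+1) F (fpow c n) x - N%:R * h x) =
   fun x => u1 x + (u2 1%N x - u2 0%N x) + u3 x + u4 x + al * h x.
  apply: funext => x; rewrite (sum_fpow c1 (fun k => F k x)) -/K.
  rewrite (@big_cat_nat _ _ _ K0)//= -/(u1 x) -/C.
  have -> : \sum_(K0 <= k < K) (C k.+1 - C k) * F k x =
     (u2 1%N x - u2 0%N x) + u3 x + \sum_(K0 <= k < K) d k * F k x.
    rewrite /u2 /u3 -sumrB -!big_split /=; apply: eq_bigr => k _.
    by rewrite /err /psi /d addn0 addn1; ring.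
  have -> : u4 x = \sum_(K0 <= k < K) d k * F k x - (K%:R `^ ga - K0%:R `^ ga) * h x.
    rewrite -(telescope_sumr (fun k : nat => k%:R `^ ga) K0K) mulr_suml -sumrB.
    apply: eq_big_nat => k /andP[Kk _].
    have Pk : P k.+1 x - P k x = F k x - h x.
      by rewrite /P big_nat_recr ?(leq_trans K00)//= addrAC subrr add0r.
    by rewrite Pk mulrBr.
  by rewrite /al; ring.
have C0 k : 0 <= C k.+1 - C k by rewrite subr_ge0 le_ceilp.
have K0g : 0 <= K0%:R `^ ga :> R by exact: powR_ge0.
have n1 : nrm m u1 <= K0%:R `^ ga + 1.
  apply: le_trans (ler_nrm_sum _ _) _; first by move=> k _; exact: bmZ.
  apply: (@le_trans _ _ (\sum_(1 <= k < K0) (C k.+1 - C k))).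
    apply: ler_sum => k _; rewrite nrmZ// ger0_norm// ler_piMr//.
    exact: nrm_le_bound.
  rewrite (telescope_sumr C)//.
  have h1 := @ceilp_lt R c K0.
  have h2 : 0 <= C 1%N by rewrite /C /ceilp ler0z ceil_ge0 (lt_le_trans _ (powR_ge0 _ _))// ltrN10.
  rewrite -/ga in h1; rewrite /C in h2 *; lra.
have n2 : nrm m (fun x => u2 1%N x - u2 0%N x) <= 2 * (B / central R p.*2).
  apply: le_trans (ler_nrmB (bu2 _) (bu2 _)) _.
  have q1 : nrm m (u2 1%N) <= B / central R p.*2.
    by apply: psi_sum_nrm_le => // j hj; exact: hsin.
  have q0 : nrm m (u2 0%N) <= B / central R p.*2.
    by apply: psi_sum_nrm_le => // j hj; exact: hsin.
  lra.
have n3 : nrm m u3 <= 2 * (K%:R * central R p + B).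
  have e1 := @cos_pow_sum_le p 1 K0 K B p0 K0K B0 (fun j hj => hcos j 1%N hj isT).
  have e0 := @cos_pow_sum_le p 0 K0 K B p0 K0K B0 (fun j hj => hcos j 0%N hj isT).
  apply: nrm_le_bound => // x; apply: le_trans (ler_norm_sum _ _ _) _.
  apply: (@le_trans _ _ (\sum_(K0 <= k < K) cos (pi * (k + 1)%:R `^ ga) ^+ p.*2 +
     \sum_(K0 <= k < K) cos (pi * (k + 0)%:R `^ ga) ^+ p.*2)); last by lra.
  rewrite -big_split /= big_nat_cond [leRHS]big_nat_cond; apply: ler_sum => k.
  rewrite andbT => /andP[Kk _]; have k0 := leq_trans K00 Kk.
  rewrite normrM -[leRHS]mulr1 ler_pM//.
  apply: le_trans (ler_normB _ _) _; rewrite addn1 addn0; apply: lerD; exact: ceilp_stair.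
have n4 : nrm m u4 <= 2 * (K0%:R `^ ga / K0%:R) * W.
  apply: le_trans (abel_nrm_le _ W0 bP hW) _; first by rewrite K00.
  by rewrite ler_wpM2r// ler_pM2l// delta_le.
have n5 : nrm m (fun x => al * h x) <= (K0%:R `^ ga + 1) * nrm m h.
  rewrite nrmZ// ler_wpM2r ?nrm_ge0//.
  have /andP[h1 h2] := root_fpowS c1 N; rewrite -/K -/ga in h1 h2.
  rewrite /al ler_norml; apply/andP; split; lra.
have b12 := bmD bu1 (bmB (bu2 1%N) (bu2 0%N)).
have b123 := bmD b12 bu3; have b1234 := bmD b123 bu4.
apply: le_trans (ler_nrmD b1234 bu5) _.
have q1 := ler_nrmD b123 bu4; have q2 := ler_nrmD b12 bu3.
have q3 := ler_nrmD bu1 (bmB (bu2 1%N) (bu2 0%N)).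
lra.
Qed.

End Comparison.

(** * Size of the losses *)

Section Asymptotics.
Variable R : realType.

Lemma powR_nat_unbounded (A t : R) : 0 < t -> exists M, forall N, (M <= N)%N -> A <= N%:R `^ t.
Proof.
move=> t0; exists (Num.truncn (`|A| `^ t^-1)).+1 => N MN.
have h : `|A| `^ t^-1 <= N%:R.
  by apply: le_trans (ltW (truncnS_gt _)) _; rewrite ler_nat.
apply: le_trans (ler_norm A) _.
have -> : `|A| = (`|A| `^ t^-1) `^ t by rewrite -powRrM mulVf ?gt_eqF// powRr1.
by apply: ge0_ler_powR; rewrite ?nnegrE ?powR_ge0// ltW.
Qed.

Variable c : R.
Hypothesis c1 : 1 < c.

Lemma fpow_superlinear (A : R) : exists M, forall N, (M <= N)%N ->
  A * (N%:R + 1) <= (fpow c N.+1)%:R.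
Proof.
have [M hM] := @powR_nat_unbounded (2 * `|A|) (c - 1) ltac:(by rewrite subr_gt0).
exists M.+1 => N MN; apply: le_trans (fpowS_ge c1 N).
rewrite -mulr_powRB1 ?ler0n// ?(lt_trans ltr01 c1)//.
have N1 : 1 <= N%:R :> R by rewrite ler1n (leq_trans _ MN).
have hN := hM N (ltnW MN).
apply: (@le_trans _ _ (N%:R * (2 * `|A|))); last by rewrite ler_wpM2l.
apply: (@le_trans _ _ (`|A| * (N%:R + 1))); first by rewrite ler_wpM2r ?ler_norm// addr_ge0.
have := normr_ge0 A; nra.
Qed.

Lemma fpow_pow_small (e : R) : c < 23%:R / 22%:R -> 0 < e ->
  exists M, forall N, (M <= N)%N -> (fpow c N.+1)%:R ^+ 22 <= e * N%:R ^+ 23.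
Proof.
move=> c2 e0; have t0 : 0 < 23 - 22 * c :> R by move: c2; rewrite ltr_pdivlMr//; lra.
have [M hM] := @powR_nat_unbounded (2 `^ (22 * c) / e) _ t0.
exists M.+1 => N MN.
have N1 : 1 <= N%:R :> R by rewrite ler1n (leq_trans _ MN).
have N0 : 0 < N%:R :> R by exact: lt_le_trans N1.
have hN := hM N (ltnW MN).
have /andP[h1 _] := fpow_itv c N.+1.
apply: (@le_trans _ _ ((2 * N%:R) `^ c ^+ 22)).
  rewrite lerXn2r ?nnegrE ?powR_ge0//; apply: le_trans h1 _.
  apply: ge0_ler_powR; rewrite ?nnegrE ?mulr_ge0//; first by rewrite ltW// (lt_trans ltr01).
  by rewrite -natr1; lra.
rewrite -[X in X <= _]powR_mulrn ?powR_ge0// -powRrM (mulrC c) powRM//.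
rewrite -[X in _ <= _ * X]powR_mulrn// (_ : 23%:R = 22 * c + (23 - 22 * c)); last by ring.
rewrite powRD; last by rewrite (gt_eqF N0) implybT.
rewrite ler_pdivrMr// in hN.
rewrite [X in X <= _]mulrC [X in _ <= X]mulrCA ler_wpM2l ?powR_ge0//.
by rewrite [X in _ <= X]mulrC.
Qed.

(** With [V = sqrt (K^3 sqrt N)], the first two terms are at most [V] and [4V], and for this [lam]
    the third equals [32 V / sqrt sg]. *)
Lemma energy_le (sg N K : R) : 0 < sg -> 1 <= N -> N <= K ->
  energy N (sg * N / (8 * K ^+ 3)) <= (5 + 32 / Num.sqrt sg) * Num.sqrt (K ^+ 3 * Num.sqrt N).
Proof.
move=> sg0 N1 NK; rewrite /energy.
have N0 : 0 < N by exact: lt_le_trans N1.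
have K1 : 1 <= K by exact: le_trans NK.
have K0 : 0 < K by exact: lt_le_trans K1.
have s1 : 1 <= Num.sqrt N by rewrite -[X in X <= _]sqrtr1 ler_wsqrtr.
have K3 : 0 < K ^+ 3 by exact: exprn_gt0.
set V := Num.sqrt (K ^+ 3 * Num.sqrt N).
have V0 : 0 <= V by exact: sqrtr_ge0.
have NN3 : N ^+ 3 <= K ^+ 3 by rewrite lerXn2r ?nnegrE ?(ltW N0) ?(ltW K0).
have K3s : K ^+ 3 <= K ^+ 3 * Num.sqrt N by rewrite ler_peMr// ltW.
have N2 : N ^+ 2 <= N ^+ 3 by rewrite [X in _ <= X]exprS ler_peMl// exprn_ge0// ltW.
have a1 : N <= V.
  rewrite -[X in X <= _](ger0_norm (ltW N0)) -sqrtr_sqr ler_wsqrtr//.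
  exact: le_trans (le_trans N2 NN3) K3s.
have a2 : N * Num.sqrt (3 * N) <= 2 * V.
  have -> : N * Num.sqrt (3 * N) = Num.sqrt (3 * N ^+ 3).
    rewrite -[X in X * _](ger0_norm (ltW N0)) -sqrtr_sqr -sqrtrM ?sqr_ge0//.
    by congr Num.sqrt; ring.
  have -> : 2 * V = Num.sqrt (4 * (K ^+ 3 * Num.sqrt N)).
    rewrite sqrtrM// (_ : (4 : R) = 2 ^+ 2); last by ring.
    by rewrite sqrtr_sqr ger0_norm.
  rewrite ler_wsqrtr//.
  have := le_trans NN3 K3s; have := exprn_ge0 3 (ltW N0); lra.
have a3 : Num.sqrt (8 * Num.sqrt N / (sg * N / (8 * K ^+ 3))) * Num.sqrt N = 8 * V / Num.sqrt sg.
  rewrite -sqrtrM; last first.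
    by rewrite divr_ge0 ?mulr_ge0 ?sqrtr_ge0 ?invr_ge0 ?(ltW sg0) ?(ltW N0)// mulr_ge0// ltW.
  have -> : 8 * Num.sqrt N / (sg * N / (8 * K ^+ 3)) * N = 8 ^+ 2 * (K ^+ 3 * Num.sqrt N) / sg.
    by field; rewrite !gt_eqF.
  rewrite sqrtrM; last by rewrite !mulr_ge0 ?exprn_ge0 ?sqrtr_ge0// ltW.
  by rewrite sqrtrM ?sqr_ge0// sqrtr_sqr ger0_norm// sqrtrV// ltW.
have -> : Num.sqrt (8 * Num.sqrt N / (sg * N / (8 * K ^+ 3))) * (2 * Num.sqrt N) = 2 * (8 * V / Num.sqrt sg).
  by rewrite mulrCA a3.
have -> : (5 + 32 / Num.sqrt sg) * V = 5 * V + 4 * (8 * V / Num.sqrt sg).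
  by field; rewrite gt_eqF// sqrtr_gt0.
lra.
Qed.

Lemma loss_small (sg z : R) : c < 23%:R / 22%:R -> 0 < sg -> 0 < z ->
  exists M, forall N, (M <= N)%N -> forall K : R, K = (fpow c N.+1)%:R ->
   (K / N%:R) ^+ 2 * Num.sqrt (energy N%:R (sg * N%:R / (8 * K ^+ 3))) <= z * N%:R.
Proof.
move=> c2 sg0 z0; pose C := 5 + 32 / Num.sqrt sg.
have C0 : 0 < C by rewrite /C addr_gt0// divr_gt0// sqrtr_gt0.
(* After squaring, it suffices that [K^4 V <= (z^2 / C) N^6]. As [V^4 = K^6 N], the fourth power of
   this is [K^22 <= (z^2 / C)^4 N^23]. *)
have [M hM] := fpow_pow_small c2 (exprn_gt0 4 (divr_gt0 (exprn_gt0 2 z0) C0)).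
exists M.+1 => N MN K KE.
have N1 : 1 <= N%:R :> R by rewrite ler1n (leq_trans _ MN).
have N0 : 0 < N%:R :> R by exact: lt_le_trans N1.
have NK : N%:R <= K by rewrite KE ler_nat fpowS_ge_id.
have K0 : 0 < K by exact: lt_le_trans NK.
have hN := hM N (ltnW MN); rewrite -KE in hN.
have := energy_le sg0 N1 NK; set E := energy _ _ => hE; rewrite -/C in hE.
set V := Num.sqrt (K ^+ 3 * Num.sqrt N%:R) in hE.
have V0 : 0 <= V by exact: sqrtr_ge0.
have V4 : V ^+ 4 = K ^+ 6 * N%:R.
  rewrite (_ : 4 = 2 * 2)%N// exprM sqr_sqrtr ?mulr_ge0 ?exprn_ge0 ?sqrtr_ge0 ?(ltW K0)//.
  by rewrite exprMn sqr_sqrtr// -exprM.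
have [E0|E0] := leP E 0.
  by rewrite (ler0_sqrtr E0) mulr0 mulr_ge0// ltW.
rewrite -(@ler_sqr R) ?nnegrE ?mulr_ge0 ?sqrtr_ge0 ?exprn_ge0 ?invr_ge0 ?(ltW K0) ?(ltW N0) ?(ltW z0)//.
rewrite exprMn sqr_sqrtr ?(ltW E0)// -exprM.
apply: (@le_trans _ _ ((K / N%:R) ^+ (2 * 2) * (C * V))).
  by rewrite ler_wpM2l// exprn_ge0// divr_ge0// ltW.
have key : K ^+ 4 * V <= z ^+ 2 / C * N%:R ^+ 6.
  rewrite -(@ler_pXn2r _ 4)// ?nnegrE ?mulr_ge0 ?exprn_ge0 ?invr_ge0 ?(ltW K0) ?(ltW z0) ?(ltW C0)//.
  rewrite exprMn V4 [leRHS]exprMn -!exprM.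
  have -> : K ^+ (4 * 4) * (K ^+ 6 * N%:R) = K ^+ 22 * N%:R by rewrite mulrA -exprD.
  have -> : (z ^+ 2 / C) ^+ 4 * N%:R ^+ (6 * 4) = (z ^+ 2 / C) ^+ 4 * N%:R ^+ 23 * N%:R.
    by rewrite -mulrA -exprSr.
  by rewrite ler_pM2r.
have -> : (K / N%:R) ^+ (2 * 2) * (C * V) = C * (K ^+ 4 * V) / N%:R ^+ 4.
  by rewrite expr_div_n; field; rewrite gt_eqF.
rewrite ler_pdivrMr ?exprn_gt0//.
apply: (@le_trans _ _ (C * (z ^+ 2 / C * N%:R ^+ 6))); first by rewrite ler_pM2l.
by rewrite le_eqVlt; apply/orP; left; apply/eqP; field; rewrite gt_eqF.
Qed.

End Asymptotics.

(** * Choice of the parameters *)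

Section FractionalPowers.
Variables (R : realType) (X : Type) (m : mean R X) (T S : X -> X).
Hypotheses (m1 : ex m (fun=> 1) = 1) (pT : preserves m T) (pS : preserves m S).
Hypothesis TS : forall x, T (S x) = S (T x).
Variables f g : X -> R.
Hypotheses (bf : bm m f) (bg : bm m g).
Hypotheses (f1 : forall x, `|f x| <= 1) (g1 : forall x, `|g x| <= 1).
Variables (c : R) (c1 : 1 < c) (c2 : c < 23%:R / 22%:R).
Let ga : R := c^-1.
Local Notation F := (prodTS T S f g).

Let gam0 : 0 < ga. Proof. exact: ga_gt0. Qed.
Let gam1 : ga < 1. Proof. exact: ga_lt1. Qed.

Lemma third_le2 : third ga <= 2.
Proof.
have g0 := gam0; have g1' := gam1; rewrite /third -[leRHS]mul1r.
by apply: ler_pM; rewrite ?mulr_ge0 ?subr_ge0 ?(ltW g0) ?(ltW g1')//; nra.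
Qed.

Lemma powR_ga3 (x : R) : 0 < x -> x `^ (ga - 3) = x `^ ga / x ^+ 3.
Proof.
move=> x0; rewrite powRB; last by rewrite (gt_eqF x0) implybT.
by rewrite powR_mulrn// ltW.
Qed.

(** Frequencies as large as [2 (q rho)^2], with [rho] about [K/N], are allowed: [K] outgrows every
    multiple of [N], and the lower bound for [K] then keeps the phase increments below [pi]. *)
Lemma exp_sums_le (q N rho K0 j s : nat) :
  let K := fpow c N.+1 in
  let lam := third ga * N%:R / (8 * K%:R ^+ 3) in
  let B := (K %/ N).+1%:R * Num.sqrt (energy N%:R lam) in
  (0 < N)%N -> (0 < q)%N -> (rho * N <= 2 * K)%N -> (0 < K0 <= K)%N -> (K <= q * K0)%N ->
  32 * q%:R ^+ 5 * (N%:R + 1) <= K%:R :> R ->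
  (0 < j <= ((q * rho) ^ 2).*2)%N -> (s <= 1)%N ->
  nrm m (fun x => \sum_(K0 <= k < K) sin (2 * pi * j%:R * (k + s)%:R `^ ga) * F k x) <= B /\
  `|\sum_(K0 <= k < K) cos (2 * pi * j%:R * (k + s)%:R `^ ga)| <= B.
Proof.
move=> K lam B N0 q0 hrho /andP[K00 K0K] qK big /andP[j0 jp] s1.
have pi0 := @pi_gt0 R; have th0 := third_gt0 gam0 gam1; have th2 := third_le2.
have K0n : (0 < K)%N by exact: leq_trans K0K.
have KR : 0 < K%:R :> R by rewrite ltr0n.
have NR : 0 < N%:R :> R by rewrite ltr0n.
have jR : 1 <= j%:R :> R by rewrite ler1n.
have /andP[Kg1 Kg2] := root_fpowS c1 N; rewrite -/K -/ga in Kg1 Kg2.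
have lam0 : 0 < lam by rewrite /lam divr_gt0// mulr_gt0// exprn_gt0.
(* The 8 in [lam] is [2^3], from [K + s <= 2K]. *)
have hlo : lam <= 2 * pi * j%:R * third ga * (K + s)%:R `^ (ga - 3).
  have Ks : (K + s)%:R <= 2 * K%:R :> R.
    by rewrite -natrM ler_nat; move: s1 K0n; clear; lia.
  have Ks0 : 0 < (K + s)%:R :> R by rewrite ltr0n addn_gt0 K0n.
  rewrite powR_ga3//.
  have e1 : N%:R <= (K + s)%:R `^ ga :> R.
    apply: le_trans Kg1 _; apply: ge0_ler_powR; rewrite ?nnegrE ?ler_nat ?leq_addr//.
    exact: ltW gam0.
  have e2 : (8 * K%:R ^+ 3)^-1 <= ((K + s)%:R ^+ 3)^-1 :> R.
    rewrite lef_pV2 ?posrE ?mulr_gt0 ?exprn_gt0//.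
    have -> : 8 * K%:R ^+ 3 = (2 * K%:R) ^+ 3 :> R by ring.
    by rewrite lerXn2r ?nnegrE ?mulr_ge0.
  have e3 : N%:R / (8 * K%:R ^+ 3) <= (K + s)%:R `^ ga / (K + s)%:R ^+ 3 :> R.
    by apply: ler_pM => //; rewrite invr_ge0 mulr_ge0// exprn_ge0.
  have e4 : 0 <= (K + s)%:R `^ ga / (K + s)%:R ^+ 3 :> R by rewrite divr_ge0 ?powR_ge0 ?exprn_ge0.
  rewrite /lam -mulrA.
  apply: (@le_trans _ _ (third ga * ((K + s)%:R `^ ga / (K + s)%:R ^+ 3))).
    by rewrite ler_pM2l.
  rewrite -mulrA ler_peMl//; first by rewrite mulr_ge0// ltW.
  have pi2 := @pi_ge2 R; nra.
(* The left side is at most [pi * 2 third * (8 q^5 (N + 1) / K)]; by [big] the fraction is at most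
   1/4, and [third <= 2]. *)
have hup : 2 * pi * j%:R * third ga * N%:R ^+ 2 * K0%:R `^ (ga - 3) <= pi.
  have K00R : 0 < K0%:R :> R by rewrite ltr0n.
  have qR : 0 < q%:R :> R by rewrite ltr0n.
  rewrite powR_ga3//.
  have e1 : K0%:R `^ ga <= N%:R + 1 :> R.
    apply: le_trans Kg2; apply: ge0_ler_powR; rewrite ?nnegrE ?ler_nat//.
    exact: ltW gam0.
  have e2 : K%:R ^+ 3 <= q%:R ^+ 3 * K0%:R ^+ 3 :> R.
    by rewrite -exprMn lerXn2r ?nnegrE ?mulr_ge0// -natrM ler_nat.
  have e3 : (j * N ^ 2)%:R <= 8 * q%:R ^+ 2 * K%:R ^+ 2 :> R.
    rewrite -!natrX -!natrM ler_nat.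
    apply: (@leq_trans ((2 * (q * rho) ^ 2) * N ^ 2)); first by rewrite leq_mul2r mul2n jp orbT.
    rewrite (_ : 2 * (q * rho) ^ 2 * N ^ 2 = 2 * q ^ 2 * (rho * N) ^ 2)%N; last by rewrite !expnMn; ring.
    apply: (@leq_trans (2 * q ^ 2 * (2 * K) ^ 2)); first by rewrite leq_mul2l leq_exp2r ?hrho ?orbT.
    by rewrite expnMn; apply: eq_leq; ring.
  have e4 : K0%:R `^ ga / K0%:R ^+ 3 <= (N%:R + 1) * q%:R ^+ 3 / K%:R ^+ 3 :> R.
    rewrite ler_pdivrMr ?exprn_gt0// mulrAC ler_pdivlMr ?exprn_gt0//.
    by rewrite -[leRHS]mulrA; apply: ler_pM; rewrite ?powR_ge0 ?exprn_ge0.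
  have -> : 2 * pi * j%:R * third ga * N%:R ^+ 2 * (K0%:R `^ ga / K0%:R ^+ 3) =
     pi * (2 * third ga * ((j * N ^ 2)%:R * (K0%:R `^ ga / K0%:R ^+ 3))).
    by rewrite natrM natrX; ring.
  rewrite -[leRHS]mulr1 ler_pM2l//.
  have e5 : (j * N ^ 2)%:R * (K0%:R `^ ga / K0%:R ^+ 3) <=
     (8 * q%:R ^+ 2 * K%:R ^+ 2) * ((N%:R + 1) * q%:R ^+ 3 / K%:R ^+ 3) :> R.
    by apply: ler_pM; rewrite ?divr_ge0 ?powR_ge0 ?exprn_ge0.
  have e6 : (8 * q%:R ^+ 2 * K%:R ^+ 2) * ((N%:R + 1) * q%:R ^+ 3 / K%:R ^+ 3) =
     8 * q%:R ^+ 5 * (N%:R + 1) / K%:R :> R by field; rewrite gt_eqF.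
  rewrite e6 in e5.
  have e7 : 8 * q%:R ^+ 5 * (N%:R + 1) / K%:R <= 4^-1 :> R by rewrite ler_pdivrMr//; lra.
  have e8 := le_trans e5 e7.
  apply: (@le_trans _ _ (2 * third ga * 4^-1)); last by lra.
  by apply: ler_wpM2l => //; apply: mulr_ge0 => //; exact: ltW.
have KK : (0 < K0 <= K)%N by rewrite K00.
have one1 (x : X) : `|(1 : R)| <= 1 by rewrite normr1.
have [_ hsin] := @exp_sum_range R X m T S m1 pT pS TS f g bf bg f1 g1 ga gam0 gam1 j s K0 K N lam j0 KK N0 lam0 hlo hup.
(* The scalar sum is the case [f = g = 1]. *)
have [hcos _] := @exp_sum_range R X m T S m1 pT pS TS (fun=> 1) (fun=> 1) (bm_cst m 1) (bm_cst m 1) one1 one1 ga gam0 gam1 j s K0 K N lam j0 KK N0 lam0 hlo hup.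
split=> //; apply: le_trans hcos.
rewrite -[leLHS](nrm_cst (\sum_(K0 <= k < K) cos (2 * pi * j%:R * (k + s)%:R `^ ga)) m1).
rewrite le_eqVlt; apply/orP; left; apply/eqP; congr (nrm _ _); apply: funext => x.
by apply: eq_bigr => k _; rewrite /prodTS !mulr1.
Qed.

Variable h : X -> R.
Hypothesis bh : bm m h.
Hypothesis cesaro : forall e : R, 0 < e -> exists M, forall N, (M <= N)%N ->
  nrm m (fun x => avg (fun n => n) T S f g N x - h x) <= e.

Lemma nrm_partial_sum (k : nat) (e : R) : 0 <= e ->
  nrm m (fun x => avg (fun n => n) T S f g k x - h x) <= e ->
  nrm m (fun x => \sum_(1 <= i < k.+1) (F i x - h x)) <= k%:R * e.
Proof.
move=> e0 hk; have [->|k0] := posnP k.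
  by under eq_fun do rewrite big_geq//; rewrite nrm0 mul0r.
have kR : 0 < k%:R :> R by rewrite ltr0n.
have -> : (fun x => \sum_(1 <= i < k.+1) (F i x - h x)) =
   fun x => k%:R * (avg (fun n => n) T S f g k x - h x).
  apply: funext => x; rewrite sumrB sumr_const_nat subn1 /= mulrBr -[h x *+ k]mulr_natl; congr (_ - _).
  by rewrite /avg mulrA divff ?gt_eqF// mul1r.
rewrite nrmZ; last by apply: bmB => //; exact: (bm_avg pT pS).
by rewrite ger0_norm ?ler_pM2l// ltW.
Qed.

Ltac keep_section := clear - m m1 pT pS TS bf bg f1 g1 c1 c2 gam0 gam1 bh cesaro.

Theorem fractional_cesaro (e : R) : 0 < e -> exists M, forall N, (M <= N)%N ->
  nrm m (fun x => avg (fpow c) T S f g N x - h x) <= e.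
Proof.
move=> e0; set H := 1 + nrm m h.
have H1 : 1 <= H by rewrite lerDl nrm_ge0.
pose r := (Num.truncn (12 * H / e)).+2.
have rR : 12 * H / e <= r%:R by apply: le_trans (ltW (truncnS_gt _)) _; rewrite ler_nat /r.
have r1 : 1 <= r%:R :> R by rewrite ler1n.
have r0 : 0 < r%:R :> R by exact: lt_le_trans r1.
have rH : 12 * H <= e * r%:R by move: rR; rewrite ler_pdivrMr// [X in _ <= X]mulrC.
(* [K0] is about [K / q]. The square compensates for the exponent [ga >= 1/2], so that the head has
   weight about [N / r]. *)
pose q := (2 * r ^ 2)%N.
have q0 : (0 < q)%N by rewrite /q muln_gt0 expn_gt0.
have qR : q%:R = 2 * r%:R ^+ 2 :> R by rewrite /q natrM natrX.
have q1 : 2 <= q%:R :> R by rewrite qR; nra.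
have qp : 0 < q%:R :> R by lra.
(* [om] and [z] carry [1/q]: the Abel part is multiplied by [K / K0 <= q], the oscillating part by
   [1 / central (2p) <= 3 q rho]. *)
pose om := e / (24 * q%:R).
have om0 : 0 < om by rewrite divr_gt0// mulr_gt0.
pose z := e / 12 / (12 * q%:R).
have z0 : 0 < z by rewrite divr_gt0 ?mulr_gt0// divr_gt0.
have th0 := third_gt0 gam0 gam1.
have [M1 hM1] := cesaro om0.
have [M2 hM2] := loss_small c1 c2 th0 z0.
have [M3 hM3] := fpow_superlinear c1 (32 * q%:R ^+ 5).
pose M4 := (Num.truncn (6 * H / e)).+1.
exists (maxn (maxn M1 M2) (maxn (maxn M3 M4) (q * M1.+1))) => N.
rewrite !geq_max => /andP[/andP[N1 N2] /andP[/andP[N3 N4] N5]].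
have N0 : (0 < N)%N by exact: leq_trans N4.
have NR : 0 < N%:R :> R by rewrite ltr0n.
have NR1 : 1 <= N%:R :> R by rewrite ler1n.
set K := fpow c N.+1.
have NK : (N <= K)%N by exact: fpowS_ge_id.
have K0n : (0 < K)%N by exact: leq_trans NK.
have KR : 0 < K%:R :> R by rewrite ltr0n.
have NKR : N%:R <= K%:R :> R by rewrite ler_nat.
have qK : (q * M1.+1 <= K)%N by exact: leq_trans NK.
have qK' : (q <= K)%N by apply: leq_trans qK; rewrite leq_pmulr.
pose K0 := (K %/ q).+1.
have MK0 : (M1 < K0)%N by rewrite ltnS leq_divRL// mulnC (leq_trans _ qK)// leq_mul2l ltnW ?orbT.
have K0K : (K0 <= K)%N.
  by apply: ltn_Pdiv => //; rewrite -(ltr_nat R); lra.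
have KqK0 : (K <= q * K0)%N by rewrite mulnC ltnW// ltn_ceil.
have K0up : K0%:R <= K%:R / r%:R ^+ 2 :> R.
  rewrite ler_pdivlMr ?exprn_gt0//.
  have h1 : (K0 * q)%:R <= (2 * K)%:R :> R.
    by rewrite ler_nat mul2n -addnn (mulSn (K %/ q)) leq_add// leq_trunc_div.
  by move: h1; rewrite natrM qR natrM; lra.
pose rho := (K %/ N).+1.
have rhoN : (rho * N <= 2 * K)%N.
  by rewrite mul2n -addnn (mulSn (K %/ N)) leq_add// leq_trunc_div.
have Krho : (K <= rho * N)%N by rewrite ltnW// ltn_ceil.
have big : 32 * q%:R ^+ 5 * (N%:R + 1) <= K%:R :> R by exact: hM3.
pose lam : R := third ga * N%:R / (8 * K%:R ^+ 3).
pose B := rho%:R * Num.sqrt (energy N%:R lam).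
have B0 : 0 <= B by rewrite mulr_ge0 ?sqrtr_ge0.
(* The balanced degree: [central p <= 1 / (q rho)] makes the mean error [K central p] at most
   [N / q], while [1 / central (2p)] stays of order [q rho]. *)
pose p := ((q * rho) ^ 2)%N.
have p0 : (0 < p)%N by rewrite expn_gt0 muln_gt0 q0.
have K0pos : (0 < K0 <= K)%N by rewrite K0K.
have sums j s (hj : (0 < j <= p.*2)%N) (hs : (s <= 1)%N) :=
  @exp_sums_le q N rho K0 j s N0 q0 rhoN K0pos KqK0 big hj hs.
pose W := om * K%:R.
have W0 : 0 <= W by rewrite mulr_ge0// ltW.
have hW k : (K0 <= k <= K)%N -> nrm m (fun x => \sum_(1 <= i < k) (F i x - h x)) <= W.
  move=> /andP[Kk kK]; have k0 : (0 < k)%N by exact: leq_trans Kk.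
  rewrite -(prednK k0); apply: le_trans (nrm_partial_sum (ltW om0) _) _.
    by apply: hM1; rewrite -ltnS prednK// (leq_trans MK0).
  by rewrite /W mulrC ler_wpM2l ?(ltW om0)// ler_nat (leq_trans (leq_pred _)).
have bF k : bm m (F k) by exact: (bm_prodTS pT pS).
have F1 k x : `|F k x| <= 1 by exact: prodTS_le1.
have hcos j s : (0 < j <= p)%N -> (s <= 1)%N ->
    `|\sum_(K0 <= k < K) cos (2 * pi * j%:R * (k + s)%:R `^ ga)| <= B.
  move=> /andP[j0 jp] hs; apply: (sums j s _ hs).2; rewrite j0 /= -addnn.
  by apply: leq_trans jp _; rewrite leq_addr.
have main := @comparison_ineq R X m m1 c c1 F h bF F1 bh N K0 p B W K0pos p0 B0 W0
  (fun j s hj hs => (sums j s hj hs).1) hcos hW.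
have loss := hM2 N N2 K%:R erefl; rewrite -/lam in loss.
set E := Num.sqrt (energy N%:R lam) in B B0 loss hcos main *.
have E0 : 0 <= E by exact: sqrtr_ge0.
have rhoR : rho%:R * N%:R <= 2 * K%:R :> R by rewrite -!natrM ler_nat.
have KrhoR : K%:R <= rho%:R * N%:R :> R by rewrite -!natrM ler_nat.
have rho2 : rho%:R <= 2 * (K%:R / N%:R) :> R by rewrite mulrA ler_pdivlMr.
have KN1 : 1 <= K%:R / N%:R :> R by rewrite ler_pdivlMr// mul1r.
have BKN : B * (K%:R / N%:R) <= 2 * (z * N%:R).
  apply: (@le_trans _ _ (2 * ((K%:R / N%:R) ^+ 2 * E))); last by rewrite ler_pM2l.
  have -> : 2 * ((K%:R / N%:R) ^+ 2 * E) = 2 * (K%:R / N%:R) * E * (K%:R / N%:R) by ring.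
  by rewrite ler_wpM2r ?divr_ge0// /B ler_wpM2r.
have B2 : B <= 2 * (z * N%:R) by apply: le_trans BKN; rewrite ler_peMr.
have qrho : 0 < q%:R * rho%:R :> R by rewrite mulr_gt0.
have pR : p%:R = (q%:R * rho%:R) ^+ 2 :> R by rewrite /p natrX natrM.
have cen1 : central R p * (q%:R * rho%:R) <= 1.
  rewrite -(@expr_le1 _ 2)// ?mulr_ge0 ?(ltW (central_gt0 _ _))// exprMn -pR.
  apply: le_trans (central_upper R p); rewrite ler_wpM2l ?sqr_ge0//.
  by move: (ler0n R p); keep_section; lra.
have cenK : K%:R * central R p <= N%:R / q%:R.
  rewrite ler_pdivlMr//; apply: (@le_trans _ _ (central R p * (q%:R * rho%:R) * N%:R)); last by rewrite ler_piMl// ltW.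
  have -> : central R p * (q%:R * rho%:R) * N%:R = rho%:R * N%:R * central R p * q%:R by ring.
  by rewrite ler_pM2r// ler_pM2r// central_gt0.
have cen2 : (central R p.*2)^-1 <= 3 * (q%:R * rho%:R).
  have c0 := central_gt0 R p.*2.
  rewrite -[leLHS]mul1r ler_pdivrMr//.
  rewrite -(@ler_sqr R) ?nnegrE ?mulr_ge0 ?(ltW c0) ?(ltW qrho)// expr1n exprMn exprMn -pR.
  have := @central_lower R p.*2; rewrite double_gt0 => /(_ p0).
  rewrite -[in X in _ * (4 * X)]muln2 natrM.
  by move: (sqr_ge0 (central R p.*2)) (ler0n R p); keep_section; nra.
have t2 : B / central R p.*2 <= 12 * q%:R * (z * N%:R).
  apply: (@le_trans _ _ (B * (3 * (q%:R * rho%:R)))); first by rewrite ler_wpM2l.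
  apply: (@le_trans _ _ (B * (3 * (q%:R * (2 * (K%:R / N%:R)))))).
    by rewrite ler_wpM2l// ler_pM2l// ler_pM2l.
  have -> : B * (3 * (q%:R * (2 * (K%:R / N%:R)))) = 6 * q%:R * (B * (K%:R / N%:R)) by ring.
  have -> : 12 * q%:R * (z * N%:R) = 6 * q%:R * (2 * (z * N%:R)) by ring.
  by rewrite ler_pM2l// mulr_gt0.
have /andP[_ Kg] := root_fpowS c1 N; rewrite -/K -/ga in Kg.
have K0R : 0 < K0%:R :> R by rewrite ltr0n.
have K0g : K0%:R `^ ga <= (N%:R + 1) / r%:R :> R.
  apply: (@le_trans _ _ ((K%:R / r%:R ^+ 2) `^ ga)).
    by apply: ge0_ler_powR; rewrite ?nnegrE ?divr_ge0 ?exprn_ge0// ltW// gam0.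
  rewrite powRM ?invr_ge0 ?exprn_ge0//; apply: ler_pM; rewrite ?powR_ge0//.
  (* The base is at most one and [ga >= 1/2], because [c < 2]. *)
  have -> : r%:R^-1 = (r%:R ^+ 2)^-1 `^ 2^-1 :> R.
    by rewrite powR12_sqrt ?invr_ge0 ?exprn_ge0// sqrtrV ?exprn_ge0// sqrtr_sqr ger0_norm.
  apply: ger_powR; first by rewrite invr_gt0 exprn_gt0//= invf_le1 ?exprn_gt0// expr_ge1.
  rewrite /ga lef_pV2 ?posrE ?(lt_trans ltr01 c1)//.
  by move: c2; rewrite ltr_pdivlMr//; keep_section; lra.
have K0g' : K0%:R `^ ga <= N%:R + 1 :> R.
  by apply: le_trans K0g _; rewrite ler_pdivrMr// ler_peMr// addr_ge0.
have t4 : K0%:R `^ ga / K0%:R * W <= om * q%:R * (2 * N%:R).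
  have KK0 : K%:R <= q%:R * K0%:R :> R by rewrite -natrM ler_nat.
  rewrite /W mulrAC ler_pdivrMr//.
  have -> : om * q%:R * (2 * N%:R) * K0%:R = (2 * N%:R) * (om * (q%:R * K0%:R)) by ring.
  apply: ler_pM; [exact: powR_ge0|exact: W0| |by rewrite ler_pM2l].
  by apply: (le_trans K0g'); move: NR1; keep_section; lra.
have t1 : (K0%:R `^ ga + 1) * H <= e / 6 * N%:R + e / 6 * N%:R.
  have a1 : K0%:R `^ ga * H <= e / 6 * N%:R.
    apply: (@le_trans _ _ ((2 * N%:R) / r%:R * H)).
      rewrite ler_wpM2r ?(le_trans ler01)//; apply: le_trans K0g _.
      by rewrite ler_pM2r ?invr_gt0//; move: NR1; keep_section; lra.
    rewrite mulrAC ler_pdivrMr//.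
    have : N%:R * (12 * H) <= N%:R * (e * r%:R) by rewrite ler_pM2l.
    by keep_section; lra.
  have a2 : H <= e / 6 * N%:R.
    have : 6 * H / e <= N%:R.
      by apply: le_trans (ltW (truncnS_gt _)) _; rewrite ler_nat.
    by rewrite ler_pdivrMr//; keep_section; lra.
  by move: a1 a2; keep_section; lra.
have t3 : N%:R / q%:R <= e / 12 * N%:R.
  rewrite ler_pdivrMr//.
  have : 12 <= e * q%:R.
    rewrite qR; have : r%:R <= r%:R ^+ 2 :> R by rewrite expr2 ler_peMl// ltW.
    move=> rr; have : e * r%:R <= e * r%:R ^+ 2 by rewrite ler_pM2l.
    by move: rH H1; keep_section; lra.
  move=> hq; have : N%:R * 12 <= N%:R * (e * q%:R) by rewrite ler_pM2l.
  by keep_section; lra.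
have zq : q%:R * z = e / 12 / 12 by rewrite /z; field; rewrite gt_eqF.
have oq : om * q%:R = e / 24 by rewrite /om; field; rewrite gt_eqF.
have z1 : z <= e / 12 / 24.
  by have : 2 * z <= q%:R * z by [rewrite ler_pM2r]; rewrite zq; keep_section; lra.
have zN : z * N%:R <= e / 12 / 24 * N%:R by rewrite ler_pM2r.
have t2' : B / central R p.*2 <= e / 12 * N%:R.
  apply: le_trans t2 _; have -> : 12 * q%:R * (z * N%:R) = 12 * (q%:R * z) * N%:R by ring.
  by rewrite zq; keep_section; lra.
rewrite oq in t4.
have total : nrm m (fun x => \sum_(1 <= n < N.+1) F (fpow c n) x - N%:R * h x) <= e * N%:R.
  apply: le_trans main _; rewrite -/H -/K.
  have eN : 0 < e * N%:R by rewrite mulr_gt0.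
  rewrite -[2 * (K0%:R `^ ga / K0%:R) * W]mulrA.
  by move: t1 t2' t3 t4 cenK B2 zN eN; keep_section; lra.
have -> : (fun x => avg (fpow c) T S f g N x - h x) =
  fun x => N%:R^-1 * (\sum_(1 <= n < N.+1) F (fpow c n) x - N%:R * h x).
  by apply: funext => x; rewrite mulrBr mulKf// gt_eqF.
rewrite nrmZ; last by apply: bmB; [apply: bm_sum => k _|exact: bmZ].
by rewrite ger0_norm ?invr_ge0// mulrC ler_pdivrMr.
Qed.

End FractionalPowers.

(** * Probability spaces *)

Section ProbabilityMean.
Variables (d : measure_display) (X : measurableType d) (R : realType) (P : probability X R).

(** Bounded everywhere rather than almost everywhere, since the axioms of [mean] are pointwise. *)
Definition bmeas (u : X -> R) : Prop :=
  measurable_fun setT u /\ exists B : R, forall x, `|u x| <= B.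

Lemma bmeas_integrable u : bmeas u -> P.-integrable setT (EFin \o u).
Proof.
move=> [mu [B uB]]; apply: measurable_bounded_integrable => //.
  exact: le_lt_trans (probability_le1 P measurableT) (ltry 1).
exists B; split; first exact: num_real.
by move=> x Bx y _ /=; exact: le_trans (ltW Bx).
Qed.

Definition prob_mean : mean R X.
Proof.
refine (@Mean R X bmeas (fun u => \int[P]_x u x) _ _ _ _ _ _).
- by move=> c; split; [exact: measurable_cst|exists `|c|].
- move=> u v [mu [A uA]] [mv [B vB]]; split; first exact: measurable_funD.
  by exists (A + B) => x; apply: le_trans (ler_normD _ _) _; exact: lerD.
- move=> u v [mu [A uA]] [mv [B vB]]; split; first exact: measurable_funM.
  by exists (A * B) => x; rewrite normrM ler_pM.
- by move=> u v bu bv; rewrite RintegralD//; exact: bmeas_integrable.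
- by move=> c u bu; rewrite RintegralZl//; exact: bmeas_integrable.
- by move=> u bu u0; apply: Rintegral_ge0 => x _.
Defined.

Lemma prob_mean1 : ex prob_mean (fun=> 1) = 1.
Proof. by rewrite /= Rintegral_cst// mul1r -[RHS]/(fine 1%E) -(probability_setT P). Qed.

Lemma measure_preserving_preserves T : measure_preserving P T -> preserves prob_mean T.
Proof.
move=> [mT hT] u [mu [B uB]].
have bu : bmeas (fun x => u (T x)).
  by split; [exact: measurableT_comp|exists B].
split=> //=; rewrite /Rintegral; congr fine.
have := @integral_pushforward _ _ _ _ R T mT P setT (EFin \o u).
rewrite preimage_setT => <-//; [|exact/measurable_EFinP|exact: (bmeas_integrable bu)].
by apply: eq_measure_integral => A mA _; exact: hT.
Qed.

Lemma measure_preserving_iter T n : measure_preserving P T -> measure_preserving P (iter n T).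
Proof.
move=> [mT hT]; elim: n => [|n [mn hn]]; first by split => //; exact: measurable_id.
split=> [|A mA].
  by apply: (@measurableT_comp _ _ _ _ _ _ T).
rewrite (_ : iter n.+1 T @^-1` A = iter n T @^-1` (T @^-1` A))// hn ?hT//.
by rewrite -[X in measurable X]setTI; exact: mT.
Qed.

Lemma Lnorm2E u : bmeas u -> Lnorm P 2%:E (fun x => (u x)%:E) = (nrm prob_mean u)%:E.
Proof.
move=> bu; rewrite unlock.
have -> : (\int[P]_x (`|(u x)%:E| `^ 2))%E = (\int[P]_x (u x ^+ 2))%:E.
  rewrite /Rintegral fineK; last first.
    by apply: integrable_fin_num => //; exact: (bmeas_integrable (bmX (m := prob_mean) 2 bu)).
  apply: eq_integral => x _; rewrite abse_EFin poweR_EFin powR_mulrn//.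
  by rewrite real_normK ?num_real.
by rewrite poweR_EFin powR12_sqrt//; apply: Rintegral_ge0 => x _; exact: sqr_ge0.
Qed.

Lemma bmeas_norm u : bmeas u -> bmeas (fun x => `|u x|).
Proof.
move=> [mu [B uB]]; split; last by exists B => x; rewrite normr_id.
exact: measurableT_comp.
Qed.

Lemma limn_sup_dist (w : nat -> R) (s : R) (j : nat) : (forall k, `|w k| <= 1) ->
  (forall n, (j <= n)%N -> `|w n - w j| <= s) -> `|w j - limn_sup w| <= s.
Proof.
move=> w1 ws.
have bw : bounded_fun w.
  by exists 1; split; [exact: num_real|move=> x x1 k _ /=; exact: le_trans (ltW x1)].
have ub n : has_sup [set w k | k in [set k | (n <= k)%N]].
  split; first by exists (w n), n => /=.
  by exists 1 => _ [k _ <-]; exact: le_trans (ler_norm _) (w1 k).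
have lo n : w j - s <= sups w n.
  apply: (@le_trans _ _ (w (maxn n j))).
    have := ws (maxn n j) (leq_maxr _ _); rewrite ler_norml => /andP[h _]; lra.
  by apply: ub_le_sup; [exact: (ub n).2|exists (maxn n j) => //=; exact: leq_maxl].
have hi : sups w j <= w j + s.
  apply: ge_sup; first exact: (ub j).1.
  move=> _ [k jk <-]; have := ws k jk; rewrite ler_norml => /andP[_ h]; lra.
rewrite limn_supE//.
have h1 : w j - s <= inf (range (sups w)).
  by apply: lb_le_inf; [exists (sups w 0%N), 0%N|move=> _ [n _ <-]; exact: lo].
have h2 : inf (range (sups w)) <= sups w j.
  by apply: ge_inf; [exists (w j - s) => _ [n _ <-]; exact: lo|exists j].
rewrite ler_norml; apply/andP; split; lra.
Qed.

(** A subsequence with gaps [2^-k] has increments summable in mean, and uniform bounds turn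
    convergence in mean into convergence in [nrm]. *)
Lemma bounded_cauchy_limit (u : nat -> X -> R) :
  (forall n, bmeas (u n)) -> (forall n x, `|u n x| <= 1) ->
  (forall e : R, 0 < e -> exists M, forall N N', (M <= N)%N -> (M <= N')%N ->
     nrm prob_mean (fun x => u N x - u N' x) <= e) ->
  exists2 h, bmeas h & forall e : R, 0 < e -> exists M, forall N, (M <= N)%N ->
     nrm prob_mean (fun x => u N x - h x) <= e.
Proof.
move=> bu u1 cau.
have m1 := prob_mean1.
have cau' k : exists M, forall N N', (M <= N)%N -> (M <= N')%N ->
     nrm prob_mean (fun x => u N x - u N' x) <= 2^-1 ^+ k.
  by apply: cau; rewrite exprn_gt0// invr_gt0.
have [phi0 hphi0] := choice cau'.
pose phi k := (\max_(i < k.+1) phi0 i)%N.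
have phi_ge k : (phi0 k <= phi k)%N by exact: (@leq_bigmax _ (fun i : 'I_k.+1 => phi0 i) ord_max).
have phiS k : (phi k <= phi k.+1)%N by rewrite /phi [X in (_ <= X)%N]big_ord_recr /= leq_maxl.
have hphi k N N' : (phi k <= N)%N -> (phi k <= N')%N ->
     nrm prob_mean (fun x => u N x - u N' x) <= 2^-1 ^+ k.
  by move=> h1 h2; apply: hphi0; exact: leq_trans (phi_ge k) _.
pose w k := u (phi k).
have bw k : bmeas (w k) by exact: bu.
have w1 k x : `|w k x| <= 1 by exact: u1.
(* The upper limit is defined everywhere, measurable and bounded, so no exceptional set has to be
   handled. *)
pose h x := limn_sup (fun k => w k x).
have mh : measurable_fun setT h.
  apply: (@measurable_fun_limn_sup _ _ _ setT w).
  - by move=> x _; exists 1 => _ [k _ <-]; exact: le_trans (ler_norm _) (w1 k x).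
  - move=> x _; exists (- 1) => _ [k _ <-]; have := w1 k x.
    by rewrite ler_norml => /andP[].
  - by move=> k; case: (bw k).
have h3 x : `|h x| <= 3.
  have : `|w 0%N x - h x| <= 2.
    apply: limn_sup_dist => // n _; apply: le_trans (ler_normB _ _) _.
    have := lerD (w1 n x) (w1 0%N x); lra.
  move=> h2; rewrite (_ : h x = w 0%N x - (w 0%N x - h x)); last by ring.
  apply: le_trans (ler_normB _ _) _; have := w1 0%N x; lra.
have bh : bmeas h by split=> //; exists 3.
have L1 j : ex prob_mean (fun x => `|w j x - h x|) <= 2 * 2^-1 ^+ j.
  pose G k x := (`|w (j + k).+1 x - w (j + k)%N x|)%:E.
  have bG k : bmeas (fun x => `|w (j + k).+1 x - w (j + k)%N x|).
    by apply: bmeas_norm; exact: (bmB (m := prob_mean) (bw _) (bw _)).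
  have mG k : measurable_fun setT (G k) by apply/measurable_EFinP; case: (bG k).
  have G0 k x : (0 <= G k x)%E by rewrite lee_fin.
  have bwh : bmeas (fun x => `|w j x - h x|).
    by apply: bmeas_norm; exact: (bmB (m := prob_mean) (bw _) bh).
  have ptw x : ((`|w j x - h x|)%:E <= \sum_(0 <= k <oo) G k x)%E.
    have part n : (\sum_(0 <= k < n) G k x <= \sum_(0 <= k <oo) G k x)%E.
      by apply: nneseries_lim_ge => k _ _.
    (* Where the sum of the increments is infinite the bound is trivial. *)
    move: part; case: (\sum_(0 <= k <oo) G k x)%E => [s| |] part.
    - rewrite lee_fin; apply: limn_sup_dist => // n jn.
      have := part (n - j)%N; rewrite sumEFin lee_fin; apply: le_trans.
      have -> : w n x - w j x = \sum_(0 <= k < n - j) (w (j + k).+1 x - w (j + k)%N x).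
        under eq_bigr do rewrite -addnS.
        by rewrite (telescope_sumr (fun k => w (j + k)%N x))// subnKC// addn0.
      exact: ler_norm_sum.
    - exact: leey.
    - by have := part 0%N; rewrite big_geq// leeNy_eq.
  have Gk k : (\int[P]_x G k x)%E = (ex prob_mean (fun x => `|w (j + k).+1 x - w (j + k)%N x|))%:E.
    by rewrite /= /Rintegral fineK//; apply: integrable_fin_num => //; exact: bmeas_integrable.
  have Gsmall k : ex prob_mean (fun x => `|w (j + k).+1 x - w (j + k)%N x|) <= 2^-1 ^+ (j + k).
    have bd : bm prob_mean (fun x => `|w (j + k).+1 x - w (j + k)%N x|) := bG k.
    apply: (@le_trans _ _ (nrm prob_mean (fun x => `|w (j + k).+1 x - w (j + k)%N x|))).
      have := cauchy_schwarz_ex bd (bm_cst prob_mean 1).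
      under eq_fun do rewrite mulr1.
      by rewrite nrm_cst// normr1 mulr1.
    rewrite /nrm; under eq_fun do rewrite real_normK ?num_real//.
    by apply: hphi => //; exact: phiS.
  rewrite -lee_fin.
  have -> : (ex prob_mean (fun x => `|w j x - h x|))%:E = (\int[P]_x (`|w j x - h x|)%:E)%E.
    by rewrite /= /Rintegral fineK//; apply: integrable_fin_num => //; exact: bmeas_integrable.
  apply: (@le_trans _ _ (\int[P]_x \sum_(0 <= k <oo) G k x)%E).
    apply: ge0_le_integral => //.
    - by apply/measurable_EFinP; case: bwh.
    - by apply: ge0_emeasurable_sum => // k x _ _.
  rewrite integral_nneseries//.
  apply: lime_le; first by apply: is_cvg_nneseries => k _ _; apply: integral_ge0 => x _.
  apply: nearW => n; under eq_bigr do rewrite Gk.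
  rewrite sumEFin lee_fin.
  apply: (@le_trans _ _ (\sum_(0 <= k < n) 2^-1 ^+ (j + k))); first exact: ler_sum.
  suff : \sum_(0 <= k < n) 2^-1 ^+ (j + k) <= 2 * 2^-1 ^+ j - 2 * 2^-1 ^+ (j + n) :> R.
    by have : 0 <= 2^-1 ^+ (j + n) :> R by [exact: exprn_ge0]; lra.
  elim: n => [|n IH]; first by rewrite big_geq// addn0 subrr.
  rewrite big_nat_recr//= addnS exprS; lra.
exists h => // e e0.
(* 12 = 4 * (1 + 2): [|u N - h|] is at most [1 + 3], and its mean is at most [(1 + 2) 2^-j]. *)
have [j hj] : exists j, 12 * 2^-1 ^+ j <= e ^+ 2 :> R.
  have [j hj] := @powR_nat_unbounded R (12 / e ^+ 2) 1 ltr01; exists j.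
  have hj2 := hj j (leqnn j); rewrite powRr1// ler_pdivrMr ?exprn_gt0// in hj2.
  rewrite exprVn ler_pdivrMr ?exprn_gt0//.
  have : j%:R <= 2 ^+ j :> R by rewrite -natrX ler_nat ltnW// ltn_expl.
  have := exprn_gt0 2 e0; nra.
exists (phi j) => N jN.
have bN : bm prob_mean (fun x => u N x - h x) := bmB (m := prob_mean) (bu N) bh.
have bNj : bm prob_mean (fun x => `|u N x - w j x|) := bmeas_norm (bmB (m := prob_mean) (bu N) (bw j)).
have bjh : bm prob_mean (fun x => `|w j x - h x|) := bmeas_norm (bmB (m := prob_mean) (bw j) bh).
rewrite -(@ler_sqr R) ?nnegrE ?nrm_ge0 ?(ltW e0)// nrm_sq//.
apply: le_trans hj.
have q1 : ex prob_mean (fun x => `|u N x - w j x|) <= 2^-1 ^+ j.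
  apply: (@le_trans _ _ (nrm prob_mean (fun x => `|u N x - w j x|))).
    have := cauchy_schwarz_ex bNj (bm_cst prob_mean 1).
    under eq_fun do rewrite mulr1.
    by rewrite nrm_cst// normr1 mulr1.
  rewrite /nrm; under eq_fun do rewrite real_normK ?num_real//.
  exact: hphi.
apply: (@le_trans _ _ (ex prob_mean (fun x => 4 * (`|u N x - w j x| + `|w j x - h x|)))).
  apply: le_ex; [exact: bmX|by apply: bmZ; exact: bmD|].
  move=> x; rewrite -real_normK ?num_real// expr2; apply: ler_pM => //.
    apply: le_trans (ler_normB _ _) _; have := u1 N x; have := h3 x; lra.
  by have := ler_normD (u N x - w j x) (w j x - h x); rewrite addrA subrK.
rewrite exZ; last exact: bmD.
rewrite exD//; have := L1 j; lra.
Qed.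

End ProbabilityMean.

(** * Reduction to functions bounded by one everywhere *)

Section Truncation.
Variables (d : measure_display) (X : measurableType d) (R : realType) (P : probability X R).

Lemma Linfty_ae_bound (f : X -> R) : Linfty P f ->
  exists2 B : R, 0 < B & \forall x \ae P, `|f x| <= B.
Proof.
move=> [mf]; rewrite unlock.
have P0 : (0 < P [set: X])%E by rewrite (probability_setT P) lte01.
rewrite P0 => fin.
have [B hB] : exists B : R, (ess_sup P (abse \o (EFin \o f)) <= B%:E)%E.
  move: fin; case: (ess_sup P _) => [r _|//|_]; first by exists r.
  by exists 0; rewrite leNye.
exists (`|B| + 1); first by rewrite ltr_wpDl.
have /ess_supP : (ess_sup P (abse \o (EFin \o f)) <= (`|B| + 1)%:E)%E.
  by apply: le_trans hB _; rewrite lee_fin; have := ler_norm B; lra.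
by apply: filterS => x; rewrite /= lee_fin.
Qed.

(** Clamping [f / B] to [[-1, 1]] changes it only on a null set and supplies the bound at every
    point. *)
Lemma Linfty_truncation (f : X -> R) : Linfty P f ->
  exists (B : R) (f' : X -> R), [/\ 0 < B, bmeas f', forall x, `|f' x| <= 1 &
    \forall x \ae P, f x = B * f' x].
Proof.
move=> lf; have [B B0 fB] := Linfty_ae_bound lf; have [mf _] := lf.
pose f' x := Num.max (- 1) (Num.min 1 (f x / B)).
have f1 x : `|f' x| <= 1.
  by rewrite /f' ler_norml le_max lexx /= ge_max ge_min lexx andbT; lra.
exists B, f'; split => //.
  split; last by exists 1.
  apply: measurable_maxr; first exact: measurable_cst.
  apply: measurable_minr; first exact: measurable_cst.
  by apply: measurable_funM => //; exact: measurable_cst.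
apply: filterS fB => x; rewrite ler_norml => /andP[h1 h2].
have h3 : f x / B <= 1 by rewrite ler_pdivrMr// mul1r.
have h4 : - 1 <= f x / B by rewrite ler_pdivlMr// mulN1r.
by rewrite /f' (min_idPr h3) (max_idPr h4) mulrC divfK// gt_eqF.
Qed.

(** Preimages of a null set are null, and countably many of them form one exceptional set. *)
Lemma ae_iter (T : X -> X) (Q : X -> Prop) : measure_preserving P T ->
  (\forall x \ae P, Q x) -> \forall x \ae P, forall n, Q (iter n T x).
Proof.
move=> mT [A [mA A0 QA]]; apply: ae_foralln => n.
have [mn hn] := measure_preserving_iter n mT.
exists (iter n T @^-1` A); split.
- by rewrite -[X in measurable X]setTI; exact: mn.
- by rewrite hn.
- by move=> x nQ; exact: QA.
Qed.

Lemma measurable_avg (a : nat -> nat) (T S : X -> X) (f g : X -> R) N :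
  measure_preserving P T -> measure_preserving P S ->
  measurable_fun setT f -> measurable_fun setT g -> measurable_fun setT (avg a T S f g N).
Proof.
move=> mT mS mf mg; apply: measurable_funM; first exact: measurable_cst.
apply: measurable_sum => n; apply: measurable_funM.
  by apply: measurableT_comp => //; case: (measure_preserving_iter (a n) mT).
by apply: measurableT_comp => //; case: (measure_preserving_iter (a n) mS).
Qed.

Lemma Lnorm2_ae (u v : X -> R) : measurable_fun setT u -> measurable_fun setT v ->
  (\forall x \ae P, u x = v x) ->
  Lnorm P 2%:E (fun x => (u x)%:E) = Lnorm P 2%:E (fun x => (v x)%:E).
Proof.
move=> mu mv uv; rewrite unlock; congr (_ `^ _)%E.
have sqE (w : X -> R) x : (`|(w x)%:E| `^ 2)%E = (w x ^+ 2)%:E.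
  by rewrite abse_EFin poweR_EFin powR_mulrn// real_normK ?num_real.
under eq_integral do rewrite sqE.
under [in RHS]eq_integral do rewrite sqE.
apply: ge0_ae_eq_integral => //.
- by apply/measurable_EFinP; exact: measurable_funX.
- by apply/measurable_EFinP; exact: measurable_funX.
- by move=> x _; rewrite lee_fin sqr_ge0.
- by move=> x _; rewrite lee_fin sqr_ge0.
- by apply: filterS uv => x -> _.
Qed.

End Truncation.

Theorem theorem1p1 (R : realType) (c : R) (hc1 : 1 < c) (hc2 : c < 23%:R / 22%:R)
  (d : measure_display) (X : measurableType d) (P : probability X R)
  (T S : X -> X) (hT : measure_preserving P T) (hS : measure_preserving P S)
  (hTS : T \o S = S \o T) (f g : X -> R) (hf : Linfty P f) (hg : Linfty P g) :
  exists h : X -> R, L2 P h /\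
    L2_cvg P (avg (fun n => floorn (n%:R `^ c)) T S f g) h /\
    L2_cvg P (avg (fun n => n) T S f g) h.
Proof.
have [A [f' [A0 bf f1 fE]]] := Linfty_truncation hf.
have [B [g' [B0 bg g1 gE]]] := Linfty_truncation hg.
have TS x : T (S x) = S (T x) by have := congr1 (fun F => F x) hTS.
have pT := measure_preserving_preserves hT; have pS := measure_preserving_preserves hS.
have m1 := prob_mean1 P.
pose m := prob_mean P.
have bA a N : bmeas (avg a T S f' g' N) by exact: (bm_avg (m := m) pT pS a N bf bg).
have A1 a N x : `|avg a T S f' g' N x| <= 1.
  by rewrite -[leRHS]mulr1; exact: avg_bound.
have [h bh hcvg] := bounded_cauchy_limit (bA (fun n => n)) (A1 (fun n => n))
  (cesaro_cauchy m1 pT pS TS bf bg f1 g1).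
have fcvg := fractional_cesaro m1 pT pS TS bf bg f1 g1 hc1 hc2 bh hcvg.
have bCh : bmeas (fun x => A * B * h x) by exact: (bmZ (m := m) (A * B) bh).
(* For either sequence of exponents, the averages of [f] and [g] are almost everywhere [A * B] times
   those of the truncations. *)
have transfer a : (forall e : R, 0 < e -> exists M, forall N, (M <= N)%N ->
    nrm m (fun x => avg a T S f' g' N x - h x) <= e) ->
  L2_cvg P (avg a T S f g) (fun x => A * B * h x).
  move=> acvg.
  have LE N : Lnorm P 2%:E (fun x => (avg a T S f g N x - A * B * h x)%:E) =
      (A * B * nrm m (fun x => avg a T S f' g' N x - h x))%:E.
    have bdiff : bmeas (fun x => avg a T S f' g' N x - h x) by exact: (bmB (m := m) (bA a N) bh).
    rewrite (@Lnorm2_ae _ _ _ P _ (fun x => A * B * (avg a T S f' g' N x - h x))).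
    - rewrite Lnorm2E; last exact: (bmZ (m := m) (A * B) bdiff).
      by rewrite (nrmZ (m := m) _ bdiff) ger0_norm// mulr_ge0// ltW.
    - apply: measurable_funB; last by case: bCh.
      by apply: (measurable_avg _ _ hT hS); [case: hf|case: hg].
    - by case: (bmZ (m := m) (A * B) bdiff).
    - have fT := ae_iter hT fE; have gS := ae_iter hS gE.
      apply: filterS2 fT gS => x fT gS.
      rewrite mulrBr; congr (_ - _); rewrite /avg mulrCA; congr (_ * _).
      by rewrite mulr_sumr; apply: eq_bigr => n _; rewrite fT gS; ring.
  rewrite /L2_cvg (_ : (fun N => _) = EFin \o (fun N => A * B * nrm m (fun x => avg a T S f' g' N x - h x))); last first.
    by apply: funext => N; rewrite LE.
  apply: cvg_EFin; first by near=> N.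
  apply/cvgrPdist_le => e e0.
  have [M hM] := acvg (e / (A * B)) ltac:(by rewrite divr_gt0// mulr_gt0).
  exists M => // N /= MN; rewrite sub0r normrN ger0_norm; last first.
    by rewrite mulr_ge0 ?nrm_ge0// mulr_ge0// ltW.
  by rewrite mulrC -ler_pdivlMr ?mulr_gt0// hM.
exists (fun x => A * B * h x); split; [|split].
- by split; [case: bCh|rewrite [X in (X < _)%E](Lnorm2E P bCh) ltry].
- exact: transfer.
- exact: transfer.
Unshelve. all: by end_near. Qed.
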